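(* Consider the Dynamic Vector Bin Packing (DVBP) problem, defined in the context. There is an algorithm that, given a DVBP instance with $n$ requests and height $h$, together with a number $k\in\mathbb{N}$, decides whether the requests can be partitioned into $k$ bins satisfying the capacity constraint at every time instant, in $O(k^{2h}\cdot n+n\log n)$ time.
   Context: An instance of DVBP consists of a dimension $d$, a bin capacity $b\in\mathbb{N}^d$, requests $a^{(1)},\dots,a^{(n)}\in\mathbb{N}^d$, start times $r_1,\dots,r_n\in\mathbb{N}$ and end times $d_1,\dots,d_n\in\mathbb{N}$. Request $i$ is active at time instant $t\in\mathbb{N}$ if $r_i\le t<d_i$. A feasible solution is a partition of $\{1,\dots,n\}$ into bins $B_1,\dots,B_k$ such that for every time instant $t\in\mathbb{N}$ and every bin $B_j$, $\sum_{i\in B_j,\ r_i\le t<d_i} a^{(i)}\le b$ component-wise; the objective is to minimize the number $k$ of bins. The height $h$ of an instance is the maximum number of requests active at the same time instant.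
   Formalization: The dimension d is treated as fixed: for each d there is an algorithm, and the O-constant may depend on d (a bound free of d cannot even cover reading the 2d numbers when n = k = h = 1); an additive constant is also allowed in the time bound for tiny inputs such as n = 1, k = 0. *)

(* Defs.v *)
From Stdlib Require Import Arith List Bool.
Import ListNotations.

(* An instance: n requests indexed 0..n-1; only indices i < n and
   components c < d are meaningful. *)
Record instance := Instance {
  n_req : nat;
  cap   : nat -> nat;             (* b_c, c < d *)
  size  : nat -> nat -> nat;      (* size i c = a^(i)_c *)
  start : nat -> nat;
  fin   : nat -> nat
}.

Definition activeb (I : instance) (i t : nat) : bool :=
  (start I i <=? t) && (t <? fin I i).

Definition sum_over (l : list nat) (g : nat -> nat) : nat :=
  fold_right (fun i acc => g i + acc) 0 l.

Definition feasible (d : nat) (I : instance) (k : nat) : Prop :=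
  exists f : nat -> nat,
    (forall i, i < n_req I -> f i < k) /\
    (forall t j c, j < k -> c < d ->
       sum_over (filter (fun i => (f i =? j) && activeb I i t) (seq 0 (n_req I)))
                (fun i => size I i c) <= cap I c).

Definition num_active (I : instance) (t : nat) : nat :=
  length (filter (fun i => activeb I i t) (seq 0 (n_req I))).

Definition is_height (I : instance) (h : nat) : Prop :=
  (forall t, num_active I t <= h) /\ (exists t, num_active I t = h).

Inductive instr :=
| IConst (a c : nat)
| IAdd (a b c : nat)
| ISub (a b c : nat)
| ILoad (a b : nat)
| IStore (a b : nat)
| IJle (a b l : nat)
| IHalt.

Definition program := list instr.
Definition memory := nat -> nat.

Definition upd (m : memory) (a v : nat) : memory :=
  fun x => if x =? a then v else m x.

Definition step (p : program) (cfg : nat * memory) : option (nat * memory) :=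
  let (pc, m) := cfg in
  match nth_error p pc with
  | None | Some IHalt => None
  | Some (IConst a c) => Some (S pc, upd m a c)
  | Some (IAdd a b c) => Some (S pc, upd m a (m b + m c))
  | Some (ISub a b c) => Some (S pc, upd m a (m b - m c))
  | Some (ILoad a b) => Some (S pc, upd m a (m (m b)))
  | Some (IStore a b) => Some (S pc, upd m (m a) (m b))
  | Some (IJle a b l) => Some (if m a <=? m b then l else S pc, m)
  end.

Inductive runs (p : program) : nat * memory -> nat -> nat * memory -> Prop :=
| runs_halt cfg : step p cfg = None -> runs p cfg 0 cfg
| runs_step cfg cfg' s cfg'' :
    step p cfg = Some cfg' -> runs p cfg' s cfg'' -> runs p cfg (S s) cfg''.

(* Input encoding: M[0] = n, M[1] = k, M[2..d+1] = b, and request i occupies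
   the block of d+2 cells starting at d+2+i*(d+2): a^(i)_0..a^(i)_{d-1}, r_i, d_i.
   All other cells are 0. *)
Definition encode (d : nat) (I : instance) (k : nat) : memory :=
  fun x =>
    if x =? 0 then n_req I
    else if x =? 1 then k
    else if x <? d + 2 then cap I (x - 2)
    else
      let y := x - (d + 2) in
      let i := y / (d + 2) in
      let c := y mod (d + 2) in
      if i <? n_req I then
        (if c <? d then size I i c
         else if c =? d then start I i
         else fin I i)
      else 0.

(* Main.v *)
Require Import Defs.
From Stdlib Require Import Arith List Bool Lia Permutation Sorted.
Import ListNotations.

(** Only requests with a nonempty activity interval matter.  If they are inserted in the order
    of their start times, a bin can become overfull for the first time only when the newest
    request starts, so it suffices to check each request once, against the earlier requests that
    are still alive at its start.  For [k >= 2] a dynamic program scans the sorted requests and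
    keeps the set of bin assignments of the alive requests that extend to the past; such an
    assignment is a list of at most [h] bins, stored as a base-[k] number below [k^h].
    Turning one number into its successors costs [O(k^h)] (decoding is by repeated subtraction,
    and [k * h <= k^h]), hence [O(k^(2h))] per request.  For [k = 1] even an [O(h)] step is too
    expensive; there the load of the single bin is maintained by scanning the requests sorted by
    start and by end in parallel.  Merge sort accounts for [n log n].

    The algorithms are written in a small language of bounded loops over variables and arrays,
    with a clock, which is compiled to the RAM at the price of a constant factor. *)

(** * Bounded-loop programs and their compilation *)

Inductive op :=
| OConst (x c : nat)
| OAdd (x y z : nat)
| OSub (x y z : nat)
| OLd (x a i : nat)
| OSt (a i x : nat)
| OInp (x y : nat).

Inductive cmd :=
| Skip
| Op (o : op)
| Seq (c1 c2 : cmd)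
| Ifle (x y : nat) (c1 c2 : cmd)
| For (x y : nat) (c : cmd).

Record st := St { vars : nat -> nat; arrs : nat -> nat -> nat; clk : nat }.

(* On the RAM, cell 0 is scratch, cell 1 holds the address [lim] of the arrays and cell [x + 2]
   holds variable [x < NV]; entry [i] of array [a < NA] is at address [lim + NA * i + a].
   Array 0 is read-only: it keeps the first [R = NV + 2] input words, whose cells become registers. *)
Definition NV := 40.
Definition R := 42.
Definition NA := 13.

Definition setv (x v : nat) (s : st) : st :=
  St (upd (vars s) x v) (arrs s) (S (clk s)).

Definition aupd (f : nat -> nat) (i v : nat) : nat -> nat := fun x => if x =? i then v else f x.

Definition seta (a i v : nat) (s : st) : st :=
  St (vars s) (fun b => if b =? a then aupd (arrs s a) i v else arrs s b) (S (clk s)).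

Definition tick (s : st) : st := St (vars s) (arrs s) (S (clk s)).

Fixpoint wrv (c : cmd) (x : nat) : bool :=
  match c with
  | Skip => false
  | Op (OConst y _) | Op (OAdd y _ _) | Op (OSub y _ _) | Op (OLd y _ _) | Op (OInp y _) => x =? y
  | Op (OSt _ _ _) => false
  | Seq a b | Ifle _ _ a b => wrv a x || wrv b x
  | For y _ b => (x =? y) || wrv b x
  end.

Fixpoint wra (c : cmd) (x : nat) : bool :=
  match c with
  | Op (OSt a _ _) => x =? a
  | Skip | Op _ => false
  | Seq a b | Ifle _ _ a b => wra a x || wra b x
  | For _ _ b => wra b x
  end.

Definition wf_op (o : op) : bool :=
  match o with
  | OConst x _ => x <? NV
  | OAdd x y z | OSub x y z => (x <? NV) && (y <? NV) && (z <? NV)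
  | OLd x a i => (x <? NV) && (a <? NA) && (i <? NV)
  | OSt a i x => (x <? NV) && (a <? NA) && (0 <? a) && (i <? NV)
  | OInp x y => (x <? NV) && (y <? NV)
  end.

(* Loop variable and bound must not be written in the body; [eval] iterates a number of times
   fixed on entry, while the compiled code tests the bound again before each iteration. *)
Fixpoint wf (c : cmd) : bool :=
  match c with
  | Skip => true
  | Op o => wf_op o
  | Seq a b => wf a && wf b
  | Ifle x y a b => (x <? NV) && (y <? NV) && wf a && wf b
  | For x y b => (x <? NV) && (y <? NV) && negb (x =? y) && negb (wrv b x) && negb (wrv b y) && wf b
  end.

Section Semantics.
Variables (inp : nat -> nat) (lim : nat).

(* An address beyond the input belongs to one of the interleaved arrays. *)
Definition raw (s : st) (v : nat) : nat :=
  if v <? lim then inp v else arrs s ((v - lim) mod NA) ((v - lim) / NA).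

Definition eop (o : op) (s : st) : st :=
  match o with
  | OConst x c => setv x c s
  | OAdd x y z => setv x (vars s y + vars s z) s
  | OSub x y z => setv x (vars s y - vars s z) s
  | OLd x a i => setv x (arrs s a (vars s i)) s
  | OSt a i x => seta a (vars s i) (vars s x) s
  | OInp x y => setv x (raw s (vars s y)) s
  end.

Fixpoint eval (c : cmd) (s : st) : st :=
  match c with
  | Skip => s
  | Op o => eop o s
  | Seq a b => eval b (eval a s)
  | Ifle x y a b => if vars s x <=? vars s y then eval a (tick s) else eval b (tick s)
  | For x y b =>
      nat_rect (fun _ => st) (setv x 0 s) (fun i s1 => setv x (S i) (eval b s1)) (vars s y)
  end.

Lemma eval_seq a b s : eval (Seq a b) s = eval b (eval a s).
Proof. reflexivity. Qed.

Lemma eval_op o s : eval (Op o) s = eop o s.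
Proof. reflexivity. Qed.

Lemma eval_ifle x y a b s :
  eval (Ifle x y a b) s = if vars s x <=? vars s y then eval a (tick s) else eval b (tick s).
Proof. reflexivity. Qed.

Definition frame (c : cmd) (s s' : st) : Prop :=
  (forall x, wrv c x = false -> vars s' x = vars s x) /\
  (forall a, wra c a = false -> arrs s' a = arrs s a) /\ clk s <= clk s'.

Lemma upd_eq (m : memory) (a v : nat) : upd m a v a = v.
Proof. unfold upd. now rewrite Nat.eqb_refl. Qed.

Lemma upd_neq (m : memory) (a v x : nat) : x <> a -> upd m a v x = m x.
Proof. unfold upd. intros H. now destruct (Nat.eqb_spec x a). Qed.

Lemma aupd_eq f i v : aupd f i v i = v.
Proof. unfold aupd. now rewrite Nat.eqb_refl. Qed.

Lemma aupd_neq f i v x : x <> i -> aupd f i v x = f x.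
Proof. unfold aupd. intros H. now destruct (Nat.eqb_spec x i). Qed.

Lemma eval_frame (c : cmd) : forall s, frame c s (eval c s).
Proof.
  induction c as [|o|a IHa b IHb|x y a IHa b IHb|x y b IHb]; intros s.
  - repeat split; auto.
  - destruct o; cbn [eval eop]; repeat split; cbn; auto; intros w Hw;
      try (unfold upd; now rewrite Hw); now rewrite Hw.
  - cbn [eval]. destruct (IHa s) as (A1 & A2 & A3), (IHb (eval a s)) as (B1 & B2 & B3).
    repeat split; [| |lia]; intros z Hz; cbn in Hz; apply orb_false_iff in Hz as [? ?].
    + rewrite B1, A1; auto.
    + rewrite B2, A2; auto.
  - cbn [eval]. destruct (vars s x <=? vars s y).
    + destruct (IHa (tick s)) as (A1 & A2 & A3). cbn in A3.
      repeat split; [| |lia]; intros z Hz; cbn in Hz; apply orb_false_iff in Hz as [? ?].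
      * rewrite A1; auto.
      * rewrite A2; auto.
    + destruct (IHb (tick s)) as (A1 & A2 & A3). cbn in A3.
      repeat split; [| |lia]; intros z Hz; cbn in Hz; apply orb_false_iff in Hz as [? ?].
      * rewrite A1; auto.
      * rewrite A2; auto.
  - cbn [eval]. induction (vars s y) as [|n IHn]; cbn [nat_rect].
    + repeat split; cbn; auto. intros z Hz; apply orb_false_iff in Hz as [Hz ?].
      unfold upd. now rewrite Hz.
    + destruct IHn as (A1 & A2 & A3).
      set (s1 := nat_rect _ _ _ n) in *.
      destruct (IHb s1) as (B1 & B2 & B3).
      repeat split; cbn.
      * intros z Hz. pose proof (A1 z Hz) as A1z. apply orb_false_iff in Hz as [Hz ?].
        unfold upd. rewrite Hz. rewrite B1; auto.
      * intros z Hz. rewrite B2; auto.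
      * lia.
Qed.

Lemma eval_for (x y : nat) (b : cmd) (Inv : nat -> st -> Prop) (s : st) :
  Inv 0 (setv x 0 s) ->
  (forall i s1, i < vars s y -> Inv i s1 -> vars s1 x = i -> frame (For x y b) s s1 ->
     Inv (S i) (setv x (S i) (eval b s1))) ->
  Inv (vars s y) (eval (For x y b) s).
Proof.
  intros H0 HS. cbn [eval].
  set (it := nat_rect (fun _ => st) (setv x 0 s) (fun i s1 => setv x (S i) (eval b s1))).
  assert (forall n, n <= vars s y -> Inv n (it n) /\ vars (it n) x = n /\ frame (For x y b) s (it n))
    as H; [|apply H; lia].
  induction n as [|n IH]; intros Hn.
  - cbn. rewrite upd_eq. repeat split; auto; cbn; auto. intros z Hz.
    apply orb_false_iff in Hz as [Hz _]. unfold upd. now rewrite Hz.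
  - destruct (IH ltac:(lia)) as (A & B & C). cbn [nat_rect it]. repeat split.
    + apply HS; auto.
    + cbn. now rewrite upd_eq.
    + cbn. intros z Hz. rewrite <- (proj1 C z Hz). apply orb_false_iff in Hz as [Hz Hz'].
      unfold upd. rewrite Hz. now apply eval_frame.
    + cbn. intros z Hz. rewrite <- (proj1 (proj2 C) z Hz). now apply eval_frame.
    + cbn. destruct C as (_ & _ & C). pose proof (proj2 (proj2 (eval_frame b (it n)))). unfold it in *. lia.
Qed.

Definition cell (x : nat) : nat := S (S x).

Definition address (a i : nat) : program :=
  IConst 0 a :: IAdd 0 0 1 :: repeat (IAdd 0 0 (cell i)) NA.

Definition compile_op (off : nat) (o : op) : program :=
  match o with
  | OConst x c => [IConst (cell x) c]
  | OAdd x y z => [IAdd (cell x) (cell y) (cell z)]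
  | OSub x y z => [ISub (cell x) (cell y) (cell z)]
  | OLd x a i => address a i ++ [ILoad (cell x) 0]
  | OSt a i x => address a i ++ [IStore 0 (cell x)]
  | OInp x y =>
      [IConst 0 R; IJle 0 (cell y) (off + (NA + 6))] ++ address 0 y ++
      [ILoad (cell x) 0; IJle 0 0 (off + (NA + 7)); ILoad (cell x) (cell y)]
  end.

Fixpoint code_size (c : cmd) : nat :=
  match c with
  | Skip => 0
  | Op o => length (compile_op 0 o)
  | Seq a b => code_size a + code_size b
  | Ifle _ _ a b => 2 + code_size b + code_size a
  | For _ _ b => 5 + code_size b
  end.

Fixpoint compile (off : nat) (c : cmd) : program :=
  match c with
  | Skip => []
  | Op o => compile_op off o
  | Seq a b => compile off a ++ compile (off + code_size a) b
  | Ifle x y a b =>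
      [IJle (cell x) (cell y) (off + (2 + code_size b))] ++ compile (off + 1) b ++
      [IJle 0 0 (off + code_size c)] ++ compile (off + (2 + code_size b)) a
  | For x y b =>
      [IConst (cell x) 0; IJle (cell y) (cell x) (off + code_size c)] ++ compile (off + 2) b ++
      [IConst 0 1; IAdd (cell x) (cell x) 0; IJle 0 0 (off + 1)]
  end.

Lemma compile_length (c : cmd) : forall off, length (compile off c) = code_size c.
Proof.
  induction c as [|o|a IHa b IHb|x y a IHa b IHb|x y b IHb]; intros off; cbn [compile code_size].
  - reflexivity.
  - now destruct o.
  - now rewrite length_app, IHa, IHb.
  - rewrite !length_app, IHa, IHb. cbn. lia.
  - rewrite !length_app, IHb. cbn. lia.
Qed.

Inductive steps (p : program) : nat * memory -> nat -> nat * memory -> Prop :=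
| steps_refl cfg : steps p cfg 0 cfg
| steps_step cfg cfg' n cfg'' :
    step p cfg = Some cfg' -> steps p cfg' n cfg'' -> steps p cfg (S n) cfg''.

Lemma steps_trans p c1 n1 c2 n2 c3 :
  steps p c1 n1 c2 -> steps p c2 n2 c3 -> steps p c1 (n1 + n2) c3.
Proof. induction 1; cbn; auto. intros. econstructor; eauto. Qed.

Lemma steps_runs p c1 n1 c2 n2 c3 :
  steps p c1 n1 c2 -> runs p c2 n2 c3 -> runs p c1 (n1 + n2) c3.
Proof. induction 1; cbn; auto. intros. econstructor; eauto. Qed.

Definition code_at (p : program) (off : nat) (q : program) : Prop :=
  forall i, i < length q -> nth_error p (off + i) = nth_error q i.

Lemma code_at_app p off q1 q2 :
  code_at p off (q1 ++ q2) -> code_at p off q1 /\ code_at p (off + length q1) q2.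
Proof.
  intros H. split; intros i Hi.
  - rewrite H by (rewrite length_app; lia). now apply nth_error_app1.
  - rewrite <- Nat.add_assoc, H by (rewrite length_app; lia).
    rewrite nth_error_app2 by lia. f_equal. lia.
Qed.

Lemma code_at_cons p off i q :
  code_at p off (i :: q) -> nth_error p off = Some i /\ code_at p (S off) q.
Proof.
  intros H. split.
  - specialize (H 0 ltac:(cbn; lia)). now rewrite Nat.add_0_r in H.
  - intros j Hj. specialize (H (S j) ltac:(cbn; lia)). rewrite <- Nat.add_succ_comm in H.
    exact H.
Qed.

Lemma steps_repeat_add p c b n : c <> b -> forall off m,
  code_at p off (repeat (IAdd c c b) n) ->
  exists m', steps p (off, m) n (off + n, m') /\ m' c = m c + n * m b /\
    (forall x, x <> c -> m' x = m x).
Proof.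
  intros Hb. induction n as [|n IH]; intros off m H.
  - exists m. rewrite Nat.add_0_r. repeat split; auto. constructor.
  - cbn [repeat] in H. apply code_at_cons in H as [H1 H2].
    destruct (IH _ (upd m c (m c + m b)) H2) as (m' & A & B & C).
    exists m'. repeat split.
    + rewrite <- Nat.add_succ_comm. econstructor; [|exact A]. cbn. now rewrite H1.
    + rewrite B, upd_eq, upd_neq by auto. lia.
    + intros x Hx. rewrite C, upd_neq; auto.
Qed.

Record rep (m : memory) (s : st) : Prop := {
  rep_base : m 1 = lim;
  rep_var : forall x, x < NV -> m (cell x) = vars s x;
  rep_arr : forall a i, a < NA -> m (lim + (NA * i + a)) = arrs s a i;
  rep_inp : forall y, R <= y -> y < lim -> m y = inp y;
  rep_save : forall y, y < R -> arrs s 0 y = inp y }.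

Lemma rep_ext m m' s : (forall x, x <> 0 -> m' x = m x) -> R <= lim -> rep m s -> rep m' s.
Proof.
  intros H HL [A B C D E]. unfold R in *. constructor; auto.
  - now rewrite H by lia.
  - intros x Hx. rewrite H by (unfold cell; lia). auto.
  - intros a i Ha. rewrite H by lia. auto.
  - intros y Hy Hy'. unfold R in Hy. rewrite H by lia. auto.
Qed.

Lemma rep_tick m s : rep m s -> rep m (tick s).
Proof. intros [A B C D E]. constructor; auto. Qed.

Lemma rep_setv m s x v : R <= lim -> x < NV -> rep m s -> rep (upd m (cell x) v) (setv x v s).
Proof.
  intros HL Hx [A B C D E]. unfold NV, R, cell in *. constructor; unfold cell.
  - rewrite upd_neq by lia. auto.
  - intros y Hy. cbn. destruct (Nat.eq_dec y x) as [->|Hn].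
    + now rewrite !upd_eq.
    + rewrite !upd_neq by lia. apply B. exact Hy.
  - intros a i Ha. rewrite upd_neq by lia. now apply C.
  - intros y Hy Hy'. unfold R in Hy. rewrite upd_neq by lia. auto.
  - exact E.
Qed.

Lemma rep_seta m s a i v : R <= lim -> 0 < a < NA -> rep m s ->
  rep (upd m (lim + (NA * i + a)) v) (seta a i v s).
Proof.
  intros HL Ha [A B C D E]. unfold NV, R, cell in *. constructor; unfold cell.
  - rewrite upd_neq by lia. auto.
  - unfold NV. intros y Hy. rewrite upd_neq by lia. apply B. exact Hy.
  - intros b j Hb. cbn [seta arrs]. destruct (Nat.eqb_spec b a) as [->|Hn].
    + destruct (Nat.eq_dec j i) as [->|Hj].
      * now rewrite upd_eq, aupd_eq.
      * rewrite upd_neq, aupd_neq; auto. unfold NA. lia.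
    + rewrite upd_neq; auto. unfold NA in *. intros Heq. apply Hn.
      assert (13 * j + b = 13 * i + a) as Hz by lia. lia.
  - intros y Hy Hy'. rewrite upd_neq by lia. auto.
  - intros y Hy. cbn. destruct a; [lia|]. auto.
Qed.

Lemma steps_address p off m s a i :
  R <= lim -> rep m s -> i < NV -> code_at p off (address a i) ->
  exists m', steps p (off, m) (NA + 2) (off + (NA + 2), m') /\
    m' 0 = lim + (NA * vars s i + a) /\ (forall x, x <> 0 -> m' x = m x) /\ rep m' s.
Proof.
  intros HL Hr Hi H. unfold address in H.
  apply code_at_cons in H as [H1 H]. apply code_at_cons in H as [H2 H].
  destruct (@steps_repeat_add p 0 (cell i) NA ltac:(discriminate) _
    (upd (upd m 0 a) 0 (a + m 1)) H) as (m' & A & B & C).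
  assert (forall x, x <> 0 -> m' x = m x) as Hx.
  { intros x Hx. rewrite C by auto. now rewrite !upd_neq by auto. }
  exists m'. split; [|split; [|split]]; auto.
  - rewrite (Nat.add_comm NA 2). cbn [Nat.add]. econstructor; [cbn [step]; now rewrite H1|].
    econstructor; [cbn [step]; now rewrite H2|].
    rewrite upd_eq. rewrite upd_neq by lia. rewrite <- !Nat.add_succ_comm. exact A.
  - rewrite B, upd_eq, (rep_base _ _ Hr), !upd_neq by (unfold cell; lia).
    rewrite (rep_var _ _ Hr) by auto. lia.
  - eapply rep_ext; eauto.
Qed.

Definition ram_factor := NA + 8.

Lemma compile_op_correct p o : R <= lim -> wf_op o = true -> forall off m s,
  code_at p off (compile_op off o) -> rep m s ->
  exists m' n, steps p (off, m) n (off + length (compile_op 0 o), m') /\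
    rep m' (eop o s) /\ n <= ram_factor.
Proof.
  intros HL Hwf off m s Hc Hr. unfold ram_factor.
  destruct o as [x c|x y z|x y z|x a i|a i x|x y]; cbn [wf_op] in Hwf;
    rewrite ?andb_true_iff, ?Nat.ltb_lt in Hwf; cbn [compile_op eop].
  - apply code_at_cons in Hc as [H1 _]. eexists _, 1. split; [|split; [|lia]].
    + econstructor; [cbn [step]; rewrite H1; reflexivity|]. rewrite Nat.add_1_r. constructor.
    + now apply rep_setv.
  - destruct Hwf as [[Hx Hy] Hz].
    apply code_at_cons in Hc as [H1 _]. eexists _, 1. split; [|split; [|lia]].
    + econstructor; [cbn [step]; rewrite H1; reflexivity|]. rewrite Nat.add_1_r. constructor.
    + rewrite !(rep_var _ _ Hr) by auto. now apply rep_setv.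
  - destruct Hwf as [[Hx Hy] Hz].
    apply code_at_cons in Hc as [H1 _]. eexists _, 1. split; [|split; [|lia]].
    + econstructor; [cbn [step]; rewrite H1; reflexivity|]. rewrite Nat.add_1_r. constructor.
    + rewrite !(rep_var _ _ Hr) by auto. now apply rep_setv.
  - destruct Hwf as [[Hx Ha] Hi]. cbn [compile_op] in Hc.
    apply code_at_app in Hc as [H1 H2]. apply code_at_cons in H2 as [H2 _].
    change (length (address a i)) with (NA + 2) in H2.
    destruct (steps_address _ _ _ _ _ _ HL Hr Hi H1) as (m1 & A & B & C & D).
    eexists _, (NA + 2 + 1). split; [|split; [|lia]].
    + eapply steps_trans; [exact A|]. econstructor; [cbn [step]; rewrite H2; reflexivity|].
      change (length (address a i ++ [ILoad (cell x) 0])) with (S (NA + 2)).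
      rewrite <- Nat.add_succ_r. constructor.
    + rewrite B, (rep_arr _ _ D) by auto. now apply rep_setv.
  - destruct Hwf as [[[Hx Ha] Ha'] Hi]. cbn [compile_op] in Hc.
    apply code_at_app in Hc as [H1 H2]. apply code_at_cons in H2 as [H2 _].
    change (length (address a i)) with (NA + 2) in H2.
    destruct (steps_address _ _ _ _ _ _ HL Hr Hi H1) as (m1 & A & B & C & D).
    eexists _, (NA + 2 + 1). split; [|split; [|lia]].
    + eapply steps_trans; [exact A|]. econstructor; [cbn [step]; rewrite H2; reflexivity|].
      change (length (address a i ++ [IStore 0 (cell x)])) with (S (NA + 2)).
      rewrite <- Nat.add_succ_r. constructor.
    + rewrite B, (rep_var _ _ D) by auto. now apply rep_seta.
  - destruct Hwf as [Hx Hy]. cbn [compile_op app] in Hc.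
    apply code_at_cons in Hc as [H1 Hc]. apply code_at_cons in Hc as [H2 Hc].
    apply code_at_app in Hc as [H3 Hc]. apply code_at_cons in Hc as [H4 Hc].
    apply code_at_cons in Hc as [H5 Hc]. apply code_at_cons in Hc as [H6 _].
    change (length (address 0 y)) with (NA + 2) in H4, H5, H6.
    set (m1 := upd m 0 R).
    assert (forall z, z <> 0 -> m1 z = m z) as Hm1 by (intros; now apply upd_neq).
    assert (rep m1 s) as Hr1 by (eapply rep_ext; eauto).
    change (length _) with (NA + 7).
    destruct (le_lt_dec R (vars s y)) as [Hle|Hlt].
    + eexists _, 3. split; [|split; [|lia]].
      * econstructor; [cbn [step]; rewrite H1; reflexivity|].
        econstructor; [cbn [step]; rewrite H2; reflexivity|]. fold m1.
        rewrite (rep_var _ _ Hr1) by auto. unfold m1 at 1. rewrite upd_eq.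
        apply Nat.leb_le in Hle. rewrite Hle.
        econstructor; [cbn [step]|].
        { replace (off + (NA + 6)) with (S (S (S (S off) + (NA + 2)))) by lia.
          rewrite H6. reflexivity. }
        replace (S (S (S (S (S off) + (NA + 2))))) with (off + (NA + 7)) by lia. constructor.
      * rewrite (rep_var _ _ Hr1) by auto.
        replace (m1 (vars s y)) with (raw s (vars s y)); [now apply rep_setv|].
        unfold raw. destruct (Nat.ltb_spec (vars s y) lim) as [Hl|Hl].
        -- now rewrite (rep_inp _ _ Hr1).
        -- rewrite <- (rep_arr _ _ Hr1) by (apply Nat.mod_upper_bound; discriminate).
           f_equal. rewrite <- Nat.div_mod_eq. lia.
    + destruct (steps_address _ _ _ _ _ _ HL Hr1 Hy H3) as (m2 & A & B & C & D).
      eexists _, (2 + (NA + 2 + 2)). split; [|split; [|lia]].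
      * cbn [Nat.add]. econstructor; [cbn [step]; rewrite H1; reflexivity|].
        econstructor; [cbn [step]; rewrite H2; reflexivity|]. fold m1.
        rewrite (rep_var _ _ Hr1) by auto. unfold m1 at 1. rewrite upd_eq.
        destruct (Nat.leb_spec R (vars s y)); [lia|].
        eapply (steps_trans _ _ (NA + 2)); [exact A|].
        econstructor; [cbn [step]; rewrite H4; reflexivity|].
        econstructor; [cbn [step]; rewrite H5, Nat.leb_refl; reflexivity|]. constructor.
      * rewrite B, (rep_arr _ _ D) by (unfold NA; lia). rewrite (rep_save _ _ D) by auto.
        unfold raw. destruct (Nat.ltb_spec (vars s y) lim); [|lia]. now apply rep_setv.
Qed.

Lemma compile_correct p c : R <= lim -> wf c = true -> forall off m s,
  code_at p off (compile off c) -> rep m s ->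
  exists m' n, steps p (off, m) n (off + code_size c, m') /\ rep m' (eval c s) /\
    n + ram_factor * clk s <= ram_factor * clk (eval c s).
Proof.
  intros HL. induction c as [|o|a IHa b IHb|x y a IHa b IHb|x y b IHb]; intros Hwf off m s Hc Hr.
  - exists m, 0. cbn. rewrite Nat.add_0_r. repeat split; auto; try constructor; apply Hr.
  - destruct (compile_op_correct p o HL Hwf off m s Hc Hr) as (m' & n & A & B & C).
    exists m', n. split; [|split]; auto. cbn [eval].
    assert (clk (eop o s) = S (clk s)) as -> by now destruct o. lia.
  - cbn [wf] in Hwf. apply andb_true_iff in Hwf as [Ha Hb]. cbn [compile] in Hc.
    apply code_at_app in Hc as [C1 C2]. rewrite compile_length in C2.
    destruct (IHa Ha _ _ _ C1 Hr) as (m1 & n1 & A1 & A2 & A3).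
    destruct (IHb Hb _ _ _ C2 A2) as (m2 & n2 & B1 & B2 & B3).
    exists m2, (n1 + n2). cbn [code_size eval]. split; [|split]; auto; [|lia].
    rewrite Nat.add_assoc. eapply steps_trans; eauto.
  - cbn [wf] in Hwf. rewrite !andb_true_iff, !Nat.ltb_lt in Hwf.
    destruct Hwf as [[[Hx Hy] Ha] Hb]. cbn [compile] in Hc.
    apply code_at_cons in Hc as [C1 Hc]. apply code_at_app in Hc as [C2 Hc].
    apply code_at_cons in Hc as [C3 C4]. rewrite compile_length in C3, C4.
    assert (step p (off, m) =
      Some (if vars s x <=? vars s y then off + (2 + code_size b) else S off, m)) as Hs.
    { cbn [step]. rewrite C1. now rewrite !(rep_var _ _ Hr) by auto. }
    cbn [eval]. destruct (vars s x <=? vars s y).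
    + replace (S (S off + code_size b)) with (off + (2 + code_size b)) in C4 by lia.
      destruct (IHa Ha _ _ _ C4 (rep_tick _ _ Hr)) as (m1 & n1 & A1 & A2 & A3).
      exists m1, (S n1). split; [|split]; auto.
      * econstructor; [exact Hs|]. cbn [code_size].
        replace (off + (2 + code_size b + code_size a))
          with (off + (2 + code_size b) + code_size a) by lia. exact A1.
      * cbn [clk tick] in A3. unfold ram_factor in *. lia.
    + rewrite Nat.add_1_r in C2.
      destruct (IHb Hb _ _ _ C2 (rep_tick _ _ Hr)) as (m1 & n1 & A1 & A2 & A3).
      exists m1, (S (n1 + 1)). split; [|split]; auto.
      * econstructor; [exact Hs|]. eapply steps_trans; [exact A1|].
        econstructor; [cbn [step]; rewrite C3, Nat.leb_refl; reflexivity|]. constructor.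
      * cbn [clk tick] in A3. unfold ram_factor in *. lia.
  - cbn [wf] in Hwf. rewrite !andb_true_iff, !Nat.ltb_lt, !negb_true_iff in Hwf.
    destruct Hwf as [[[[[Hx Hy] Hxy] Wx] Wy] Hb]. apply Nat.eqb_neq in Hxy. cbn [compile] in Hc.
    apply code_at_cons in Hc as [C1 Hc]. apply code_at_cons in Hc as [C2 Hc].
    apply code_at_app in Hc as [C3 Hc]. rewrite compile_length in Hc.
    apply code_at_cons in Hc as [C4 Hc]. apply code_at_cons in Hc as [C5 Hc].
    apply code_at_cons in Hc as [C6 _]. cbn [eval].
    replace (S (S off)) with (off + 2) in * by lia.
    set (it := nat_rect (fun _ => st) (setv x 0 s) (fun i s1 => setv x (S i) (eval b s1))).
    assert (forall i, i <= vars s y -> exists m1 n1,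
      steps p (off, m) n1 (off + 1, m1) /\ rep m1 (it i) /\ vars (it i) x = i /\
      vars (it i) y = vars s y /\ n1 + 1 + ram_factor * clk s <= ram_factor * clk (it i)) as H.
    { induction i as [|i IH]; intros Hi.
      - exists (upd m (cell x) 0), 1. split; [|split; [|split; [|split]]].
        + econstructor; [cbn [step]; rewrite C1; reflexivity|]. rewrite Nat.add_1_r. constructor.
        + now apply rep_setv.
        + cbn. apply upd_eq.
        + cbn. now apply upd_neq; auto.
        + cbn. lia.
      - destruct (IH ltac:(lia)) as (m1 & n1 & A1 & A2 & A3 & A4 & A5).
        destruct (IHb Hb _ _ _ C3 A2) as (m2 & n2 & B1 & B2 & B3).
        set (m3 := upd m2 0 1).
        assert (rep m3 (eval b (it i))) as D1.
        { eapply rep_ext; [|exact HL|exact B2]. intros; now apply upd_neq. }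
        destruct (eval_frame b (it i)) as (F1 & _ & _).
        assert (vars (eval b (it i)) x = i) as Ex by (rewrite F1; auto).
        exists (upd m3 (cell x) (S i)), (n1 + (1 + (n2 + 3))).
        split; [|split; [|split; [|split]]].
        + eapply steps_trans; [exact A1|].
          econstructor; [cbn [step]|].
          { rewrite Nat.add_1_r, C2. rewrite !(rep_var _ _ A2), A3, A4 by auto.
            destruct (Nat.leb_spec (vars s y) i); [lia|]. reflexivity. }
          replace (S (S off)) with (off + 2) by lia.
          eapply steps_trans; [exact B1|].
          econstructor; [cbn [step]; rewrite C4; reflexivity|].
          econstructor; [cbn [step]; rewrite C5; reflexivity|].
          econstructor; [cbn [step]; rewrite C6, Nat.leb_refl; reflexivity|].
          fold m3. rewrite (rep_var _ _ D1) by auto. rewrite Ex. unfold m3 at 2.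
          rewrite upd_eq, (Nat.add_1_r i). constructor.
        + cbn [it nat_rect]. apply rep_setv; auto.
        + cbn. apply upd_eq.
        + cbn. rewrite upd_neq by auto. now rewrite F1.
        + change (clk (it (S i))) with (S (clk (eval b (it i)))).
          unfold ram_factor in *. lia. }
    destruct (H (vars s y) ltac:(lia)) as (m1 & n1 & A1 & A2 & A3 & A4 & A5).
    exists m1, (n1 + 1). split; [|split]; auto. eapply steps_trans; [exact A1|].
    econstructor; [cbn [step]|].
    { rewrite Nat.add_1_r, C2. rewrite !(rep_var _ _ A2), A3, A4 by auto.
      rewrite Nat.leb_refl. reflexivity. }
    constructor.
Qed.

End Semantics.

(** * Bootstrapping *)

Definition save (l : list nat) : program :=
  flat_map (fun y => [IConst 0 (NA * y); IAdd 0 0 1; IStore 0 y]) l.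

Lemma save_correct p l : forall off m,
  R <= m 1 -> NoDup l -> (forall y, In y l -> 2 <= y < R) ->
  code_at p off (save l) ->
  exists m', steps p (off, m) (length (save l)) (off + length (save l), m') /\
    (forall y, In y l -> m' (m 1 + NA * y) = m y) /\
    (forall x, x <> 0 -> (forall y, In y l -> x <> m 1 + NA * y) -> m' x = m x).
Proof.
  unfold R. induction l as [|z l IH]; intros off m Hb Hn Hl Hc.
  - exists m. cbn. rewrite Nat.add_0_r. repeat split; try constructor; try easy.
  - change (save (z :: l)) with ([IConst 0 (NA * z); IAdd 0 0 1; IStore 0 z] ++ save l) in *.
    apply code_at_app in Hc as [H0 H4]. apply code_at_cons in H0 as [H1 H0].
    apply code_at_cons in H0 as [H2 H0]. apply code_at_cons in H0 as [H3 _].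
    apply NoDup_cons_iff in Hn as [Hz Hn].
    pose proof (Hl z (or_introl eq_refl)) as Hz2.
    set (m1 := upd (upd (upd m 0 (NA * z)) 0 (NA * z + m 1)) (NA * z + m 1) (m z)).
    assert (m1 1 = m 1) as E1 by (unfold m1; now rewrite !upd_neq by (unfold NA; lia)).
    destruct (IH (off + 3) m1) as (m' & A & B & C); try rewrite E1; auto.
    { intros y Hy. apply Hl. now right. }
    exists m'. split; [|split].
    + rewrite length_app. cbn [length]. cbn [Nat.add].
      econstructor; [cbn [step]; rewrite H1; reflexivity|].
      econstructor; [cbn [step]; rewrite H2; reflexivity|].
      econstructor; [cbn [step]; rewrite H3; reflexivity|].
      rewrite !upd_eq, (upd_neq _ _ _ 1) by lia. rewrite (upd_neq _ _ _ z), (upd_neq _ _ _ z) by lia.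
      fold m1. replace (S (S (S off))) with (off + 3) by lia.
      replace (off + S (S (S (length (save l))))) with (off + 3 + length (save l)) by lia. exact A.
    + rewrite E1 in B, C. intros y [<-|Hy].
      * rewrite C; [| |].
        -- unfold m1. rewrite Nat.add_comm. apply upd_eq.
        -- unfold NA. lia.
        -- intros y Hy He. assert (z = y) by (unfold NA in He; lia). congruence.
      * rewrite B by auto. assert (y < 42) by (apply Hl; now right).
        assert (2 <= y) by (apply Hl; now right).
        unfold m1. now rewrite !upd_neq by (unfold NA; lia).
    + rewrite E1 in B, C. intros x Hx Hy. rewrite C; auto.
      * unfold m1. rewrite upd_neq; [now rewrite !upd_neq by auto|].
        specialize (Hy z (or_introl eq_refl)). lia.
      * intros y Hy'. apply Hy. now right.
Qed.

(* [lim := k + spread d * n] lies beyond the input and the registers when [n > 0]; with [n] saved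
   at address [lim], the input word [k] is recovered as [lim - spread d * n]. *)
Definition spread (d : nat) : nat := R + 2 * (d + 2).

(* No cell is free on entry, so [n = 0] is detected by comparing [k + n] with [k]. *)
Definition boot_head (d lz : nat) : program :=
  [IAdd 1 1 0; ISub 0 1 0; IJle 1 0 lz; ISub 0 1 0] ++
  repeat (IAdd 1 1 0) (spread d - 1) ++ [IStore 1 0] ++ save (seq 2 40) ++
  [ILoad 2 1; IConst 3 0] ++ repeat (IAdd 3 3 2) (spread d) ++
  [ISub 3 1 3; IConst 0 NA; IAdd 0 0 1; IStore 0 3].

Definition link (d : nat) (c : cmd) (res : nat) : program :=
  let off := length (boot_head d 0) in
  boot_head d (off + code_size c + 3) ++ compile off c ++
  [IConst 0 0; IAdd 0 0 (cell res); IHalt; IConst 0 1; IHalt].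

Lemma boot_head_length d l l' : length (boot_head d l) = length (boot_head d l').
Proof. reflexivity. Qed.

Lemma boot_zero d I k c res : n_req I = 0 ->
  exists m', runs (link d c res) (0, encode d I k) 4 (length (boot_head d 0) + code_size c + 4, m') /\ m' 0 = 1.
Proof.
  intros Hn. set (l := length (boot_head d 0) + code_size c).
  set (p := link d c res). set (m := encode d I k).
  assert (nth_error p (l + 3) = Some (IConst 0 1) /\ nth_error p (l + 4) = Some IHalt) as [E1 E2].
  { assert (exists q, p = q ++ [IConst 0 0; IAdd 0 0 (cell res); IHalt; IConst 0 1; IHalt] /\ length q = l)
      as (q & -> & Hq).
    { eexists. split; [unfold p, link; rewrite app_assoc; reflexivity|].
      rewrite length_app, compile_length. unfold l. f_equal. }
    rewrite !nth_error_app2 by lia. rewrite !Hq.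
    replace (l + 3 - l) with 3 by lia. replace (l + 4 - l) with 4 by lia. now cbn. }
  assert (m 0 = 0) as M0 by exact Hn.
  set (m1 := upd m 1 (m 1 + m 0)). set (m2 := upd m1 0 (m1 1 - m1 0)).
  exists (upd m2 0 1). split; [|reflexivity].
  econstructor; [reflexivity|]. econstructor; [reflexivity|]. fold m m1 m2.
  econstructor.
  { cbn [step]. change (nth_error p 2) with (Some (IJle 1 0 (l + 3))).
    cbn [nth_error]. unfold m2 at 1 2. rewrite upd_eq, upd_neq by lia.
    unfold m1 at 1 2 3. rewrite upd_eq, upd_neq by lia. rewrite M0.
    replace (m 1 + 0 - 0) with (m 1 + 0) by lia. rewrite Nat.leb_refl. reflexivity. }
  econstructor; [cbn [step]; rewrite E1; reflexivity|].
  replace (S (l + 3)) with (l + 4) by lia.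
  constructor. cbn [step]. now rewrite E2.
Qed.

Lemma boot_correct d I k c res : 0 < n_req I -> wf c = true -> res < NV ->
  exists lim s0 t pc m',
    (d + 2) * (n_req I + 1) <= lim /\ clk s0 = 0 /\
    let s1 := eval (encode d I k) lim c s0 in
    runs (link d c res) (0, encode d I k) t (pc, m') /\
    t <= length (boot_head d 0) + 2 + ram_factor * clk s1 /\
    m' 0 = vars s1 res.
Proof.
  intros Hn Hwf Hres. set (n := n_req I) in *. set (lz := length (boot_head d 0) + code_size c + 3).
  set (p := link d c res). set (m := encode d I k). set (lim := k + spread d * n).
  assert (R <= lim /\ (d + 2) * (n + 1) <= lim) as [HL HL'].
  { unfold lim, spread, R. nia. }
  assert (code_at p 0 (boot_head d lz ++ compile (length (boot_head d 0)) c ++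
    [IConst 0 0; IAdd 0 0 (cell res); IHalt; IConst 0 1; IHalt])) as Hc by (intros i _; reflexivity).
  apply code_at_app in Hc as [Hb Hc]. rewrite (boot_head_length d lz 0) in Hc. cbn [Nat.add] in Hc.
  apply code_at_app in Hc as [Hc He]. rewrite compile_length in He.
  apply code_at_cons in He as [E1 He]. apply code_at_cons in He as [E2 He].
  apply code_at_cons in He as [E3 _].
  assert (m 0 = n /\ m 1 = k) as [M0 M1] by now split.
  assert (exists m2, steps p (0, m) (length (boot_head d 0)) (length (boot_head d 0), m2) /\
    m2 1 = lim /\ (forall y, y < R -> m2 (lim + NA * y) = m y) /\
    (forall y, R <= y -> y < lim -> m2 y = m y)) as (m2 & S2 & B1 & B2 & B3).
  { unfold boot_head in Hb. cbn [app] in Hb.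
    apply code_at_cons in Hb as [G1 Hb]. apply code_at_cons in Hb as [G2 Hb].
    apply code_at_cons in Hb as [G3 Hb]. apply code_at_cons in Hb as [G4 Hb].
    apply code_at_app in Hb as [G5 Hb]. apply code_at_cons in Hb as [G6 Hb].
    apply code_at_app in Hb as [G7 Hb]. apply code_at_cons in Hb as [G8 Hb].
    apply code_at_cons in Hb as [G9 Hb]. apply code_at_app in Hb as [G10 Hb].
    apply code_at_cons in Hb as [G11 Hb]. apply code_at_cons in Hb as [G12 Hb].
    apply code_at_cons in Hb as [G13 Hb]. apply code_at_cons in Hb as [G14 _].
    rewrite ?repeat_length in *. rewrite ?repeat_length in *.
    set (a1 := upd m 1 (m 1 + m 0)). set (a2 := upd a1 0 (a1 1 - a1 0)).
    set (a3 := upd a2 0 (a2 1 - a2 0)).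
    assert (a1 1 = k + n) as A1 by (unfold a1; rewrite upd_eq, M0, M1; lia).
    assert (a1 0 = n) as A1' by (unfold a1; rewrite upd_neq, M0; lia).
    assert (a2 1 = k + n) as A2 by (unfold a2; rewrite upd_neq, A1; lia).
    assert (a2 0 = k) as A2' by (unfold a2; rewrite upd_eq, A1, A1'; lia).
    assert (a3 1 = k + n) as A3 by (unfold a3; rewrite upd_neq, A2; lia).
    assert (a3 0 = n) as A3' by (unfold a3; rewrite upd_eq, A2, A2'; lia).
    assert (forall x, 2 <= x -> a3 x = m x) as Ax3.
    { intros x Hx. unfold a3, a2, a1. now rewrite !upd_neq by lia. }
    destruct (steps_repeat_add p 1 0 (spread d - 1) ltac:(lia) _ a3 G5) as (a4 & S4 & A4 & A4').
    rewrite A3, A3' in A4.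
    assert (a4 1 = lim) as A41. { rewrite A4. unfold lim. unfold spread, R. nia. }
    assert (a4 0 = n) as A40 by (rewrite A4' by lia; auto).
    set (a5 := upd a4 (a4 1) (a4 0)).
    assert (a5 1 = lim) as A51. { unfold a5, R in *. rewrite upd_neq; lia. }
    assert (forall x, 2 <= x -> x < lim -> a5 x = m x) as Ax5.
    { intros x Hx Hx'. unfold a5. rewrite upd_neq by lia. rewrite A4' by lia. apply Ax3. auto. }
    assert (a5 lim = n) as A5l. { unfold a5. rewrite A41, upd_eq. auto. }
    destruct (save_correct p (seq 2 40)) with (2 := seq_NoDup 40 2) (4 := G7) (m := a5)
      as (a6 & S6 & A6 & A6').
    { rewrite A51. exact HL. }
    { intros y Hy. apply in_seq in Hy. unfold R. lia. }
    rewrite A51 in A6, A6'.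
    assert (forall x, 1 <= x -> x < lim + NA * 2 -> a6 x = a5 x) as Ax6.
    { intros x Hx Hx'. apply A6'; [lia|]. intros y Hy. apply in_seq in Hy. unfold NA in *. lia. }
    set (a7 := upd a6 2 (a6 (a6 1))). set (a8 := upd a7 3 0).
    unfold R in *.
    assert (a7 2 = n) as A7. { unfold a7. rewrite upd_eq, (Ax6 1), A51, Ax6; unfold NA; lia. }
    assert (forall x, x <> 2 -> x <> 3 -> a8 x = a6 x) as Ax8.
    { intros. unfold a8, a7. now rewrite !upd_neq by lia. }
    destruct (steps_repeat_add p 3 2 (spread d) ltac:(lia) _ a8 G10) as (a9 & S9 & A9 & A9').
    assert (a9 3 = spread d * n) as A93.
    { rewrite A9. unfold a8. rewrite upd_eq, upd_neq by lia. rewrite A7. lia. }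
    assert (a9 1 = lim) as A91 by (rewrite A9', Ax8, Ax6, A51 by (unfold NA; lia); auto).
    set (b1 := upd a9 3 (a9 1 - a9 3)). set (b2 := upd b1 0 NA). set (b3 := upd b2 0 (b2 0 + b2 1)).
    set (b4 := upd b3 (b3 0) (b3 3)).
    assert (b3 3 = k) as E33.
    { unfold b3, b2, b1. rewrite 2!upd_neq, upd_eq by lia. rewrite A91, A93. unfold lim. lia. }
    assert (b3 0 = NA + lim) as E30.
    { unfold b3. rewrite upd_eq. unfold b2 at 1. rewrite upd_eq. unfold b2, b1.
      rewrite !upd_neq by lia. now rewrite A91. }
    assert (forall x, x <> 0 -> x <> 2 -> x <> 3 -> x <> lim + NA -> b4 x = a6 x) as Ex.
    { intros x H0 H2 H3 H4. unfold b4. rewrite upd_neq by lia. unfold b3, b2, b1.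
      rewrite !upd_neq by lia. rewrite A9' by lia. now apply Ax8. }
    exists b4. split; [|split; [|split]].
    - replace (length (boot_head d 0)) with
        (4 + ((spread d - 1) + (1 + (length (save (seq 2 40)) + (2 + (spread d + 4)))))).
      2:{ unfold boot_head. rewrite !length_app, !repeat_length. cbn [length]. lia. }
      cbn [Nat.add]. econstructor; [cbn [step]; rewrite G1; reflexivity|].
      econstructor; [cbn [step]; rewrite G2; reflexivity|]. fold a1 a2.
      econstructor; [cbn [step]; rewrite G3, A2, A2'; reflexivity|].
      destruct (Nat.leb_spec (k + n) k); [lia|].
      econstructor; [cbn [step]; rewrite G4; reflexivity|]. fold a3.
      eapply steps_trans; [exact S4|].
      econstructor; [cbn [step]; rewrite G6; reflexivity|]. fold a5.
      eapply steps_trans; [exact S6|].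
      econstructor; [cbn [step]; rewrite G8; reflexivity|]. fold a7.
      econstructor; [cbn [step]; rewrite G9; reflexivity|]. fold a8.
      eapply steps_trans; [exact S9|].
      econstructor; [cbn [step]; rewrite G11; reflexivity|]. fold b1.
      econstructor; [cbn [step]; rewrite G12; reflexivity|]. fold b2.
      econstructor; [cbn [step]; rewrite G13; reflexivity|]. fold b3.
      econstructor; [cbn [step]; rewrite G14; reflexivity|]. fold b4.
      match goal with |- steps _ (?a, _) _ (?b, _) => replace b with a by lia end. constructor.
    - rewrite Ex, Ax6 by (unfold NA; lia). exact A51.
    - intros y Hy. destruct (Nat.eq_dec y 1) as [->|Hy1].
      + unfold b4. rewrite E30, E33, Nat.mul_1_r, (Nat.add_comm NA), upd_eq. now rewrite M1.
      + rewrite Ex by (unfold NA; lia). destruct (Nat.eq_dec y 0) as [->|Hy0].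
        * rewrite Nat.mul_0_r, Nat.add_0_r, Ax6, A5l by (unfold NA; lia). auto.
        * rewrite A6 by (apply in_seq; lia). apply Ax5; lia.
    - intros y Hy Hy'. rewrite Ex, Ax6, Ax5 by (unfold NA; lia). auto. }
  set (s0 := St (fun x => m2 (cell x)) (fun a i => m2 (lim + (NA * i + a))) 0).
  assert (rep m lim m2 s0) as Hr.
  { constructor; auto. intros y Hy. cbn [s0 arrs]. rewrite Nat.add_0_r. auto. }
  destruct (compile_correct _ _ p c HL Hwf _ _ _ Hc Hr) as (m3 & t & S3 & C1 & C2).
  set (s1 := eval m lim c s0) in *.
  exists lim, s0, (length (boot_head d 0) + (t + 2)),
    (length (boot_head d 0) + code_size c + 2), (upd (upd m3 0 0) 0 (m3 (cell res))).
  split; auto. split; auto. cbv zeta. split; [|split].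
  - eapply steps_runs; [exact S2|]. eapply steps_runs; [exact S3|].
    econstructor; [cbn [step]; rewrite E1; reflexivity|].
    econstructor; [cbn [step]; rewrite E2; reflexivity|].
    rewrite upd_eq, (upd_neq _ _ _ (cell res)) by (unfold cell; lia). cbn [Nat.add].
    replace (length (boot_head d 0) + code_size c + 2)
      with (S (S (length (boot_head d 0) + code_size c))) by lia.
    constructor. cbn [step]. now rewrite E3.
  - change (clk s0) with 0 in C2. rewrite Nat.mul_0_r in C2.
    change (t + 0 <= ram_factor * clk s1) in C2.
    change (length (boot_head d 0) + (t + 2) <= length (boot_head d 0) + 2 + ram_factor * clk s1). lia.
  - rewrite upd_eq. now apply C1.
Qed.

(** * Sums, merging and positional codes *)

Lemma sum_over_app l1 l2 g : sum_over (l1 ++ l2) g = sum_over l1 g + sum_over l2 g.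
Proof. induction l1; cbn; auto. unfold sum_over in *. lia. Qed.

Lemma sum_over_perm l1 l2 g : Permutation l1 l2 -> sum_over l1 g = sum_over l2 g.
Proof. induction 1; cbn in *; unfold sum_over in *; lia. Qed.

Lemma sum_filter_le (p q : nat -> bool) l g :
  (forall x, In x l -> p x = true -> q x = true) ->
  sum_over (filter p l) g <= sum_over (filter q l) g.
Proof.
  induction l as [|a l IH]; intros H; cbn; auto.
  specialize (IH (fun x Hx => H x (or_intror Hx))).
  destruct (p a) eqn:E.
  - rewrite (H a (or_introl eq_refl) E). cbn. unfold sum_over in *. lia.
  - destruct (q a); cbn; unfold sum_over in *; lia.
Qed.

Lemma sum_filter_split (p : nat -> bool) l g :
  sum_over l g = sum_over (filter p l) g + sum_over (filter (fun x => negb (p x)) l) g.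
Proof.
  induction l as [|a l IH]; cbn; auto. destruct (p a); cbn; unfold sum_over in *; lia.
Qed.

Lemma filter_perm {A} (p : A -> bool) l1 l2 :
  Permutation l1 l2 -> Permutation (filter p l1) (filter p l2).
Proof.
  induction 1; cbn; auto.
  - destruct (p x); auto.
  - destruct (p x), (p y); auto. constructor.
  - eapply perm_trans; eauto.
Qed.

Lemma filter_all {A} (p : A -> bool) l : (forall x, In x l -> p x = true) -> filter p l = l.
Proof.
  induction l as [|a l IH]; cbn; intros H; auto. rewrite H by auto. f_equal. auto.
Qed.

Lemma filter_none {A} (p : A -> bool) l : (forall x, In x l -> p x = false) -> filter p l = [].
Proof.
  induction l as [|a l IH]; cbn; intros H; auto. rewrite H by auto. auto.
Qed.

Lemma filter_filter {A} (p q : A -> bool) l :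
  filter p (filter q l) = filter (fun x => p x && q x) l.
Proof.
  induction l as [|a l IH]; cbn; auto.
  destruct (q a); cbn; rewrite ?andb_true_r, ?andb_false_r, IH; auto.
Qed.

Section Merge.
Variable key : nat -> nat.

Fixpoint merge (l1 : list nat) : list nat -> list nat :=
  fix aux l2 :=
    match l1, l2 with
    | [], _ => l2
    | _, [] => l1
    | a :: l1', b :: l2' => if key a <=? key b then a :: merge l1' l2 else b :: aux l2'
    end.

Definition sorted := StronglySorted (fun a b => key a <= key b).

Lemma merge_nil_l l : merge [] l = l.
Proof. now destruct l. Qed.

Lemma merge_nil_r l : merge l [] = l.
Proof. now destruct l. Qed.

Lemma merge_cons a l1 b l2 :
  merge (a :: l1) (b :: l2) =
  if key a <=? key b then a :: merge l1 (b :: l2) else b :: merge (a :: l1) l2.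
Proof. reflexivity. Qed.

Lemma merge_perm l1 : forall l2, Permutation (l1 ++ l2) (merge l1 l2).
Proof.
  induction l1 as [|a l1 IH1]; intros l2.
  - now rewrite merge_nil_l.
  - induction l2 as [|b l2 IH2].
    + now rewrite merge_nil_r, app_nil_r.
    + rewrite merge_cons. destruct (key a <=? key b).
      * cbn. now rewrite IH1.
      * rewrite <- IH2. symmetry. apply Permutation_middle.
Qed.

Lemma merge_sorted l1 : forall l2, sorted l1 -> sorted l2 -> sorted (merge l1 l2).
Proof.
  induction l1 as [|a l1 IH1]; intros l2 H1 H2.
  - now rewrite merge_nil_l.
  - induction l2 as [|b l2 IH2].
    + now rewrite merge_nil_r.
    + rewrite merge_cons. apply StronglySorted_inv in H1 as [S1 F1].
      pose proof H2 as H2'. apply StronglySorted_inv in H2 as [S2 F2].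
      rewrite Forall_forall in F1, F2.
      destruct (Nat.leb_spec (key a) (key b)) as [Hab|Hab].
      * constructor; [now apply IH1|]. apply Forall_forall. intros x Hx.
        apply (Permutation_in _ (Permutation_sym (merge_perm _ _))) in Hx.
        apply in_app_iff in Hx as [Hx|[<-|Hx]]; auto. specialize (F2 x Hx). lia.
      * constructor; [now apply IH2|]. apply Forall_forall. intros x Hx.
        apply (Permutation_in _ (Permutation_sym (merge_perm _ _))) in Hx.
        apply in_app_iff in Hx as [[<-|Hx]|Hx]; auto; [lia|]. specialize (F1 x Hx). lia.
Qed.

Fixpoint pass_fuel (fuel w : nat) (l : list nat) : list nat :=
  match fuel with
  | 0 => []
  | S f => merge (firstn w l) (firstn w (skipn w l)) ++ pass_fuel f w (skipn w (skipn w l))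
  end.

Definition pass (w : nat) (l : list nat) : list nat := pass_fuel (length l) w l.

Lemma pass_fuel_nil f w : pass_fuel f w [] = [].
Proof. induction f; cbn; auto. now rewrite !skipn_nil, !firstn_nil. Qed.

Lemma pass_fuel_enough w : 0 < w -> forall f1 f2 l, length l <= f1 -> length l <= f2 ->
  pass_fuel f1 w l = pass_fuel f2 w l.
Proof.
  intros Hw. induction f1 as [|f1 IH]; intros f2 l H1 H2.
  - destruct l; [|cbn in H1; lia]. now rewrite !pass_fuel_nil.
  - destruct l as [|a l]; [now rewrite !pass_fuel_nil|]. destruct f2 as [|f2]; [cbn in H2; lia|].
    cbn [pass_fuel]. f_equal. apply IH; rewrite !length_skipn; cbn [length] in *; lia.
Qed.

Lemma pass_nil w : pass w [] = [].
Proof. reflexivity. Qed.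

Lemma pass_unfold w l : 0 < w -> l <> [] ->
  pass w l = merge (firstn w l) (firstn w (skipn w l)) ++ pass w (skipn w (skipn w l)).
Proof.
  intros Hw Hl. unfold pass at 1. destruct (length l) as [|n] eqn:E.
  - apply length_zero_iff_nil in E. contradiction.
  - cbn [pass_fuel]. f_equal. apply pass_fuel_enough; rewrite ?length_skipn; lia.
Qed.

Definition chunks (w : nat) (l : list nat) : Prop := forall q, sorted (firstn w (skipn (q * w) l)).

Lemma chunks_one l : chunks 1 l.
Proof.
  intros q. destruct (skipn (q * 1) l); cbn; repeat constructor.
Qed.

Lemma chunks_all w l : length l <= w -> chunks w l -> sorted l.
Proof. intros H Hc. specialize (Hc 0). cbn in Hc. now rewrite firstn_all2 in Hc. Qed.

Lemma pass_correct w l : 0 < w -> chunks w l -> chunks (w + w) (pass w l) /\ Permutation l (pass w l).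
Proof.
  intros Hw. remember (length l) as n eqn:Hn. revert l Hn.
  induction n as [n IH] using (well_founded_induction lt_wf). intros l -> Hc.
  destruct l as [|a0 l0] eqn:El.
  - split; auto. intros q. rewrite skipn_nil, firstn_nil. constructor.
  - rewrite <- El in *. assert (l <> []) as Hl by now rewrite El.
    rewrite pass_unfold by auto. set (l' := skipn w (skipn w l)).
    set (A := merge _ _).
    assert (length l' = length l - w - w) as Ll' by (unfold l'; now rewrite !length_skipn).
    assert (length l > 0) by (rewrite El; cbn; lia).
    assert (chunks w l') as Hc'.
    { intros q. unfold l'. rewrite !skipn_skipn.
      replace (q * w + w + w) with ((q + 2) * w) by lia. apply Hc. }
    destruct (IH (length l') ltac:(lia) l' eq_refl Hc') as [I1 I2].
    assert (Permutation (firstn w l ++ firstn w (skipn w l)) A) as PA by apply merge_perm.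
    assert (sorted A) as SA.
    { apply merge_sorted; [apply (Hc 0)|]. specialize (Hc 1). now rewrite Nat.mul_1_l in Hc. }
    assert (length A = min w (length l) + min w (length l - w)) as LA.
    { rewrite <- (Permutation_length PA), length_app, !length_firstn, length_skipn. reflexivity. }
    split.
    + intros q. destruct (le_lt_dec (length l) (w + w)) as [Hs|Hs].
      * assert (l' = []) as -> by (apply length_zero_iff_nil; lia).
        rewrite pass_nil, app_nil_r. destruct q as [|q].
        -- cbn. rewrite firstn_all2 by lia. auto.
        -- rewrite skipn_all2 by lia. rewrite firstn_nil. constructor.
      * assert (length A = w + w) as LA' by lia.
        rewrite firstn_skipn_comm, firstn_app.
        destruct q as [|q].
        -- cbn [Nat.mul skipn Nat.add]. rewrite firstn_all2 by lia.
           replace (w + w - length A) with 0 by lia. cbn. now rewrite app_nil_r.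
        -- rewrite <- firstn_app, <- firstn_skipn_comm, skipn_app, skipn_all2 by lia.
           cbn [app]. replace (S q * (w + w) - length A) with (q * (w + w)) by lia. apply I1.
    + rewrite <- I2, <- PA. unfold l'. rewrite <- app_assoc, !firstn_skipn. reflexivity.
Qed.

End Merge.

Fixpoint decode (k m x : nat) : list nat :=
  match m with 0 => [] | S m' => x mod k :: decode k m' (x / k) end.

Definition code (k : nat) (l : list nat) : nat := fold_right (fun b y => b + k * y) 0 l.

Lemma decode_length k m : forall x, length (decode k m x) = m.
Proof. induction m; cbn; auto. Qed.

Lemma decode_lt k m : 0 < k -> forall x b, In b (decode k m x) -> b < k.
Proof.
  intros Hk. induction m as [|m IH]; cbn; [easy|]. intros x b [<-|Hb].
  - apply Nat.mod_upper_bound. lia.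
  - eauto.
Qed.

Lemma code_decode k m : 0 < k -> forall x, x < k ^ m -> code k (decode k m x) = x.
Proof.
  intros Hk. induction m as [|m IH]; cbn; intros x Hx; [lia|].
  fold (code k (decode k m (x / k))). rewrite IH.
  - rewrite Nat.add_comm. symmetry. apply Nat.div_mod_eq.
  - apply Nat.Div0.div_lt_upper_bound. lia.
Qed.

Lemma code_lt k l : (forall b, In b l -> b < k) -> code k l < k ^ length l.
Proof.
  induction l as [|b l IH]; cbn; intros H; [lia|]. fold (code k l).
  specialize (IH (fun x Hx => H x (or_intror Hx))). specialize (H b (or_introl eq_refl)). nia.
Qed.

Lemma decode_code k l : (forall b, In b l -> b < k) -> decode k (length l) (code k l) = l.
Proof.
  induction l as [|b l IH]; cbn; intros H; auto. fold (code k l).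
  pose proof (H b (or_introl eq_refl)).
  rewrite (Nat.mul_comm k), Nat.Div0.mod_add, Nat.mod_small by auto.
  rewrite Nat.div_add by lia. rewrite Nat.div_small by auto. cbn. f_equal. apply IH. auto.
Qed.

Lemma decode_map_seq k m : forall x, decode k m x = map (fun q => x / k ^ q mod k) (seq 0 m).
Proof.
  induction m as [|m IH]; intros x; auto. cbn [decode seq map]. rewrite Nat.pow_0_r, Nat.div_1_r.
  f_equal. rewrite IH, <- seq_shift, map_map. apply map_ext. intros q.
  now rewrite Nat.Div0.div_div.
Qed.

(** * Packing in the order of start times *)

Section Packing.
Variables (d : nat) (I : instance) (k : nat).

Definition nonempty (i : nat) : bool := start I i <? fin I i.

Definition fits_c (c : nat) (f : nat -> nat) (r : list nat) : Prop :=
  forall t j, sum_over (filter (fun i => (f i =? j) && activeb I i t) r) (fun i => size I i c) <= cap I c.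

Definition fits (f : nat -> nat) (r : list nat) : Prop := forall c, c < d -> fits_c c f r.

Definition alive (t i : nat) : bool := t <? fin I i.

Lemma fits_c_perm c f r r' : Permutation r r' -> fits_c c f r -> fits_c c f r'.
Proof.
  intros P H t j. rewrite (sum_over_perm _ (filter (fun i => (f i =? j) && activeb I i t) r)); auto.
  apply filter_perm. now symmetry.
Qed.

Lemma feasible_fits r : Permutation r (filter nonempty (seq 0 (n_req I))) ->
  feasible d I k <->
  ((n_req I = 0 \/ 0 < k) /\ exists f, (forall i, In i r -> f i < k) /\ fits f r).
Proof.
  intros P.
  assert (forall f t j, filter (fun i => (f i =? j) && activeb I i t) (filter nonempty (seq 0 (n_req I)))
    = filter (fun i => (f i =? j) && activeb I i t) (seq 0 (n_req I))) as E.
  { intros f t j. rewrite filter_filter. apply filter_ext. intros a. unfold activeb, nonempty.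
    destruct (Nat.leb_spec (start I a) t), (Nat.ltb_spec t (fin I a)),
      (Nat.ltb_spec (start I a) (fin I a)), (f a =? j); cbn; auto; lia. }
  split.
  - intros (f & Hf & Hc). split.
    { destruct (n_req I); auto. right. specialize (Hf 0). lia. }
    exists f. split.
    + intros i Hi. apply Hf. apply (Permutation_in _ P) in Hi. apply filter_In in Hi as [Hi _].
      apply in_seq in Hi. lia.
    + intros c Hcd. apply (fits_c_perm _ _ _ _ (Permutation_sym P)). intros t j. rewrite E.
      destruct (le_lt_dec k j) as [Hj|Hj]; auto.
      rewrite filter_none; [cbn; lia|]. intros x Hx. apply in_seq in Hx. specialize (Hf x).
      destruct (Nat.eqb_spec (f x) j); auto. lia.
  - intros (Hk & f & Hf & Hc).
    set (g := fun i => if nonempty i then f i else 0).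
    exists g. split.
    + intros i Hi. unfold g. destruct (nonempty i) eqn:En; [|lia].
      apply Hf. apply (Permutation_in _ (Permutation_sym P)). apply filter_In. split; auto.
      apply in_seq. lia.
    + intros t j c Hj Hcd. rewrite <- E.
      rewrite (filter_ext_in _ (fun i => (f i =? j) && activeb I i t)).
      * apply (fits_c_perm c f r); auto.
      * intros a Ha. apply filter_In in Ha as [_ Ha]. unfold g. now rewrite Ha.
Qed.

Lemma fits_c_nil c f : fits_c c f [].
Proof. intros t j. cbn. lia. Qed.

(* Requests are added in the order of their start times, so the load of a bin
   can exceed the capacity for the first time only when the newest request starts. *)
Lemma fits_c_cons c f i r :
  (forall a, In a r -> start I a <= start I i) -> nonempty i = true ->
  fits_c c f (i :: r) <->
  (fits_c c f r /\
   size I i c + sum_over (filter (fun a => f a =? f i) (filter (alive (start I i)) r))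
                         (fun a => size I a c) <= cap I c).
Proof.
  intros Hs Hi. unfold nonempty in Hi. apply Nat.ltb_lt in Hi.
  assert (forall t j, sum_over (filter (fun a => (f a =? j) && activeb I a t) (i :: r)) (fun a => size I a c)
    = (if (f i =? j) && activeb I i t then size I i c else 0) +
      sum_over (filter (fun a => (f a =? j) && activeb I a t) r) (fun a => size I a c)) as E.
  { intros t j. cbn. now destruct ((f i =? j) && activeb I i t). }
  assert (filter (fun a => f a =? f i) (filter (alive (start I i)) r) =
    filter (fun a => (f a =? f i) && activeb I a (start I i)) r) as E2.
  { rewrite filter_filter. apply filter_ext_in. intros a Ha. f_equal. unfold alive, activeb.
    specialize (Hs a Ha). apply Nat.leb_le in Hs. now rewrite Hs. }
  split.
  - intros H. split.
    + intros t j. specialize (H t j). rewrite E in H. lia.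
    + specialize (H (start I i) (f i)). rewrite E in H. rewrite E2.
      rewrite Nat.eqb_refl in H. unfold activeb in H at 1.
      apply Nat.ltb_lt in Hi. rewrite Hi, Nat.leb_refl in H. exact H.
  - intros [H1 H2] t j. rewrite E. destruct ((f i =? j) && activeb I i t) eqn:Ea; [|apply H1].
    apply andb_true_iff in Ea as [Ej Ea]. apply Nat.eqb_eq in Ej. subst j.
    unfold activeb in Ea. apply andb_true_iff in Ea as [Ea1 Ea2].
    apply Nat.leb_le in Ea1. apply Nat.ltb_lt in Ea2.
    rewrite filter_filter in H2. etransitivity; [|exact H2]. apply Nat.add_le_mono_l.
    apply sum_filter_le. intros x _ Hx. apply andb_true_iff in Hx as [Hx1 Hx2]. rewrite Hx1.
    unfold activeb in Hx2. apply andb_true_iff in Hx2 as [_ Hx2]. apply Nat.ltb_lt in Hx2.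
    unfold alive. cbn. apply Nat.ltb_lt. lia.
Qed.

(* [r] lists the processed requests, latest start first. *)
Fixpoint act (r : list nat) : list nat :=
  match r with [] => [] | i :: r' => i :: filter (alive (start I i)) (act r') end.

Lemma filter_act t r : (forall a, In a r -> start I a <= t) ->
  filter (alive t) (act r) = filter (alive t) r.
Proof.
  induction r as [|i r IH]; cbn; auto. intros H.
  assert (filter (alive t) (filter (alive (start I i)) (act r)) = filter (alive t) r) as ->; auto.
  rewrite <- IH by auto. rewrite filter_filter. apply filter_ext. intros a. unfold alive.
  specialize (H i (or_introl eq_refl)).
  destruct (Nat.ltb_spec t (fin I a)), (Nat.ltb_spec (start I i) (fin I a)); cbn; auto; lia.
Qed.

Lemma act_incl r : incl (act r) r.
Proof.
  induction r as [|i r IH]; cbn; intros x Hx; auto. destruct Hx as [<-|Hx]; [now left|].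
  right. apply filter_In in Hx as [Hx _]. auto.
Qed.

Lemma act_NoDup r : NoDup r -> NoDup (act r).
Proof.
  induction 1 as [|i r Hi Hn IH]; cbn; constructor.
  - intros Hx. apply filter_In in Hx as [Hx _]. apply Hi. now apply act_incl.
  - now apply NoDup_filter.
Qed.

Definition reach (r s : list nat) : Prop :=
  exists f, (forall i, In i r -> f i < k) /\ fits f r /\ s = map f (act r).

Definition restrict (t : nat) (l s : list nat) : list nat :=
  map snd (filter (fun p => alive t (fst p)) (combine l s)).

Definition load (c j : nat) (l s : list nat) : nat :=
  fold_right (fun p y => (if snd p =? j then size I (fst p) c else 0) + y) 0 (combine l s).

Lemma restrict_map t f l : restrict t l (map f l) = map f (filter (alive t) l).
Proof.
  unfold restrict. induction l as [|a l IH]; [reflexivity|]. cbn [map combine filter fst].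
  destruct (alive t a); cbn [map snd]; [f_equal|]; exact IH.
Qed.

Lemma load_map c j f l :
  load c j l (map f l) = sum_over (filter (fun a => f a =? j) l) (fun a => size I a c).
Proof.
  unfold load. induction l as [|a l IH]; cbn; auto. rewrite IH. now destruct (f a =? j).
Qed.

Lemma reach_nil s : reach [] s <-> s = [].
Proof.
  split.
  - now intros (f & _ & _ & ->).
  - intros ->. exists (fun _ => 0). repeat split; try easy. intros c _. apply fits_c_nil.
Qed.

Lemma reach_cons i r s :
  ~ In i r -> (forall a, In a r -> start I a <= start I i) -> nonempty i = true ->
  let t := start I i in
  reach (i :: r) s <->
  exists s0 j, reach r s0 /\ j < k /\ s = j :: restrict t (act r) s0 /\
    forall c, c < d -> size I i c + load c j (filter (alive t) (act r)) (restrict t (act r) s0) <= cap I c.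
Proof.
  intros Hi Hs Hn t. split.
  - intros (f & Hf & Hfit & ->). exists (map f (act r)), (f i). split; [|split; [|split]].
    + exists f. split; [|split]; auto.
      * intros a Ha. apply Hf. now right.
      * intros c Hc. now apply (fits_c_cons c f i r Hs Hn), Hfit.
    + apply Hf. now left.
    + cbn. now rewrite restrict_map.
    + intros c Hc. rewrite restrict_map, load_map.
      destruct (proj1 (fits_c_cons c f i r Hs Hn) (Hfit c Hc)) as [_ H].
      rewrite filter_act; auto.
  - intros (s0 & j & (f & Hf & Hfit & ->) & Hj & -> & Hl).
    set (g := fun x => if x =? i then j else f x).
    assert (forall x, In x r -> g x = f x) as Hg.
    { intros x Hx. unfold g. destruct (Nat.eqb_spec x i); auto. now subst. }
    assert (g i = j) as Hgi by (unfold g; now rewrite Nat.eqb_refl).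
    assert (map f (filter (alive t) (act r)) = map g (filter (alive t) (act r))) as Em.
    { apply map_ext_in. intros x Hx. symmetry. apply Hg, act_incl. now apply filter_In in Hx. }
    exists g. split; [|split].
    + intros x [<-|Hx]; [lia|]. rewrite Hg; auto.
    + intros c Hc. apply fits_c_cons; auto. split.
      * intros t' j'. rewrite (filter_ext_in _ (fun i => (f i =? j') && activeb I i t')).
        -- now apply Hfit.
        -- intros a Ha. now rewrite Hg.
      * specialize (Hl c Hc). rewrite restrict_map, Em, load_map in Hl.
        rewrite Hgi. rewrite <- (filter_act (start I i)) by auto. exact Hl.
    + cbn. rewrite Hgi. f_equal. rewrite restrict_map. exact Em.
Qed.

Lemma act_length_le h r : is_height I h -> NoDup r ->
  (forall a, In a r -> a < n_req I /\ nonempty a = true) ->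
  StronglySorted (fun a b => start I b <= start I a) r -> length (act r) <= h.
Proof.
  intros [Hh _] Hn Hr Hs. destruct r as [|i r]; [cbn; lia|].
  etransitivity; [|apply (Hh (start I i))]. unfold num_active. apply NoDup_incl_length.
  { now apply act_NoDup. }
  apply StronglySorted_inv in Hs as [_ Hs]. rewrite Forall_forall in Hs.
  intros x Hx. apply filter_In. split.
  - apply in_seq. apply act_incl in Hx. specialize (Hr x Hx). lia.
  - unfold activeb. apply andb_true_iff. cbn in Hx. destruct Hx as [<-|Hx].
    + split; [apply Nat.leb_refl|]. now apply (Hr i (or_introl eq_refl)).
    + apply filter_In in Hx as [Hx Ha]. split; [|exact Ha]. apply Nat.leb_le, Hs. now apply act_incl.
Qed.

End Packing.

(** * Sorting program *)

Arguments upd m a v x /.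
Notation "a ;; b" := (Seq a b) (at level 90, right associativity).

Ltac ev := cbn [eval eop vars arrs clk setv seta tick upd Nat.eqb].
Ltac ev_in H := cbn [eval eop vars arrs clk setv seta tick upd Nat.eqb] in H.

Notation vN := 0 (only parsing).
Notation vK := 1 (only parsing).
Notation vD := 2 (only parsing).
Notation vM := 3 (only parsing).
Notation vRES := 4 (only parsing).
Notation v1 := 5 (only parsing).
Notation v0 := 6 (only parsing).
Notation v2 := 7 (only parsing).

Notation aOFF := 1 (only parsing).
Notation aSTART := 2 (only parsing).
Notation aFIN := 3 (only parsing).
Notation aX := 4 (only parsing).
Notation aY := 5 (only parsing).
Notation aQ := 6 (only parsing).
Notation aACT := 7 (only parsing).
Notation aACT2 := 8 (only parsing).
Notation aF := 9 (only parsing).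
Notation aG := 10 (only parsing).
Notation aDIG := 11 (only parsing).
Notation aDIG2 := 12 (only parsing).

Definition seg (f : nat -> nat) (lo len : nat) : list nat := map f (seq lo len).

Lemma seg_length f lo len : length (seg f lo len) = len.
Proof. unfold seg. now rewrite length_map, length_seq. Qed.

Lemma seg_cons f lo len : 0 < len -> seg f lo len = f lo :: seg f (S lo) (len - 1).
Proof. intros H. destruct len; [lia|]. cbn. now rewrite Nat.sub_0_r. Qed.

Lemma seg_snoc f lo len : seg f lo (S len) = seg f lo len ++ [f (lo + len)].
Proof. unfold seg. now rewrite seq_S, map_app. Qed.

Lemma seg_ext f g lo len : (forall i, lo <= i < lo + len -> f i = g i) -> seg f lo len = seg g lo len.
Proof. intros H. apply map_ext_in. intros i Hi. apply in_seq in Hi. now apply H. Qed.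

Lemma seg_aupd_snoc f o v : seg (aupd f o v) 0 (S o) = seg f 0 o ++ [v].
Proof.
  rewrite seg_snoc. cbn [Nat.add]. rewrite aupd_eq. f_equal. apply seg_ext. intros i Hi.
  apply aupd_neq. lia.
Qed.

Lemma seg_firstn f w lo len : firstn w (seg f lo len) = seg f lo (min w len).
Proof.
  revert lo len. induction w as [|w IH]; intros lo len; auto.
  destruct len; auto. cbn. f_equal. apply IH.
Qed.

Lemma seg_skipn f w lo len : skipn w (seg f lo len) = seg f (lo + w) (len - w).
Proof.
  revert lo len. induction w as [|w IH]; intros lo len.
  - now rewrite Nat.add_0_r, Nat.sub_0_r.
  - destruct len; auto. cbn. rewrite Nat.add_succ_r. apply IH.
Qed.

Lemma seg_app f lo n1 n2 : seg f lo (n1 + n2) = seg f lo n1 ++ seg f (lo + n1) n2.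
Proof. unfold seg. now rewrite seq_app, map_app. Qed.

Lemma seg_in f len x : In x (seg f 0 len) -> exists i, i < len /\ f i = x.
Proof. intros H. apply in_map_iff in H as (i & E & H). apply in_seq in H. exists i. split; auto. lia. Qed.

Lemma seg_nth_in f len i : i < len -> In (f i) (seg f 0 len).
Proof. intros H. apply in_map. apply in_seq. lia. Qed.

Section Sort.
Variables (inp : nat -> nat) (lim : nat).
Notation run := (eval inp lim).

Notation vw := 8 (only parsing).
Notation vp := 9 (only parsing).
Notation vo := 10 (only parsing).
Notation vhi := 11 (only parsing).
Notation vmid := 12 (only parsing).
Notation vi := 13 (only parsing).
Notation vj := 14 (only parsing).
Notation va := 15 (only parsing).
Notation vb := 16 (only parsing).

Definition next_block : cmd :=
  Op (OAdd vi vo v0);; Op (OAdd vmid vo vw);; Ifle vmid vM Skip (Op (OAdd vmid vM v0));;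
  Op (OAdd vj vmid v0);; Op (OAdd vhi vmid vw);; Ifle vhi vM Skip (Op (OAdd vhi vM v0)).

Definition take (v : nat) : cmd :=
  Op (OLd va aX v);; Op (OSt aY vo va);; Op (OAdd v v v1).

Definition pick (key : nat) : cmd :=
  Ifle vmid vi (take vj)
    (Ifle vhi vj (take vi)
      (Op (OLd va aX vi);; Op (OLd va key va);; Op (OLd vb aX vj);; Op (OLd vb key vb);;
       Ifle va vb (take vi) (take vj))).

Definition pass_cmd (key : nat) : cmd :=
  Op (OConst vhi 0);; Op (OConst vi 0);; Op (OConst vj 0);; Op (OConst vmid 0);;
  For vo vM (Ifle vhi vo next_block Skip;; pick key).

Definition merge_state (key : nat -> nat) (x : nat -> nat) (N w o : nat) (s : st) : Prop :=
  let i := vars s vi in let mid := vars s vmid in let j := vars s vj in let hi := vars s vhi in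
  o <= hi <= N /\ i <= mid /\ mid <= j <= hi /\ hi = o + (mid - i) + (hi - j) /\
  seg (arrs s aY) 0 o ++ merge key (seg x i (mid - i)) (seg x j (hi - j)) ++
    pass key w (seg x hi (N - hi)) = pass key w (seg x 0 N).

Lemma next_block_spec key x N w o s :
  vars s v0 = 0 -> vars s vM = N -> vars s vw = w -> 0 < w -> vars s vo = o -> o < N ->
  vars s vhi = o -> merge_state key x N w o s ->
  let s' := run next_block s in
  merge_state key x N w o s' /\ o < vars s' vhi /\ clk s' <= clk s + 8.
Proof.
  intros H0 HM Hw Hpos Ho HoN Hhi (A & B & C & D & E).
  assert (forall hi mid, mid = min (o + w) N -> hi = min (mid + w) N ->
    seg (arrs s aY) 0 o ++ merge key (seg x o (mid - o)) (seg x mid (hi - mid)) ++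
    pass key w (seg x hi (N - hi)) = pass key w (seg x 0 N)) as Hmain.
  { intros hi mid -> ->. rewrite <- E. f_equal.
    replace (vars s vmid - vars s vi) with 0 by lia.
    replace (vars s vhi - vars s vj) with 0 by lia. rewrite Hhi.
    cbn [seg seq map]. rewrite merge_nil_l. cbn [app].
    rewrite (pass_unfold key w (seg x o (N - o))); auto.
    2:{ rewrite seg_cons by lia. easy. }
    rewrite !seg_skipn, !seg_firstn. f_equal; [f_equal|].
    - f_equal. lia.
    - destruct (le_lt_dec (o + w) N) as [Hle|Hlt].
      + f_equal; lia.
      + replace (min w (N - o - w)) with 0 by lia.
        replace (min (min (o + w) N + w) N - min (o + w) N) with 0 by lia. reflexivity.
    - f_equal. destruct (le_lt_dec (o + w + w) N) as [Hle|Hlt].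
      + f_equal; lia.
      + replace (N - o - w - w) with 0 by lia.
        replace (N - min (min (o + w) N + w) N) with 0 by lia. reflexivity. }
  unfold merge_state, next_block in *. cbv zeta. ev. rewrite H0, HM, Hw, Ho.
  destruct (Nat.leb_spec (o + w) N); ev; rewrite ?H0, ?HM, ?Hw, ?Ho, ?Nat.add_0_r.
  - destruct (Nat.leb_spec (o + w + w) N); ev; rewrite ?H0, ?HM, ?Nat.add_0_r;
      (split; [|lia]); repeat (split; [lia|]); apply Hmain; lia.
  - destruct (Nat.leb_spec (N + w) N); ev; rewrite ?H0, ?HM, ?Nat.add_0_r; [lia|].
      (split; [|lia]); repeat (split; [lia|]); apply Hmain; lia.
Qed.

Lemma pick_spec kn x N w o s :
  let key := arrs s kn in
  x = arrs s aX -> vars s v1 = 1 -> vars s vo = o -> o < vars s vhi ->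
  merge_state key x N w o s ->
  let s' := run (pick kn) s in
  merge_state key x N w (S o) s' /\ clk s' <= clk s + 12.
Proof.
  intros key Hx H1 Ho Hlt (A & B & C & D & E).
  set (i := vars s vi) in *. set (mid := vars s vmid) in *. set (j := vars s vj) in *.
  set (hi := vars s vhi) in *.
  assert (forall v l, seg (aupd (arrs s aY) o v) 0 (S o) ++ l = seg (arrs s aY) 0 o ++ v :: l) as HY.
  { intros v l. now rewrite seg_aupd_snoc, <- app_assoc. }
  assert (mid < i + 1 \/ seg x i (mid - i) = x i :: seg x (i + 1) (mid - (i + 1))) as Hi.
  { destruct (le_lt_dec mid i); [left; lia|right]. rewrite seg_cons by lia.
    f_equal. f_equal; lia. }
  assert (hi < j + 1 \/ seg x j (hi - j) = x j :: seg x (j + 1) (hi - (j + 1))) as Hj.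
  { destruct (le_lt_dec hi j); [left; lia|right]. rewrite seg_cons by lia.
    f_equal. f_equal; lia. }
  unfold merge_state, pick, take. cbv zeta. ev. fold mid i hi j.
  destruct (Nat.leb_spec mid i); ev; fold mid i hi j; rewrite ?H1, ?Ho.
  { split; [|lia]. repeat (split; [lia|]). rewrite HY, <- E.
    replace (mid - i) with 0 by lia. destruct Hj as [Hj|Hj]; [lia|].
    rewrite Hj. cbn [seg seq map]. rewrite !merge_nil_l. cbn [app]. subst x. reflexivity. }
  destruct Hi as [Hi|Hi]; [lia|].
  destruct (Nat.leb_spec hi j); ev; fold mid i hi j; rewrite ?H1, ?Ho.
  { split; [|lia]. repeat (split; [lia|]). rewrite HY, <- E.
    replace (hi - j) with 0 by lia. rewrite Hi. cbn [seg seq map]. rewrite !merge_nil_r.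
    cbn [app]. subst x. reflexivity. }
  destruct Hj as [Hj|Hj]; [lia|]. rewrite Hi, Hj, merge_cons in E.
  subst x.
  destruct (Nat.leb_spec (arrs s kn (arrs s aX i)) (arrs s kn (arrs s aX j))) as [Hc|Hc]; ev;
    fold mid i hi j; rewrite ?H1, ?Ho; (split; [|lia]); repeat (split; [lia|]); rewrite HY, <- E; unfold key.
  - apply Nat.leb_le in Hc. rewrite Hc, Hj. reflexivity.
  - apply Nat.leb_gt in Hc. rewrite Hc, Hi. reflexivity.
Qed.

Lemma pass_cmd_spec kn s :
  (kn =? aY) = false -> vars s v0 = 0 -> vars s v1 = 1 -> 0 < vars s vw ->
  let N := vars s vM in
  let s' := run (pass_cmd kn) s in
  seg (arrs s' aY) 0 N = pass (arrs s kn) (vars s vw) (seg (arrs s aX) 0 N) /\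
  clk s' <= clk s + 5 + 25 * N.
Proof.
  intros Hkn H0 H1 Hw N. set (w := vars s vw) in *. set (x := arrs s aX). set (key := arrs s kn).
  unfold pass_cmd. set (body := Ifle _ _ _ _;; _). set (loop := For _ _ _). ev. subst loop.
  cbv zeta. set (s1 := setv vmid 0 _).
  change (arrs s kn) with (arrs s1 kn) in key. change (arrs s aX) with (arrs s1 aX) in x.
  change (vars s v0) with (vars s1 v0) in H0. change (vars s v1) with (vars s1 v1) in H1.
  change (vars s vw) with (vars s1 vw) in w. change N with (vars s1 vM).
  pose proof (eval_for inp lim vo vM body
    (fun o s2 => merge_state key x N w o s2 /\ clk s2 <= clk s1 + 1 + 25 * o) s1) as H.
  cbv beta in H. change (vars s1 vM) with N in H |- *.
  change (clk s1) with (S (S (S (S (clk s))))) in H. fold (run (For vo vM body) s1) in H.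
  destruct H as [(A & B & C & D & E) Hclk].
  - split; [|cbn; lia]. unfold merge_state. cbn. rewrite !Nat.sub_0_r.
    repeat (split; [lia|]). reflexivity.
  - intros i s2 Hi [Hm Hc] Ho F.
    pose proof (proj1 F v0 eq_refl) as F0. pose proof (proj1 F v1 eq_refl) as F1.
    pose proof (proj1 F vM eq_refl) as FM. pose proof (proj1 F vw eq_refl) as Fw.
    assert (arrs s2 kn = key) as Fk.
    { apply (proj1 (proj2 F) kn). cbn. now rewrite Hkn. }
    pose proof (proj1 (proj2 F) aX eq_refl) as Fx. fold x in Fx.
    rewrite H0 in F0. rewrite H1 in F1. change (vars s1 vM) with N in FM. fold w in Fw.
    clear F. unfold body. cbn [eval vars]. rewrite Ho.
    destruct (Nat.leb_spec (vars s2 vhi) i) as [Hhi|Hhi].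
    + assert (vars s2 vhi = i) as Hhi' by (destruct Hm; lia).
      pose proof (next_block_spec key x N w i (tick s2)) as HB. cbv zeta in HB.
      destruct HB as (B1 & B2 & B3); try assumption.
      pose proof (eval_frame inp lim next_block (tick s2)) as F.
      cbn [eval] in *. set (s3 := run next_block (tick s2)) in *.
      pose proof (proj1 F v1 eq_refl) as G1. pose proof (proj1 F vo eq_refl) as Go.
      pose proof (proj1 (proj2 F) kn eq_refl) as Gk. pose proof (proj1 (proj2 F) aX eq_refl) as Gx.
      ev_in G1. ev_in Go. ev_in Gk. ev_in Gx. ev_in B3.
      pose proof (pick_spec kn x N w i s3) as HP. cbv zeta in HP.
      rewrite Gk, Fk, Gx, Fx, G1, F1, Go, Ho in HP.
      destruct HP as [P1 P2]; auto. split; [exact P1|]. ev. lia.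
    + cbn [eval]. pose proof (pick_spec kn x N w i (tick s2)) as HP. cbv zeta in HP.
      ev_in HP. rewrite Fk, Fx, F1, Ho in HP.
      destruct HP as [P1 P2]; auto. split; [exact P1|]. ev. lia.
  - replace (vars (run (For vo vM body) s1) vmid - vars (run (For vo vM body) s1) vi) with 0 in E by lia.
    replace (vars (run (For vo vM body) s1) vhi - vars (run (For vo vM body) s1) vj) with 0 in E by lia.
    replace (N - vars (run (For vo vM body) s1) vhi) with 0 in E by lia.
    cbn [seg seq map] in E. rewrite merge_nil_l, pass_nil in E. cbn [app] in E.
    rewrite app_nil_r in E. split; [exact E|]. lia.
Qed.

Definition copy_cmd (src dst : nat) : cmd := For vo vM (Op (OLd va src vo);; Op (OSt dst vo va)).

Lemma copy_cmd_spec src dst s :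
  (src =? dst) = false ->
  let s' := run (copy_cmd src dst) s in
  seg (arrs s' dst) 0 (vars s vM) = seg (arrs s src) 0 (vars s vM) /\
  clk s' <= clk s + 1 + 3 * vars s vM.
Proof.
  intros Hne. apply (eval_for inp lim vo vM (Op (OLd va src vo);; Op (OSt dst vo va))
    (fun o s2 => seg (arrs s2 dst) 0 o = seg (arrs s src) 0 o /\ clk s2 <= clk s + 1 + 3 * o)).
  - split; [reflexivity|cbn; lia].
  - intros i s1 Hi [A B] Ho F.
    assert (arrs s1 src = arrs s src) as E. { apply (proj1 (proj2 F)). cbn. now rewrite Hne. }
    ev. rewrite Nat.eqb_refl, Ho, E. split; [|lia]. rewrite seg_aupd_snoc, A, seg_snoc. reflexivity.
Qed.

Definition sort_cmd (kn : nat) : cmd :=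
  Op (OConst vw 1);;
  For vp vM (Ifle vM vw Skip (pass_cmd kn;; copy_cmd aY aX;; Op (OAdd vw vw vw))).

Lemma sort_cmd_spec kn s :
  (kn =? aY) = false -> (kn =? aX) = false -> vars s v0 = 0 -> vars s v1 = 1 ->
  let N := vars s vM in
  let s' := run (sort_cmd kn) s in
  sorted (arrs s kn) (seg (arrs s' aX) 0 N) /\
  Permutation (seg (arrs s aX) 0 N) (seg (arrs s' aX) 0 N) /\
  clk s' <= clk s + 2 + 3 * N + (Nat.log2 N + 1) * (28 * N + 10).
Proof.
  intros Hkn Hkn' H0 H1 N. unfold sort_cmd. set (body := Ifle _ _ _ _).
  set (s1 := run (Op (OConst vw 1)) s). set (key := arrs s kn).
  pose proof (eval_for inp lim vp vM body
    (fun p s2 => chunks key (vars s2 vw) (seg (arrs s2 aX) 0 N) /\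
       Permutation (seg (arrs s aX) 0 N) (seg (arrs s2 aX) 0 N) /\
       exists e, vars s2 vw = 2 ^ e /\ (e = 0 \/ 2 ^ (e - 1) < N) /\ (e = p \/ N <= vars s2 vw) /\
         clk s2 <= clk s + 2 + 3 * p + e * (28 * N + 10)) s1) as H.
  cbv zeta. change (vars s1 vM) with N in H.
  change (run (Op (OConst vw 1);; For vp vM body) s) with (run (For vp vM body) s1).
  destruct H as (A & B & e & C & D & E & G).
  - split; [|split].
    + cbn. apply chunks_one.
    + cbn. reflexivity.
    + exists 0. cbn. repeat split; auto; lia.
  - intros p s2 Hp (A & B & e & C & D & E & G) Hvp F.
    pose proof (eq_trans (proj1 F v0 eq_refl) H0) as F0.
    pose proof (eq_trans (proj1 F v1 eq_refl) H1) as F1. pose proof (proj1 F vM eq_refl) as FM.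
    change (vars s1 vM) with N in FM.
    assert (arrs s2 kn = key) as Fk.
    { apply (proj1 (proj2 F) kn). cbn. now rewrite Hkn, Hkn'. }
    clear F. unfold body. cbn [eval].
    rewrite FM. destruct (Nat.leb_spec N (vars s2 vw)) as [Hle|Hlt].
    + ev. split; [|split]; auto. exists e. repeat split; auto. lia.
    + destruct E as [E|E]; [|lia]. subst e.
      assert (0 < vars s2 vw) as Hw by (rewrite C; apply Nat.neq_0_lt_0, Nat.pow_nonzero; lia).
      destruct (pass_cmd_spec kn (tick s2) Hkn F0 F1 Hw) as [P1 P2].
      pose proof (eval_frame inp lim (pass_cmd kn) (tick s2)) as F.
      set (s3 := run (pass_cmd kn) (tick s2)) in *.
      pose proof (proj1 F vM eq_refl) as FM3. pose proof (proj1 F vw eq_refl) as Fw3.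
      ev_in FM3. ev_in Fw3. ev_in P1. ev_in P2. rewrite FM in P1, P2, FM3. clear F.
      destruct (copy_cmd_spec aY aX s3 eq_refl) as [Q1 Q2].
      pose proof (eval_frame inp lim (copy_cmd aY aX) s3) as F.
      set (s4 := run (copy_cmd aY aX) s3) in *.
      pose proof (proj1 F vw eq_refl) as Fw4. rewrite Fw3 in Fw4. rewrite FM3 in Q1, Q2. clear F.
      rewrite P1, Fk in Q1.
      destruct (pass_correct key (vars s2 vw) _ Hw A) as [R1 R2].
      ev. rewrite Fw4, Q1. split; [|split]; auto.
      * etransitivity; [exact B|exact R2].
      * exists (S p). split; [cbn; lia|]. split; [right; cbn; rewrite Nat.sub_0_r; lia|].
        split; [now left|]. lia.
  - assert (N <= vars (run (For vp vM body) s1) vw) as HN.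
    { destruct E as [E|E]; auto. rewrite C, E. apply Nat.lt_le_incl, Nat.pow_gt_lin_r. lia. }
    split; [|split]; auto.
    + eapply chunks_all; [|exact A]. now rewrite seg_length.
    + assert (e <= Nat.log2 N + 1) as He.
      { destruct D as [D|D]; [lia|]. destruct e as [|e]; [lia|]. cbn in D. rewrite Nat.sub_0_r in D.
        assert (0 < N) as HN0 by lia. apply Nat.lt_le_incl, Nat.log2_le_pow2 in D; auto. lia. }
      etransitivity; [exact G|]. apply Nat.add_le_mono_l. now apply Nat.mul_le_mono_r.
Qed.

End Sort.

(** * Input, preparation and the case of one bin *)

Lemma StronglySorted_seg (Rel : nat -> nat -> Prop) x N i j :
  StronglySorted Rel (seg x 0 N) -> i < j < N -> Rel (x i) (x j).
Proof.
  intros H Hij. replace N with (i + S (N - i - 1)) in H by lia. rewrite seg_app in H.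
  assert (StronglySorted Rel (seg x (0 + i) (S (N - i - 1)))) as H'.
  { induction (seg x 0 i) as [|a l IH]; auto. cbn in H. apply StronglySorted_inv in H as [H _]. auto. }
  rewrite seg_cons in H' by lia. apply StronglySorted_inv in H' as [_ H'].
  rewrite Forall_forall in H'. apply H'. apply in_map. apply in_seq. lia.
Qed.

Lemma sorted_rev (key : nat -> nat) l :
  sorted key l -> StronglySorted (fun a b => key b <= key a) (rev l).
Proof.
  induction 1 as [|a l H IH F]; cbn; [constructor|].
  rewrite Forall_forall in F.
  assert (forall b, In b (rev l) -> key a <= key b) as F' by (intros b Hb; apply F; now apply in_rev).
  clear F H. induction IH as [|b l' H IH F]; cbn in *.
  - repeat constructor.
  - constructor; auto. apply Forall_app. split; auto.
Qed.

Lemma jobs_lt {I : instance} l x : Permutation l (filter (nonempty I) (seq 0 (n_req I))) -> In x l -> x < n_req I /\ 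
  nonempty I x = true.
Proof.
  intros P H. apply (Permutation_in _ P), filter_In in H as [H1 H2]. apply in_seq in H1. split; auto. lia.
Qed.

Section Env.
Variables (d : nat) (I : instance) (k lim : nat).
Notation n := (n_req I).
Hypothesis Hlim : (d + 2) * (n + 1) <= lim.
Notation run := (eval (encode d I k) lim).
Notation word := (raw (encode d I k) lim).

Lemma raw_inp s v : v < lim -> word s v = encode d I k v.
Proof. intros H. unfold raw. apply Nat.ltb_lt in H. now rewrite H. Qed.

Lemma encode_block i c : i < n -> c < d + 2 ->
  encode d I k ((d + 2) * (i + 1) + c) =
  if c <? d then size I i c else if c =? d then start I i else fin I i.
Proof.
  intros Hi Hc. unfold encode.
  destruct (Nat.eqb_spec ((d + 2) * (i + 1) + c) 0); [nia|].
  destruct (Nat.eqb_spec ((d + 2) * (i + 1) + c) 1); [nia|].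
  destruct (Nat.ltb_spec ((d + 2) * (i + 1) + c) (d + 2)); [nia|].
  replace ((d + 2) * (i + 1) + c - (d + 2)) with (c + i * (d + 2)) by nia. cbv zeta.
  rewrite Nat.div_add, Nat.Div0.mod_add, Nat.div_small, Nat.mod_small by lia.
  cbn [Nat.add]. apply Nat.ltb_lt in Hi. now rewrite Hi.
Qed.

Lemma block_lt i c : i < n -> c < d + 2 -> (d + 2) * (i + 1) + c < lim.
Proof. intros. nia. Qed.

Lemma raw_size s i c : i < n -> c < d -> word s ((d + 2) * (i + 1) + c) = size I i c.
Proof.
  intros Hi Hc. rewrite raw_inp by (apply block_lt; lia). rewrite encode_block by lia.
  apply Nat.ltb_lt in Hc. now rewrite Hc.
Qed.

Lemma raw_start s i : i < n -> word s ((d + 2) * (i + 1) + d) = start I i.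
Proof.
  intros Hi. rewrite raw_inp by (apply block_lt; lia). rewrite encode_block by lia.
  now rewrite Nat.ltb_irrefl, Nat.eqb_refl.
Qed.

Lemma raw_fin s i : i < n -> word s ((d + 2) * (i + 1) + d + 1) = fin I i.
Proof.
  intros Hi. rewrite <- Nat.add_assoc, raw_inp by (apply block_lt; lia). rewrite encode_block by lia.
  destruct (Nat.ltb_spec (d + 1) d); [lia|]. destruct (Nat.eqb_spec (d + 1) d); [lia|]. reflexivity.
Qed.

Lemma raw_cap s c : c < d -> word s (c + 2) = cap I c.
Proof.
  intros Hc. rewrite raw_inp by nia. unfold encode.
  destruct (Nat.eqb_spec (c + 2) 0); [lia|]. destruct (Nat.eqb_spec (c + 2) 1); [lia|].
  destruct (Nat.ltb_spec (c + 2) (d + 2)); [|lia]. f_equal. lia.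
Qed.

Record env (s : st) : Prop := {
  env_N : vars s vN = n;
  env_K : vars s vK = k;
  env_D : vars s vD = d;
  env_1 : vars s v1 = 1;
  env_0 : vars s v0 = 0;
  env_2 : vars s v2 = 2;
  env_off : forall i, i < n -> arrs s aOFF i = (d + 2) * (i + 1);
  env_start : forall i, i < n -> arrs s aSTART i = start I i;
  env_fin : forall i, i < n -> arrs s aFIN i = fin I i }.

Definition keeps_env (c : cmd) : bool :=
  forallb (fun x => negb (wrv c x)) [vN; vK; vD; v1; v0; v2] &&
  forallb (fun a => negb (wra c a)) [aOFF; aSTART; aFIN].

Lemma env_frame c s s' : keeps_env c = true -> frame c s s' -> env s -> env s'.
Proof.
  unfold keeps_env. rewrite andb_true_iff, !forallb_forall. intros [Hv Ha] (Fv & Fa & _) H.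
  assert (forall x, In x [vN; vK; vD; v1; v0; v2] -> vars s' x = vars s x) as Ev.
  { intros x Hx. apply Fv. apply negb_true_iff. auto. }
  assert (forall a, In a [aOFF; aSTART; aFIN] -> arrs s' a = arrs s a) as Ea.
  { intros a Hx. apply Fa. apply negb_true_iff. auto. }
  destruct H. constructor; intros; rewrite ?Ev, ?Ea by (cbn; tauto); auto.
Qed.

(* Variable 8 is the request index, 9 the address of its input block, 10 the block length. *)
Definition init_body : cmd :=
  Op (OAdd 9 9 10);; Op (OSt aOFF 8 9);; Op (OAdd 11 9 vD);; Op (OInp 12 11);; Op (OSt aSTART 8 12);;
  Op (OAdd 11 11 v1);; Op (OInp 12 11);; Op (OSt aFIN 8 12).

Definition init_loop : cmd := For 8 vN init_body.

Definition init_cmd : cmd :=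
  Op (OConst v1 1);; Op (OConst v0 0);; Op (OConst v2 2);; Op (OConst vD d);;
  Op (OInp vN v0);; Op (OInp vK v1);; Op (OConst 9 0);; Op (OConst 10 (d + 2));; init_loop.

Lemma init_cmd_spec s :
  let s' := run init_cmd s in env s' /\ clk s' <= clk s + 9 + 9 * n.
Proof.
  unfold init_cmd. ev. set (s1 := setv 10 _ _). cbv zeta.
  assert (vars s1 vN = n) as EN by (cbn; rewrite raw_inp by nia; reflexivity).
  assert (vars s1 vK = k) as EK by (cbn; rewrite raw_inp by nia; reflexivity).
  pose proof (eval_for (encode d I k) lim 8 vN init_body
    (fun i s2 => vars s2 9 = (d + 2) * i /\
      (forall j, j < i -> arrs s2 aOFF j = (d + 2) * (j + 1) /\ arrs s2 aSTART j = start I j /\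
         arrs s2 aFIN j = fin I j) /\ clk s2 <= clk s + 9 + 9 * i) s1) as H.
  fold init_loop in H. rewrite EN in H. destruct H as (A & B & C).
  - split; [|split].
    + cbn. lia.
    + intros; lia.
    + cbn. lia.
  - intros i s2 Hi (A & B & C) E8 F.
    pose proof (proj1 F 10 eq_refl : vars s2 10 = d + 2) as F10.
    pose proof (proj1 F vD eq_refl : vars s2 vD = d) as FD.
    pose proof (proj1 F v1 eq_refl : vars s2 v1 = 1) as F1.
    unfold init_body. ev. rewrite E8, A, F10, FD, F1.
    replace ((d + 2) * i + (d + 2)) with ((d + 2) * (i + 1)) by lia.
    rewrite raw_start, raw_fin by auto.
    split; [lia|]. split; [|lia].
    intros j Hj. destruct (Nat.eq_dec j i) as [->|Hne].
    + rewrite !aupd_eq. auto.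
    + rewrite !aupd_neq by auto. apply B. lia.
  - split; [|lia]. pose proof (eval_frame (encode d I k) lim init_loop s1) as F.
    constructor; try (intros i Hi; now apply B);
      (match goal with |- vars _ ?x = _ => rewrite (proj1 F x eq_refl) end); auto.
Qed.

Definition collect_body : cmd :=
  Op (OLd 9 aSTART 8);; Op (OLd 10 aFIN 8);;
  Ifle 10 9 Skip (Op (OSt aX vM 8);; Op (OAdd vM vM v1)).

Definition collect_loop : cmd := For 8 vN collect_body.

Definition collect_cmd : cmd := Op (OConst vM 0);; collect_loop.

Lemma collect_cmd_spec s : env s ->
  let s' := run collect_cmd s in
  seg (arrs s' aX) 0 (vars s' vM) = filter (nonempty I) (seq 0 n) /\ clk s' <= clk s + 2 + 6 * n.
Proof.
  intros He. unfold collect_cmd. ev. set (s1 := setv vM _ _). cbv zeta.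
  pose proof (eval_for (encode d I k) lim 8 vN collect_body
    (fun i s2 => seg (arrs s2 aX) 0 (vars s2 vM) = filter (nonempty I) (seq 0 i) /\
       clk s2 <= clk s + 2 + 6 * i) s1) as H.
  change (vars s1 vN) with (vars s vN) in H. rewrite (env_N _ He) in H. apply H; clear H.
  - split; [reflexivity|cbn; lia].
  - intros i s2 Hi [A B] E8 F.
    pose proof (eq_trans (proj1 F v1 eq_refl) (env_1 _ He)) as F1.
    pose proof (proj1 (proj2 F) aSTART eq_refl) as Fs. pose proof (proj1 (proj2 F) aFIN eq_refl) as Ff.
    change (arrs s2 aSTART = arrs s aSTART) in Fs. change (arrs s2 aFIN = arrs s aFIN) in Ff.
    unfold collect_body. ev. rewrite E8, Fs, Ff, (env_start _ He), (env_fin _ He) by auto.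
    rewrite seq_S, filter_app. cbn [filter Nat.add]. unfold nonempty at 2.
    destruct (Nat.leb_spec (fin I i) (start I i)) as [Hl|Hl].
    + ev. destruct (Nat.ltb_spec (start I i) (fin I i)); [lia|]. rewrite app_nil_r. split; auto. lia.
    + ev. destruct (Nat.ltb_spec (start I i) (fin I i)); [|lia].
      rewrite F1, ?E8, Nat.add_1_r, seg_aupd_snoc, A. split; auto. lia.
Qed.

Record jobs (s : st) : Prop := {
  jobs_perm : Permutation (seg (arrs s aX) 0 (vars s vM)) (filter (nonempty I) (seq 0 n));
  jobs_sorted : sorted (start I) (seg (arrs s aX) 0 (vars s vM));
  jobs_perm_fin : Permutation (seg (arrs s aQ) 0 (vars s vM)) (filter (nonempty I) (seq 0 n));
  jobs_sorted_fin : sorted (fin I) (seg (arrs s aQ) 0 (vars s vM)) }.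

Lemma sorted_ext (key key' : nat -> nat) l : (forall a, In a l -> key a = key' a) -> sorted key l -> sorted key' l.
Proof.
  intros H S. induction S as [|a l S IH F]; constructor.
  - apply IH. intros b Hb. apply H. now right.
  - rewrite Forall_forall in *. intros b Hb. rewrite <- !H; cbn; auto.
Qed.

Definition prepare_cmd : cmd :=
  collect_cmd;; sort_cmd aFIN;; copy_cmd aX aQ;; sort_cmd aSTART.

Lemma prepare_cmd_spec s : env s ->
  let s' := run prepare_cmd s in
  env s' /\ jobs s' /\ vars s' vM <= n /\
  clk s' <= clk s + 7 + 15 * n + 2 * ((Nat.log2 n + 1) * (28 * n + 10)).
Proof.
  intros He. unfold prepare_cmd. cbn [eval]. cbv zeta.
  destruct (collect_cmd_spec s He) as [A1 A2].
  pose proof (env_frame collect_cmd s _ eq_refl (eval_frame (encode d I k) lim _ _) He) as He1.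
  set (s1 := run collect_cmd s) in *. set (N := vars s1 vM) in *.
  assert (N <= n) as HN.
  { rewrite <- (seg_length (arrs s1 aX) 0 N), A1. rewrite <- (length_seq n 0) at 2.
    apply filter_length_le. }
  destruct (sort_cmd_spec (encode d I k) lim aFIN s1 eq_refl eq_refl (env_0 _ He1) (env_1 _ He1))
    as (B1 & B2 & B3).
  pose proof (eval_frame (encode d I k) lim (sort_cmd aFIN) s1) as F2.
  pose proof (env_frame (sort_cmd aFIN) s1 _ eq_refl F2 He1) as He2.
  set (s2 := run (sort_cmd aFIN) s1) in *. fold N in B1, B2, B3.
  pose proof (proj1 F2 vM eq_refl) as M2. fold N in M2.
  destruct (copy_cmd_spec (encode d I k) lim aX aQ s2 eq_refl) as (C1 & C2).
  pose proof (eval_frame (encode d I k) lim (copy_cmd aX aQ) s2) as F3.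
  pose proof (env_frame (copy_cmd aX aQ) s2 _ eq_refl F3 He2) as He3.
  set (s3 := run (copy_cmd aX aQ) s2) in *.
  pose proof (proj1 F3 vM eq_refl) as M3. rewrite M2 in M3, C1, C2.
  pose proof (proj1 (proj2 F3) aX eq_refl) as X3.
  destruct (sort_cmd_spec (encode d I k) lim aSTART s3 eq_refl eq_refl (env_0 _ He3) (env_1 _ He3))
    as (D1 & D2 & D3).
  pose proof (eval_frame (encode d I k) lim (sort_cmd aSTART) s3) as F4.
  pose proof (env_frame (sort_cmd aSTART) s3 _ eq_refl F4 He3) as He4.
  set (s4 := run (sort_cmd aSTART) s3) in *. rewrite M3 in D1, D2, D3.
  pose proof (proj1 F4 vM eq_refl) as M4. rewrite M3 in M4.
  pose proof (proj1 (proj2 F4) aQ eq_refl) as Q4.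
  rewrite A1 in B2.
  split; [exact He4|]. split; [|split; [lia|]].
  - assert (Permutation (seg (arrs s4 aX) 0 N) (filter (nonempty I) (seq 0 n))) as P4.
    { rewrite <- D2, X3. now symmetry. }
    constructor; rewrite M4.
    + exact P4.
    + eapply sorted_ext; [|exact D1]. intros a Ha. apply (env_start _ He3).
      now apply (jobs_lt _ _ P4).
    + rewrite Q4, C1. now symmetry.
    + rewrite Q4, C1. eapply sorted_ext; [|exact B1]. intros a Ha. apply (env_fin _ He1).
      eapply jobs_lt; [symmetry; exact B2|exact Ha].
  - assert ((Nat.log2 N + 1) * (28 * N + 10) <= (Nat.log2 n + 1) * (28 * n + 10)) as HL.
    { apply Nat.mul_le_mono; [|lia]. apply Nat.add_le_mono_r. now apply Nat.log2_le_mono. }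
    lia.
Qed.

Section Sweep.
Variables (x y : nat -> nat) (N : nat).
Hypothesis Px : Permutation (seg x 0 N) (filter (nonempty I) (seq 0 n)).
Hypothesis Sx : sorted (start I) (seg x 0 N).
Hypothesis Py : Permutation (seg y 0 N) (filter (nonempty I) (seq 0 n)).
Hypothesis Sy : sorted (fin I) (seg y 0 N).

(* A finished request is nonempty, so it started strictly before [x p]. *)
Lemma finished_started g p : p < N ->
  sum_over (filter (fun a => negb (alive I (start I (x p)) a)) (seg y 0 N)) g =
  sum_over (filter (fun a => negb (alive I (start I (x p)) a)) (seg x 0 p)) g.
Proof.
  intros Hp. set (q := fun a => negb _).
  transitivity (sum_over (filter q (seg x 0 N)) g).
  { apply sum_over_perm, filter_perm. rewrite Py. now symmetry. }
  replace N with (p + (N - p)) by lia. rewrite seg_app, filter_app, sum_over_app.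
  rewrite (filter_none q (seg x (0 + p) (N - p))); [cbn; lia|].
  intros a Ha. apply in_map_iff in Ha as (i & <- & Hi). apply in_seq in Hi.
  assert (start I (x p) <= start I (x i)) as Hs.
  { destruct (Nat.eq_dec i p) as [->|]; [lia|].
    apply (StronglySorted_seg _ _ _ p i Sx). lia. }
  destruct (jobs_lt _ (x i) Px) as [_ Hn]; [apply seg_nth_in; lia|].
  unfold nonempty in Hn. apply Nat.ltb_lt in Hn. unfold q, alive.
  destruct (Nat.ltb_spec (start I (x p)) (fin I (x i))); auto. lia.
Qed.

Lemma load_after_departures g p q : p < N -> q <= N ->
  (forall q', q' < q -> fin I (y q') <= start I (x p)) ->
  (q < N -> start I (x p) < fin I (y q)) ->
  sum_over (filter (alive I (start I (x p))) (seg x 0 p)) g + sum_over (seg y 0 q) g =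
  sum_over (seg x 0 p) g.
Proof.
  intros Hp Hq H1 H2. rewrite (sum_filter_split (alive I (start I (x p))) (seg x 0 p)).
  f_equal. rewrite <- finished_started by auto.
  replace N with (q + (N - q)) by lia. rewrite seg_app, filter_app, sum_over_app.
  rewrite filter_all, filter_none; [cbn; lia| |].
  - intros a Ha. apply in_map_iff in Ha as (i & <- & Hi). apply in_seq in Hi.
    assert (fin I (y q) <= fin I (y i)) as Hs.
    { destruct (Nat.eq_dec i q) as [->|]; [lia|].
      apply (StronglySorted_seg _ _ _ q i Sy). lia. }
    unfold alive. destruct (Nat.ltb_spec (start I (x p)) (fin I (y i))); auto. lia.
  - intros a Ha. apply seg_in in Ha as (i & Hi & <-). specialize (H1 i Hi).
    unfold alive. destruct (Nat.ltb_spec (start I (x p)) (fin I (y i))); auto. lia.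
Qed.

Lemma departed_le g p q : p < N -> q < N ->
  (forall q', q' <= q -> fin I (y q') <= start I (x p)) ->
  sum_over (seg y 0 (S q)) g <= sum_over (seg x 0 p) g.
Proof.
  intros Hp Hq H1. set (f := fun a => negb (alive I (start I (x p)) a)).
  rewrite (sum_filter_split f (seg x 0 p)). unfold f at 1. rewrite <- finished_started by auto. fold f.
  replace N with (S q + (N - S q)) by lia. rewrite seg_app, filter_app, sum_over_app.
  rewrite (filter_all f (seg y 0 (S q))); [lia|].
  intros a Ha. apply seg_in in Ha as (i & Hi & <-). specialize (H1 i ltac:(lia)).
  unfold f, alive. destruct (Nat.ltb_spec (start I (x p)) (fin I (y i))); auto. lia.
Qed.

Lemma fits_c_arrival c p q : p < N -> q <= N ->
  (forall q', q' < q -> fin I (y q') <= start I (x p)) ->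
  (q < N -> start I (x p) < fin I (y q)) -> forall L,
  sum_over (seg x 0 p) (fun a => size I a c) = L + sum_over (seg y 0 q) (fun a => size I a c) ->
  fits_c I c (fun _ => 0) (rev (seg x 0 (S p))) <->
  fits_c I c (fun _ => 0) (rev (seg x 0 p)) /\ L + size I (x p) c <= cap I c.
Proof.
  intros Hp Hq H1 H2 L HL. rewrite seg_snoc, rev_app_distr. cbn [Nat.add rev app].
  rewrite fits_c_cons.
  - rewrite (filter_all (fun _ => 0 =? 0)) by auto.
    rewrite <- (load_after_departures _ p q) in HL by auto.
    rewrite (sum_over_perm (filter _ (rev _)) (filter (alive I (start I (x p))) (seg x 0 p))).
    + apply and_iff_compat_l. lia.
    + apply filter_perm. symmetry. apply Permutation_rev.
  - intros a Ha. apply in_rev in Ha. apply seg_in in Ha as (i & Hi & <-).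
    apply (StronglySorted_seg _ _ _ i p Sx). lia.
  - eapply jobs_lt; [exact Px|]. now apply seg_nth_in.
Qed.

End Sweep.

Notation sc := 8 (only parsing).
Notation sL := 9 (only parsing).
Notation sp := 10 (only parsing).
Notation sq := 11 (only parsing).
Notation scap := 12 (only parsing).
Notation stmp := 13 (only parsing).
Notation sM2 := 14 (only parsing).
Notation su := 15 (only parsing).
Notation si := 16 (only parsing).
Notation sti := 17 (only parsing).
Notation sj := 18 (only parsing).
Notation stj := 19 (only parsing).
Notation sz := 20 (only parsing).

Definition arrive_cmd : cmd :=
  Op (OLd stmp aOFF si);; Op (OAdd stmp stmp sc);; Op (OInp sz stmp);; Op (OAdd sL sL sz);;
  Op (OAdd sp sp v1);; Ifle sL scap Skip (Op (OConst vRES 0)).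

Definition depart_cmd : cmd :=
  Op (OLd stmp aOFF sj);; Op (OAdd stmp stmp sc);; Op (OInp sz stmp);; Op (OSub sL sL sz);;
  Op (OAdd sq sq v1).

Definition event_cmd : cmd :=
  Ifle vM sp Skip
    (Op (OLd si aX sp);; Op (OLd sti aSTART si);;
     Ifle vM sq arrive_cmd
       (Op (OLd sj aQ sq);; Op (OLd stj aFIN sj);; Ifle stj sti depart_cmd arrive_cmd)).

Definition event_loop : cmd := For su sM2 event_cmd.

Definition sweep_body : cmd :=
  Op (OConst sL 0);; Op (OConst sp 0);; Op (OConst sq 0);; Op (OAdd stmp sc v2);;
  Op (OInp scap stmp);; Op (OAdd sM2 vM vM);; event_loop.

Definition sweep_loop : cmd := For sc vD sweep_body.

Definition sweep_cmd : cmd := Op (OConst vRES 1);; sweep_loop.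

Record sweep_inv (s0 : st) (c u : nat) (s : st) : Prop := {
  sw_p : vars s sp <= vars s0 vM;
  sw_q : vars s sq <= vars s0 vM;
  sw_u : vars s sp = vars s0 vM \/ vars s sp + vars s sq = u;
  sw_load : sum_over (seg (arrs s0 aX) 0 (vars s sp)) (fun a => size I a c) =
    vars s sL + sum_over (seg (arrs s0 aQ) 0 (vars s sq)) (fun a => size I a c);
  sw_departed : forall q, q < vars s sq -> vars s sp < vars s0 vM ->
    fin I (arrs s0 aQ q) <= start I (arrs s0 aX (vars s sp));
  sw_res : vars s vRES = 1 <->
    vars s0 vRES = 1 /\ fits_c I c (fun _ => 0) (rev (seg (arrs s0 aX) 0 (vars s sp))) }.

Record sweep_ctx (s0 : st) (c : nat) (s : st) : Prop := {
  cx_env : env s;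
  cx_M : vars s vM = vars s0 vM;
  cx_c : vars s sc = c;
  cx_cap : vars s scap = cap I c;
  cx_X : arrs s aX = arrs s0 aX;
  cx_Q : arrs s aQ = arrs s0 aQ }.

Lemma arrive_spec s0 c u s : jobs s0 -> c < d -> sweep_ctx s0 c s -> sweep_inv s0 c u s ->
  vars s sp < vars s0 vM -> vars s si = arrs s0 aX (vars s sp) ->
  (vars s sq < vars s0 vM ->
    start I (arrs s0 aX (vars s sp)) < fin I (arrs s0 aQ (vars s sq))) ->
  let s' := run arrive_cmd s in sweep_inv s0 c (S u) s' /\ clk s' <= clk s + 7.
Proof.
  intros [Px Sx Py Sy] Hcd [He _ Hc Hcap _ _] [A B C D E G] Hp Hi Hq.
  set (x := arrs s0 aX) in *. set (y := arrs s0 aQ) in *. set (N := vars s0 vM) in *.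
  remember (vars s sp) as p eqn:Ep. remember (vars s sq) as q eqn:Eq.
  destruct (jobs_lt _ (x p) Px) as [Hxn Hxe]; [now apply seg_nth_in|].
  pose proof (fits_c_arrival x y N Px Sx Py Sy c p q Hp B (fun q' Hq' => E q' Hq' Hp) Hq _ D) as HF.
  assert (sum_over (seg x 0 (S p)) (fun a => size I a c) =
    vars s sL + size I (x p) c + sum_over (seg y 0 q) (fun a => size I a c)) as HS.
  { rewrite seg_snoc, sum_over_app, D. cbn. lia. }
  assert (forall q', q' < q -> S p < N -> fin I (y q') <= start I (x (S p))) as HE.
  { intros q' Hq' Hp'. specialize (E q' Hq' Hp).
    pose proof (StronglySorted_seg _ _ _ p (S p) Sx ltac:(lia)). cbn in *. lia. }
  assert (p = N \/ S p + q = S u) as HC by lia.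
  unfold arrive_cmd. cbv zeta. ev.
  rewrite Hi, Hc, Hcap, (env_1 _ He), <- Ep, (env_off _ He), raw_size, Nat.add_1_r by auto.
  destruct (Nat.leb_spec (vars s sL + size I (x p) c) (cap I c)) as [Hl|Hl];
    (split; [constructor|]); ev; fold x y N; rewrite <- ?Eq; auto; try lia.
  - rewrite G, HF. tauto.
  - split; [lia|]. intros [_ HH]. apply HF in HH. lia.
Qed.

Lemma depart_spec s0 c u s : jobs s0 -> c < d -> sweep_ctx s0 c s -> sweep_inv s0 c u s ->
  vars s sp < vars s0 vM -> vars s sq < vars s0 vM -> vars s sj = arrs s0 aQ (vars s sq) ->
  fin I (arrs s0 aQ (vars s sq)) <= start I (arrs s0 aX (vars s sp)) ->
  let s' := run depart_cmd s in sweep_inv s0 c (S u) s' /\ clk s' <= clk s + 7.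
Proof.
  intros [Px Sx Py Sy] Hcd [He _ Hc Hcap _ _] [A B C D E G] Hp Hq Hj Hd.
  set (x := arrs s0 aX) in *. set (y := arrs s0 aQ) in *. set (N := vars s0 vM) in *.
  remember (vars s sp) as p eqn:Ep. remember (vars s sq) as q eqn:Eq.
  destruct (jobs_lt _ (y q) Py) as [Hyn Hye]; [now apply seg_nth_in|].
  assert (forall q', q' <= q -> fin I (y q') <= start I (x p)) as Hd'.
  { intros q' Hq'. destruct (Nat.eq_dec q' q) as [->|]; auto. apply E; lia. }
  pose proof (departed_le x y N Px Sx Py (fun a => size I a c) p q Hp Hq Hd') as HD.
  assert (sum_over (seg y 0 (S q)) (fun a => size I a c) =
    sum_over (seg y 0 q) (fun a => size I a c) + size I (y q) c) as HS.
  { rewrite seg_snoc, sum_over_app. cbn. lia. }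
  unfold depart_cmd. cbv zeta. ev.
  rewrite Hj, Hc, (env_1 _ He), (env_off _ He), raw_size, <- Eq, Nat.add_1_r by auto.
  split; [constructor|]; ev; fold x y N; rewrite <- ?Ep; auto; try lia.
  intros q' Hq' _. apply Hd'. lia.
Qed.

Lemma event_spec s0 c u s : jobs s0 -> c < d -> sweep_ctx s0 c s -> sweep_inv s0 c u s ->
  let s' := run event_cmd s in sweep_inv s0 c (S u) s' /\ clk s' <= clk s + 15.
Proof.
  intros Hj Hcd Hx Hi. pose proof Hj as [Px Sx Py Sy]. pose proof Hx as [He HM Hc Hcap HX HQ].
  pose proof Hi as [A B C D E G].
  unfold event_cmd. cbv zeta. rewrite !eval_ifle, !eval_seq, !eval_op, !eval_ifle, !eval_seq, !eval_op, !eval_ifle, HM.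
  destruct (Nat.leb_spec (vars s0 vM) (vars s sp)) as [Hp|Hp].
  { change (run Skip (tick s)) with (tick s). split; [|cbn; lia].
    constructor; auto. change (vars (tick s)) with (vars s). lia. }
  destruct (jobs_lt _ (arrs s0 aX (vars s sp)) Px) as [Hxn _]; [now apply seg_nth_in|].
  set (s1 := eop _ _ (OLd sti _ _) _).
  assert (sweep_ctx s0 c s1) as Hx1 by (constructor; auto; constructor; apply He).
  assert (sweep_inv s0 c u s1) as Hi1 by (constructor; auto).
  assert (clk s1 = clk s + 3) as T1 by (cbn; lia).
  assert (vars s1 si = arrs s0 aX (vars s sp)) as E1 by (cbn; now rewrite HX).
  assert (vars s1 sti = start I (arrs s0 aX (vars s sp))) as E2.
  { unfold s1. ev. rewrite HX. now apply (env_start _ He). }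
  assert (vars s1 sp = vars s sp) as E3 by reflexivity.
  assert (vars s1 sq = vars s sq) as E4 by reflexivity.
  assert (vars s1 vM = vars s0 vM) as E5 by exact HM.
  clearbody s1. rewrite E5, E4.
  destruct (Nat.leb_spec (vars s0 vM) (vars s sq)) as [Hq|Hq].
  { destruct (arrive_spec s0 c u (tick s1)) as [R1 R2]; auto.
    - constructor; auto; [constructor|..]; apply Hx1.
    - constructor; apply Hi1.
    - cbn. lia.
    - cbn. now rewrite E3.
    - cbn. lia.
    - split; [exact R1|]. cbn [tick clk] in R2. lia. }
  destruct (jobs_lt _ (arrs s0 aQ (vars s sq)) Py) as [Hyn _]; [now apply seg_nth_in|].
  set (s2 := eop _ _ (OLd stj _ _) _).
  pose proof Hx1 as [He1 HM1 Hc1 Hcap1 HX1 HQ1].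
  assert (sweep_ctx s0 c s2) as Hx2 by (constructor; auto; constructor; apply He1).
  assert (sweep_inv s0 c u s2) as Hi2 by (destruct Hi1; constructor; auto).
  assert (clk s2 = clk s + 6) as T2 by (cbn; lia).
  assert (vars s2 si = arrs s0 aX (vars s sp)) as G1 by (cbn; auto).
  assert (vars s2 sti = start I (arrs s0 aX (vars s sp))) as G2 by (cbn; auto).
  assert (vars s2 sp = vars s sp) as G3 by (cbn; auto).
  assert (vars s2 sq = vars s sq) as G4 by (cbn; auto).
  assert (vars s2 sj = arrs s0 aQ (vars s sq)) as G5 by (cbn; now rewrite HQ1, E4).
  assert (vars s2 stj = fin I (arrs s0 aQ (vars s sq))) as G6.
  { unfold s2. ev. rewrite HQ1, E4. now apply (env_fin _ He1). }
  clearbody s2. rewrite G6, G2.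
  destruct (Nat.leb_spec (fin I (arrs s0 aQ (vars s sq))) (start I (arrs s0 aX (vars s sp)))) as [Hd|Hd].
  - destruct (depart_spec s0 c u (tick s2)) as [R1 R2]; auto; try (cbn; rewrite ?G3, ?G4; auto; lia).
    + constructor; auto; [constructor|..]; apply Hx2.
    + constructor; apply Hi2.
    + split; [exact R1|]. cbn [tick clk] in R2. lia.
  - destruct (arrive_spec s0 c u (tick s2)) as [R1 R2]; auto; try (cbn; rewrite ?G3, ?G4; auto; lia).
    + constructor; auto; [constructor|..]; apply Hx2.
    + constructor; apply Hi2.
    + split; [exact R1|]. cbn [tick clk] in R2. lia.
Qed.

Lemma sweep_body_spec c s : env s -> jobs s -> vars s sc = c -> c < d ->
  let s' := run sweep_body s in let N := vars s vM in
  (vars s' vRES = 1 <->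
   vars s vRES = 1 /\ fits_c I c (fun _ => 0) (rev (seg (arrs s aX) 0 N))) /\
  clk s' <= clk s + 7 + 32 * N.
Proof.
  intros He Hj Hc Hcd. unfold sweep_body. ev. set (s1 := setv sM2 _ _). cbv zeta.
  set (N := vars s vM) in *.
  assert (env s1) as He1 by (constructor; apply He).
  assert (vars s1 scap = cap I c) as Hcap.
  { unfold s1. ev. rewrite Hc, (env_2 _ He). now apply raw_cap. }
  pose proof (eval_for (encode d I k) lim su sM2 event_cmd
    (fun u s2 => sweep_inv s c u s2 /\ clk s2 <= clk s + 7 + 16 * u) s1) as H.
  change (vars s1 sM2) with (N + N) in H. fold event_loop in H.
  destruct H as [[A B C _ _ G] T].
  - split; [|cbn; lia]. constructor; cbn; try lia.
    split; [|tauto]. intros ->. split; auto. apply fits_c_nil.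
  - intros u s2 Hu [A T] Eu F.
    assert (sweep_ctx s c s2) as Hx.
    { constructor.
      - eapply env_frame; [|exact F|exact He1]; reflexivity.
      - exact (proj1 F vM eq_refl).
      - exact (eq_trans (proj1 F sc eq_refl) Hc).
      - exact (eq_trans (proj1 F scap eq_refl) Hcap).
      - exact (proj1 (proj2 F) aX eq_refl).
      - exact (proj1 (proj2 F) aQ eq_refl). }
    destruct (event_spec s c u s2 Hj Hcd Hx A) as [R1 R2].
    split; [constructor; apply R1|]. cbn [setv clk]. lia.
  - assert (vars (run event_loop s1) sp = N) as Ep by (unfold N in *; lia).
    rewrite Ep in G. split; [exact G|]. lia.
Qed.

Lemma sweep_cmd_spec s : env s -> jobs s ->
  let s' := run sweep_cmd s in let N := vars s vM in
  (vars s' vRES = 1 <-> fits d I (fun _ => 0) (rev (seg (arrs s aX) 0 N))) /\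
  clk s' <= clk s + 2 + d * (8 + 32 * N).
Proof.
  intros He Hj. unfold sweep_cmd. ev. set (s1 := setv vRES _ _). cbv zeta.
  set (r := rev (seg _ _ _)). set (N := vars s vM) in *.
  pose proof (eval_for (encode d I k) lim sc vD sweep_body
    (fun c s2 => (vars s2 vRES = 1 <-> forall c', c' < c -> fits_c I c' (fun _ => 0) r) /\
       clk s2 <= clk s + 2 + c * (8 + 32 * N)) s1) as H.
  cbv zeta in H. change (vars s1 vD) with (vars s vD) in H. rewrite (env_D _ He) in H.
  apply H; clear H.
  - split; [|cbn; lia]. split; auto. intros; lia.
  - intros c s2 Hc [A B] Ec F.
    assert (env s1) as He1 by (constructor; apply He).
    assert (env s2) as He2 by (eapply env_frame; [|exact F|exact He1]; reflexivity).
    pose proof (proj1 F vM eq_refl : vars s2 vM = N) as FM.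
    pose proof (proj1 (proj2 F) aX eq_refl : arrs s2 aX = arrs s aX) as FX.
    pose proof (proj1 (proj2 F) aQ eq_refl : arrs s2 aQ = arrs s aQ) as FQ.
    assert (jobs s2) as Hj2 by (destruct Hj; constructor; rewrite FM, ?FX, ?FQ; auto).
    destruct (sweep_body_spec c s2 He2 Hj2 Ec Hc) as [C D]. rewrite FM, FX in C. rewrite FM in D.
    cbn [vars setv upd Nat.eqb clk]. split; [|lia]. rewrite C, A. fold r. split.
    + intros [H1 H2] c' Hc'. destruct (Nat.eq_dec c' c) as [->|]; auto. apply H1. lia.
    + intros H. split; intros; apply H; lia.
Qed.

End Env.

(** * Dynamic program *)

Lemma combine_snoc (l s : list nat) a b : length l = length s ->
  combine (l ++ [a]) (s ++ [b]) = combine l s ++ [(a, b)].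
Proof.
  revert s. induction l as [|x l IH]; intros [|y s] H; cbn in *; try discriminate; auto.
  f_equal. apply IH. lia.
Qed.

Lemma restrict_snoc I t l s a b : length l = length s ->
  restrict I t (l ++ [a]) (s ++ [b]) = restrict I t l s ++ (if alive I t a then [b] else []).
Proof.
  intros H. unfold restrict. rewrite combine_snoc, filter_app, map_app by auto. cbn [filter fst].
  now destruct (alive I t a).
Qed.

Lemma load_snoc I c j l s a b : length l = length s ->
  load I c j (l ++ [a]) (s ++ [b]) = load I c j l s + (if b =? j then size I a c else 0).
Proof.
  intros H. unfold load. rewrite combine_snoc, fold_right_app by auto. cbn [fold_right fst snd].
  rewrite Nat.add_0_r. induction (combine l s) as [|p r IH]; cbn; auto. rewrite IH. lia.
Qed.

Lemma restrict_length I t l : forall s, length l = length s ->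
  length (restrict I t l s) = length (filter (alive I t) l).
Proof.
  unfold restrict. induction l as [|x l IH]; intros [|y s] H; try discriminate; auto.
  injection H as H. cbn [combine filter fst]. destruct (alive I t x); cbn [map length]; auto.
Qed.

Lemma restrict_in I t l s b : In b (restrict I t l s) -> In b s.
Proof.
  intros H. apply in_map_iff in H as ([a b'] & <- & H). apply filter_In in H as [H _].
  eapply in_combine_r. exact H.
Qed.

Lemma restrict_self I t l : restrict I t l l = filter (alive I t) l.
Proof. rewrite <- (map_id l) at 2. rewrite restrict_map. apply map_id. Qed.

Section Dynamic.
Variables (d : nat) (I : instance) (k lim : nat).
Notation n := (n_req I).
Hypothesis Hlim : (d + 2) * (n + 1) <= lim.
Hypothesis Hk : 2 <= k.
Notation run := (eval (encode d I k) lim).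
Notation env := (env d I k).
Notation eval_for := (eval_for (encode d I k) lim).
Notation eval_frame := (eval_frame (encode d I k) lim).

Notation dm := 8 (only parsing).
Notation dNS := 9 (only parsing).
Notation dp := 10 (only parsing).
Notation di := 11 (only parsing).
Notation dt := 12 (only parsing).
Notation dm2 := 13 (only parsing).
Notation dNS2 := 14 (only parsing).
Notation df := 18 (only parsing).
Notation dcode := 19 (only parsing).
Notation mx := 20 (only parsing).
Notation mz := 21 (only parsing).
Notation mu := 22 (only parsing).
Notation qx := 23 (only parsing).
Notation qq := 24 (only parsing).
Notation qr := 25 (only parsing).
Notation qu := 26 (only parsing).
Notation dq := 27 (only parsing).
Notation ta := 28 (only parsing).
Notation tb := 29 (only parsing).
Notation tc := 30 (only parsing).
Notation dw := 31 (only parsing).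
Notation tidx := 33 (only parsing).
Notation tdig := 34 (only parsing).
Notation dbase := 35 (only parsing).
Notation dj := 36 (only parsing).
Notation dok := 37 (only parsing).
Notation dc := 38 (only parsing).
Notation dload := 39 (only parsing).

Lemma env_eval c s : keeps_env c = true -> env s -> env (run c s).
Proof. intros H. eapply env_frame; [exact H|]. apply eval_frame. Qed.

Definition mulk_loop : cmd := For mu vK (Op (OAdd mz mz mx)).
Definition mulk : cmd := Op (OConst mz 0);; mulk_loop.

Lemma mulk_spec s : env s ->
  let s' := run mulk s in vars s' mz = k * vars s mx /\ clk s' <= clk s + 2 + 2 * k.
Proof.
  intros He. unfold mulk. cbv zeta. rewrite eval_seq, eval_op. set (s1 := eop _ _ _ _).
  pose proof (eval_for mu vK (Op (OAdd mz mz mx))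
    (fun u s2 => vars s2 mz = u * vars s mx /\ clk s2 <= clk s + 2 + 2 * u) s1) as H.
  change (vars s1 vK) with (vars s vK) in H. rewrite (env_K _ _ _ _ He) in H. apply H; clear H.
  - split; cbn; lia.
  - intros u s2 Hu [A B] _ F. pose proof (proj1 F mx eq_refl : vars s2 mx = vars s mx) as Fx.
    ev. rewrite A, Fx. split; lia.
Qed.

Definition divk_body : cmd :=
  Op (OAdd qr qr v1);; Ifle vK qr (Op (OConst qr 0);; Op (OAdd qq qq v1)) Skip.
Definition divk_loop : cmd := For qu qx divk_body.
Definition divk : cmd := Op (OConst qq 0);; Op (OConst qr 0);; divk_loop.

Lemma divk_spec s : env s ->
  let s' := run divk s in
  vars s' qq = vars s qx / k /\ vars s' qr = vars s qx mod k /\ clk s' <= clk s + 3 + 5 * vars s qx.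
Proof.
  intros He. unfold divk. cbv zeta. rewrite !eval_seq, !eval_op. set (s1 := eop _ _ _ _).
  pose proof (eval_for qu qx divk_body
    (fun u s2 => u = k * vars s2 qq + vars s2 qr /\ vars s2 qr < k /\ clk s2 <= clk s + 3 + 5 * u) s1) as H.
  change (vars s1 qx) with (vars s qx) in H. fold divk_loop in H. destruct H as (A & B & C).
  - cbn. lia.
  - intros u s2 Hu (A & B & C) _ F.
    pose proof (eq_trans (proj1 F v1 eq_refl) (env_1 _ _ _ _ He)) as F1.
    pose proof (eq_trans (proj1 F vK eq_refl) (env_K _ _ _ _ He)) as FK.
    unfold divk_body. ev. rewrite F1, FK.
    destruct (Nat.leb_spec k (vars s2 qr + 1)); ev; rewrite ?F1; lia.
  - split; [|split; [|exact C]].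
    + eapply Nat.div_unique; eauto.
    + eapply Nat.mod_unique; eauto.
Qed.

Definition decode_body : cmd := divk;; Op (OSt aDIG dq qr);; Op (OAdd qx qq v0).
Definition decode_cmd : cmd := For dq dm decode_body.

Lemma decode_cmd_spec s : env s ->
  let s' := run decode_cmd s in let m := vars s dm in
  seg (arrs s' aDIG) 0 m = decode k m (vars s qx) /\ clk s' <= clk s + 1 + 10 * vars s qx + 6 * m.
Proof.
  intros He. cbv zeta. set (x := vars s qx).
  pose proof (eval_for dq dm decode_body
    (fun q s2 => vars s2 qx = x / k ^ q /\
       seg (arrs s2 aDIG) 0 q = seg (fun q => x / k ^ q mod k) 0 q /\
       clk s2 + 10 * vars s2 qx <= clk s + 1 + 10 * x + 6 * q) s) as H.
  fold decode_cmd in H. destruct H as (A & B & C).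
  - rewrite Nat.pow_0_r, Nat.div_1_r. split; [reflexivity|]. split; [reflexivity|].
    cbn [setv vars upd Nat.eqb clk]. fold x. lia.
  - intros q s2 Hq (A & B & C) Eq F.
    assert (env s2) as He2 by (eapply env_frame; [|exact F|exact He]; reflexivity).
    unfold decode_body. rewrite !eval_seq, !eval_op.
    destruct (divk_spec s2 He2) as (D1 & D2 & D3).
    pose proof (proj1 (eval_frame divk s2) dq eq_refl) as G1.
    pose proof (proj1 (proj2 (eval_frame divk s2)) aDIG eq_refl) as G2.
    pose proof (env_eval divk s2 eq_refl He2) as He3.
    set (s3 := run divk s2) in *. clearbody s3. rewrite Eq in G1. ev.
    rewrite G1, D1, D2, (env_0 _ _ _ _ He3), G2, A, Nat.add_0_r in *. split; [|split].
    + rewrite Nat.pow_succ_r', (Nat.mul_comm k). now rewrite Nat.Div0.div_div.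
    + rewrite seg_aupd_snoc, B, seg_snoc. reflexivity.
    + (* the quotients at least halve, so all subtractions together cost [O(x)] *)
      assert (2 * (x / k ^ q / k) <= x / k ^ q).
      { pose proof (Nat.Div0.mul_div_le (x / k ^ q) k). nia. }
      lia.
  - split; [|lia]. rewrite decode_map_seq. exact B.
Qed.

Definition compress_body (src dst : nat) : cmd :=
  Op (OLd ta aACT dq);; Op (OLd tb aFIN ta);;
  Ifle tb dt Skip (Op (OLd tc src dq);; Op (OSt dst dw tc);; Op (OAdd dw dw v1)).
Definition compress_loop (src dst : nat) : cmd := For dq dm (compress_body src dst).
Definition compress (src dst : nat) : cmd := Op (OConst dw 0);; compress_loop src dst.

Lemma compress_spec src dst s : env s ->
  (aFIN =? dst) = false -> (aACT =? dst) = false -> (src =? dst) = false ->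
  let m := vars s dm in
  (forall a, In a (seg (arrs s aACT) 0 m) -> a < n) ->
  let s' := run (compress src dst) s in
  seg (arrs s' dst) 0 (vars s' dw) = restrict I (vars s dt) (seg (arrs s aACT) 0 m) (seg (arrs s src) 0 m) /\
  clk s' <= clk s + 2 + 7 * m.
Proof.
  intros He H1 H2 H3 m Hact. unfold compress. cbv zeta. rewrite eval_seq, eval_op.
  set (s1 := eop _ _ _ _).
  pose proof (eval_for dq dm (compress_body src dst)
    (fun q s2 => seg (arrs s2 dst) 0 (vars s2 dw) =
       restrict I (vars s dt) (seg (arrs s aACT) 0 q) (seg (arrs s src) 0 q) /\
       clk s2 <= clk s + 2 + 7 * q) s1) as H.
  apply H; clear H.
  - split; [reflexivity|]. cbn. lia.
  - intros q s2 Hq [A B] Eq F. change (vars s1 dm) with m in Hq.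
    pose proof (eq_trans (proj1 F v1 eq_refl) (env_1 _ _ _ _ He)) as F1.
    pose proof (proj1 F dt eq_refl : vars s2 dt = vars s dt) as Ft.
    assert (arrs s2 aACT = arrs s aACT) as FA.
    { apply (proj1 (proj2 F)). cbn [wra compress_body]. rewrite ?H2. reflexivity. }
    assert (arrs s2 aFIN = arrs s aFIN) as FF.
    { apply (proj1 (proj2 F)). cbn [wra compress_body]. rewrite ?H1. reflexivity. }
    assert (arrs s2 src = arrs s src) as FS.
    { apply (proj1 (proj2 F)). cbn [wra compress_body]. rewrite ?H3. reflexivity. }
    clear F. rewrite !seg_snoc. cbn [Nat.add].
    rewrite restrict_snoc by now rewrite !seg_length.
    assert (arrs s aACT q < n) as Ha by (apply Hact, seg_nth_in; auto).
    unfold compress_body. ev. rewrite Eq, FA, FF, Ft, (env_fin _ _ _ _ He) by auto. unfold alive.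
    destruct (Nat.leb_spec (fin I (arrs s aACT q)) (vars s dt)) as [Hl|Hl];
      destruct (Nat.ltb_spec (vars s dt) (fin I (arrs s aACT q))); try lia; ev.
    + rewrite app_nil_r. split; auto. lia.
    + rewrite Nat.eqb_refl, F1, FS, ?Eq, Nat.add_1_r, seg_aupd_snoc, A. split; auto. lia.
Qed.

Definition horner_body : cmd :=
  mulk;; Op (OSub tidx dm2 dq);; Op (OSub tidx tidx v1);; Op (OLd tdig aDIG2 tidx);; Op (OAdd mx mz tdig).
Definition horner_loop : cmd := For dq dm2 horner_body.
Definition horner : cmd := Op (OConst mx 0);; horner_loop.

Lemma horner_spec s : env s ->
  let s' := run horner s in let m2 := vars s dm2 in
  vars s' mx = code k (seg (arrs s aDIG2) 0 m2) /\ clk s' <= clk s + 2 + m2 * (7 + 2 * k).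
Proof.
  intros He. unfold horner. cbv zeta. rewrite eval_seq, eval_op. set (s1 := eop _ _ _ _).
  set (m2 := vars s dm2).
  pose proof (eval_for dq dm2 horner_body
    (fun q s2 => vars s2 mx = code k (seg (arrs s aDIG2) (m2 - q) q) /\
       clk s2 <= clk s + 2 + q * (7 + 2 * k)) s1) as H.
  change (vars s1 dm2) with m2 in H. cbv beta in H. rewrite Nat.sub_diag in H. apply H; clear H.
  - split; cbn; lia.
  - intros q s2 Hq [A B] Eq F.
    assert (env s1) as He1 by (constructor; apply He).
    assert (env s2) as He2 by (eapply env_frame; [|exact F|exact He1]; reflexivity).
    pose proof (proj1 F dm2 eq_refl : vars s2 dm2 = m2) as Fm.
    pose proof (proj1 (proj2 F) aDIG2 eq_refl : arrs s2 aDIG2 = arrs s aDIG2) as FD.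
    unfold horner_body. rewrite !eval_seq, !eval_op.
    destruct (mulk_spec s2 He2) as [D1 D2].
    pose proof (proj1 (eval_frame mulk s2) dq eq_refl) as G1.
    pose proof (proj1 (eval_frame mulk s2) dm2 eq_refl) as G2.
    pose proof (proj1 (proj2 (eval_frame mulk s2)) aDIG2 eq_refl) as G3.
    pose proof (env_eval mulk s2 eq_refl He2) as He3.
    set (s3 := run mulk s2) in *. clearbody s3. ev.
    rewrite D1, G1, G2, G3, Fm, FD, Eq, (env_1 _ _ _ _ He3), A. split; [|lia].
    rewrite (seg_cons _ (m2 - S q)) by lia.
    replace (S (m2 - S q)) with (m2 - q) by lia. replace (S q - 1) with q by lia.
    replace (m2 - q - 1) with (m2 - S q) by lia. cbn [code fold_right].
    fold (code k (seg (arrs s aDIG2) (m2 - q) q)). lia.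
Qed.

Definition check_inner : cmd :=
  Op (OLd ta aDIG2 dq);;
  Ifle ta dj
    (Ifle dj ta
      (Op (OLd tb aACT2 dq);; Op (OLd tb aOFF tb);; Op (OAdd tb tb dc);; Op (OInp tc tb);;
       Op (OAdd dload dload tc)) Skip) Skip.
Definition check_loop : cmd := For dq dm2 check_inner.
Definition check_body : cmd :=
  Op (OLd dload aOFF di);; Op (OAdd dload dload dc);; Op (OInp dload dload);; check_loop;;
  Op (OAdd tb dc v2);; Op (OInp tb tb);; Ifle dload tb Skip (Op (OConst dok 0)).
Definition check_outer : cmd := For dc vD check_body.
Definition check : cmd := Op (OConst dok 1);; check_outer.

Record ctx (al : list nat) (t i : nat) (s : st) : Prop := {
  dx_env : env s;
  dx_act : seg (arrs s aACT) 0 (vars s dm) = al;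
  dx_t : vars s dt = t;
  dx_i : vars s di = i;
  dx_act2 : seg (arrs s aACT2) 0 (vars s dm2) = filter (alive I t) al }.

Definition keeps_ctx (c : cmd) : bool :=
  keeps_env c && forallb (fun x => negb (wrv c x)) [dm; dt; di; dm2] &&
  forallb (fun a => negb (wra c a)) [aACT; aACT2].

Lemma ctx_frame al t i c s s' : keeps_ctx c = true -> frame c s s' -> ctx al t i s -> ctx al t i s'.
Proof.
  unfold keeps_ctx. rewrite !andb_true_iff, !forallb_forall. intros [[He Hv] Ha] F H.
  assert (forall x, In x [dm; dt; di; dm2] -> vars s' x = vars s x) as Ev.
  { intros x Hx. apply F. apply negb_true_iff. auto. }
  assert (forall a, In a [aACT; aACT2] -> arrs s' a = arrs s a) as Ea.
  { intros a Hx. apply F. apply negb_true_iff. auto. }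
  destruct H. constructor; rewrite ?Ev, ?Ea by (cbn; tauto); auto.
  eapply env_frame; eauto.
Qed.

Lemma ctx_eval al t i c s : keeps_ctx c = true -> ctx al t i s -> ctx al t i (run c s).
Proof. intros H. eapply ctx_frame; [exact H|]. apply eval_frame. Qed.

Lemma ctx_m al t i s : ctx al t i s -> vars s dm = length al.
Proof. intros H. now rewrite <- (dx_act _ _ _ _ H), seg_length. Qed.

Lemma ctx_m2 al t i s : ctx al t i s -> vars s dm2 = length (filter (alive I t) al).
Proof. intros H. now rewrite <- (dx_act2 _ _ _ _ H), seg_length. Qed.

Section Arrival.
Variables (al : list nat) (t i : nat).
Hypothesis Hal : forall a, In a al -> a < n.
Hypothesis Hi : i < n.
Notation ctx := (ctx al t i).
Notation m := (length al).
Notation al2 := (filter (alive I t) al).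

Lemma check_loop_spec s : ctx s -> vars s dc < d ->
  let s' := run check_loop s in
  vars s' dload = vars s dload + load I (vars s dc) (vars s dj) al2 (seg (arrs s aDIG2) 0 (vars s dm2)) /\
  clk s' <= clk s + 1 + 9 * vars s dm2.
Proof.
  intros Hx Hc. cbv zeta. rewrite <- (dx_act2 _ _ _ _ Hx).
  assert (forall q, q < vars s dm2 -> arrs s aACT2 q < n) as Hq.
  { intros q Hq. apply Hal. eapply (incl_filter (alive I t)). rewrite <- (dx_act2 _ _ _ _ Hx).
    now apply seg_nth_in. }
  pose proof (eval_for dq dm2 check_inner
    (fun q s2 => vars s2 dload = vars s dload +
       load I (vars s dc) (vars s dj) (seg (arrs s aACT2) 0 q) (seg (arrs s aDIG2) 0 q) /\
       clk s2 <= clk s + 1 + 9 * q) s) as H.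
  apply H; clear H.
  - split; cbn; lia.
  - intros q s2 Hq2 [A B] Eq F.
    pose proof (proj1 F dc eq_refl) as Fc. pose proof (proj1 F dj eq_refl) as Fj.
    pose proof (proj1 (proj2 F) aOFF eq_refl) as FO. pose proof (proj1 (proj2 F) aACT2 eq_refl) as FA.
    pose proof (proj1 (proj2 F) aDIG2 eq_refl) as FD. clear F.
    rewrite !seg_snoc, load_snoc by now rewrite !seg_length. cbn [Nat.add].
    unfold check_inner. ev. rewrite Eq, FD, Fj.
    destruct (Nat.leb_spec (arrs s aDIG2 q) (vars s dj)) as [H1|H1];
      [destruct (Nat.leb_spec (vars s dj) (arrs s aDIG2 q)) as [H2|H2]|]; ev;
      destruct (Nat.eqb_spec (arrs s aDIG2 q) (vars s dj)) as [H3|H3]; try lia.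
    rewrite ?Eq, FA, FO, Fc, (env_off _ _ _ _ (dx_env _ _ _ _ Hx)), raw_size by auto. lia.
Qed.

Definition ok_bin (j : nat) (s2 : list nat) : Prop :=
  forall c, c < d -> size I i c + load I c j al2 s2 <= cap I c.

Lemma check_spec s : ctx s ->
  let s' := run check s in
  (1 <= vars s' dok <-> ok_bin (vars s dj) (seg (arrs s aDIG2) 0 (vars s dm2))) /\
  clk s' <= clk s + 2 + d * (9 + 9 * vars s dm2).
Proof.
  intros Hx. unfold check. cbv zeta. rewrite eval_seq, eval_op. set (s1 := eop _ _ _ _).
  set (j := vars s dj). set (dg := seg _ _ _).
  assert (env s1) as He1 by (constructor; apply Hx).
  assert (ctx s1) as Hx1 by (constructor; auto; apply Hx).
  pose proof (eval_for dc vD check_body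
    (fun c s2 => (1 <= vars s2 dok <-> forall c', c' < c -> size I i c' + load I c' j al2 dg <= cap I c') /\
       clk s2 <= clk s + 2 + c * (9 + 9 * vars s dm2)) s1) as H.
  rewrite (env_D _ _ _ _ He1) in H. apply H; clear H.
  - split; [|cbn; lia]. split; [intros; lia|]. intros _. cbn. lia.
  - intros c s2 Hc [A B] Ec F.
    assert (ctx s2) as Hx2 by (eapply ctx_frame; [|exact F|exact Hx1]; reflexivity).
    pose proof (proj1 F dj eq_refl : vars s2 dj = j) as Fj.
    pose proof (proj1 F dm2 eq_refl : vars s2 dm2 = vars s dm2) as Fm.
    pose proof (proj1 (proj2 F) aDIG2 eq_refl : arrs s2 aDIG2 = arrs s aDIG2) as FD. clear F.
    unfold check_body. rewrite !eval_seq, !eval_op. set (s3 := eop _ _ (OInp dload _) _).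
    assert (env s3) as He3 by (constructor; apply Hx2).
    assert (ctx s3) as Hx3 by (constructor; auto; apply Hx2).
    assert (vars s3 dload = size I i c) as E3.
    { unfold s3. ev. rewrite (dx_i _ _ _ _ Hx2), Ec.
      rewrite (env_off _ _ _ _ (dx_env _ _ _ _ Hx2)) by auto. now apply raw_size. }
    assert (vars s3 dc = c) as E3c by exact Ec.
    destruct (check_loop_spec s3 Hx3) as [D1 D2]; [lia|].
    assert (clk s3 = clk s2 + 3) as T3 by (cbn; lia).
    change (arrs s3 aDIG2) with (arrs s2 aDIG2) in D1. change (vars s3 dm2) with (vars s2 dm2) in D1, D2.
    change (vars s3 dj) with (vars s2 dj) in D1. rewrite E3, E3c, Fj, Fm, FD in D1. fold dg in D1.
    pose proof (proj1 (eval_frame check_loop s3) dok eq_refl : vars (run check_loop s3) dok = vars s2 dok) as G1.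
    pose proof (eq_trans (proj1 (eval_frame check_loop s3) dc eq_refl) E3c) as G2.
    pose proof (env_eval check_loop s3 eq_refl He3) as He4.
    clearbody s3. set (s4 := run check_loop s3) in *. clearbody s4.
    rewrite eval_ifle. ev. rewrite D1, G2, (env_2 _ _ _ _ He4), raw_cap by auto.
    destruct (Nat.leb_spec (size I i c + load I c j al2 dg) (cap I c)) as [Hl|Hl]; ev; (split; [|lia]).
    + rewrite G1, A. split.
      * intros H c' Hc'. destruct (Nat.eq_dec c' c) as [->|]; auto. apply H. lia.
      * intros H c' Hc'. apply H. lia.
    + split; [lia|]. intros H. specialize (H c ltac:(lia)). lia.
Qed.

Definition bin_body : cmd :=
  check;; Ifle v1 dok (Op (OSt aG dbase v1)) Skip;; Op (OAdd dbase dbase v1).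
Definition bins : cmd := For dj vK bin_body.

Lemma bins_spec s : ctx s ->
  let s' := run bins s in let s2 := seg (arrs s aDIG2) 0 (vars s dm2) in
  (forall x, 1 <= arrs s' aG x <->
     1 <= arrs s aG x \/ exists j, j < k /\ x = vars s dbase + j /\ ok_bin j s2) /\
  clk s' <= clk s + 1 + k * (6 + d * (9 + 9 * vars s dm2)).
Proof.
  intros Hx. cbv zeta. set (dg := seg _ _ _).
  pose proof (eval_for dj vK bin_body
    (fun j s2 => vars s2 dbase = vars s dbase + j /\
       (forall x, 1 <= arrs s2 aG x <->
          1 <= arrs s aG x \/ exists j', j' < j /\ x = vars s dbase + j' /\ ok_bin j' dg) /\
       clk s2 <= clk s + 1 + j * (6 + d * (9 + 9 * vars s dm2))) s) as H.
  rewrite (env_K _ _ _ _ (dx_env _ _ _ _ Hx)) in H. fold bins in H. destruct H as (_ & A & B); auto.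
  - split; [cbn; lia|]. split; [|cbn; lia]. intros x. split; [now left|].
    intros [H|(j & Hj & _)]; [exact H|lia].
  - intros j s2 Hj (A & B & C) Ej F.
    assert (ctx s2) as Hx2 by (eapply ctx_frame; [|exact F|exact Hx]; reflexivity).
    pose proof (proj1 F dm2 eq_refl : vars s2 dm2 = vars s dm2) as Fm.
    pose proof (proj1 (proj2 F) aDIG2 eq_refl : arrs s2 aDIG2 = arrs s aDIG2) as FD. clear F.
    unfold bin_body. rewrite !eval_seq, !eval_op, eval_ifle.
    destruct (check_spec s2 Hx2) as [D1 D2]. rewrite Ej, FD, Fm in D1. fold dg in D1. rewrite Fm in D2.
    pose proof (proj1 (eval_frame check s2) dbase eq_refl) as G1.
    pose proof (proj1 (proj2 (eval_frame check s2)) aG eq_refl) as G2.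
    pose proof (dx_env _ _ _ _ (ctx_eval _ _ _ check s2 eq_refl Hx2)) as He3.
    set (s3 := run check s2) in *. clearbody s3. rewrite (env_1 _ _ _ _ He3).
    destruct (Nat.leb_spec 1 (vars s3 dok)) as [Hl|Hl]; ev; rewrite ?(env_1 _ _ _ _ He3), ?G1, ?G2, ?A;
      (split; [lia|]); (split; [|lia]); intros x.
    + unfold aupd. destruct (Nat.eqb_spec x (vars s dbase + j)) as [->|Hne].
      * split; [|intros _; lia]. intros _. right. exists j. split; [lia|]. split; auto. now apply D1.
      * rewrite B. apply or_iff_compat_l. split; intros (j' & H1 & H2 & H3); exists j'; repeat split; auto; lia.
    + rewrite B. apply or_iff_compat_l. split; intros (j' & H1 & H2 & H3); exists j'.
      * repeat split; auto.
      * assert (j' <> j). { intros ->. apply D1 in H3. lia. }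
        repeat split; auto. lia.
Qed.

Definition expand : cmd :=
  Op (OAdd qx dcode v0);; decode_cmd;; compress aDIG aDIG2;; horner;; mulk;; Op (OAdd dbase mz v0);; bins.

Definition expand_cost (x : nat) : nat :=
  20 + 10 * x + 13 * m + m * (7 + 2 * k) + 2 * k + k * (6 + d * (9 + 9 * m)).

Lemma expand_spec s : ctx s ->
  let s' := run expand s in let s2 := restrict I t al (decode k m (vars s dcode)) in
  (forall x, 1 <= arrs s' aG x <->
     1 <= arrs s aG x \/ exists j, j < k /\ x = code k (j :: s2) /\ ok_bin j s2) /\
  clk s' <= clk s + expand_cost (vars s dcode).
Proof.
  intros Hx. unfold expand. cbv zeta. rewrite !eval_seq, !eval_op.
  set (s1 := eop _ _ (OAdd qx _ _) _).
  assert (ctx s1) as Hx1 by (constructor; [constructor|..]; apply Hx).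
  assert (vars s1 qx = vars s dcode) as E1.
  { unfold s1. ev. rewrite (env_0 _ _ _ _ (dx_env _ _ _ _ Hx)). lia. }
  assert (arrs s1 aG = arrs s aG) as G1 by reflexivity.
  assert (clk s1 = S (clk s)) as T1 by reflexivity. clearbody s1.
  destruct (decode_cmd_spec s1 (dx_env _ _ _ _ Hx1)) as [D1 D2].
  rewrite E1, (ctx_m _ _ _ _ Hx1) in D1, D2.
  pose proof (ctx_eval _ _ _ decode_cmd s1 eq_refl Hx1) as Hx2.
  pose proof (proj1 (proj2 (eval_frame decode_cmd s1)) aG eq_refl) as G2. rewrite G1 in G2.
  set (s2 := run decode_cmd s1) in *. clearbody s2.
  destruct (compress_spec aDIG aDIG2 s2 (dx_env _ _ _ _ Hx2) eq_refl eq_refl eq_refl) as [C1 C2].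
  { rewrite (dx_act _ _ _ _ Hx2). exact Hal. }
  rewrite (dx_act _ _ _ _ Hx2), (dx_t _ _ _ _ Hx2), (ctx_m _ _ _ _ Hx2), D1 in C1.
  rewrite (ctx_m _ _ _ _ Hx2) in C2.
  pose proof (ctx_eval _ _ _ (compress aDIG aDIG2) s2 eq_refl Hx2) as Hx3.
  pose proof (proj1 (proj2 (eval_frame (compress aDIG aDIG2) s2)) aG eq_refl) as G3. rewrite G2 in G3.
  set (s3 := run (compress aDIG aDIG2) s2) in *. clearbody s3.
  set (sr := restrict _ _ _ _) in *.
  assert (seg (arrs s3 aDIG2) 0 (vars s3 dm2) = sr) as E3.
  { rewrite <- C1. f_equal. rewrite (ctx_m2 _ _ _ _ Hx3).
    rewrite <- (seg_length (arrs s3 aDIG2) 0 (vars s3 dw)), C1. unfold sr.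
    symmetry. apply restrict_length. now rewrite decode_length. }
  assert (vars s3 dm2 <= m) as Hm2.
  { rewrite (ctx_m2 _ _ _ _ Hx3). apply filter_length_le. }
  destruct (horner_spec s3 (dx_env _ _ _ _ Hx3)) as [H1 H2]. rewrite E3 in H1.
  pose proof (ctx_eval _ _ _ horner s3 eq_refl Hx3) as Hx4.
  pose proof (proj1 (proj2 (eval_frame horner s3)) aG eq_refl) as G4. rewrite G3 in G4.
  pose proof (proj1 (proj2 (eval_frame horner s3)) aDIG2 eq_refl) as K4.
  pose proof (proj1 (eval_frame horner s3) dm2 eq_refl) as M4.
  set (s4 := run horner s3) in *. clearbody s4.
  destruct (mulk_spec s4 (dx_env _ _ _ _ Hx4)) as [L1 L2]. rewrite H1 in L1.
  pose proof (ctx_eval _ _ _ mulk s4 eq_refl Hx4) as Hx5.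
  pose proof (proj1 (proj2 (eval_frame mulk s4)) aG eq_refl) as G5. rewrite G4 in G5.
  pose proof (proj1 (proj2 (eval_frame mulk s4)) aDIG2 eq_refl) as K5. rewrite K4 in K5.
  pose proof (proj1 (eval_frame mulk s4) dm2 eq_refl) as M5. rewrite M4 in M5.
  set (s5 := run mulk s4) in *. clearbody s5.
  set (s6 := eop _ _ (OAdd dbase _ _) _).
  assert (ctx s6) as Hx6 by (constructor; [constructor|..]; apply Hx5).
  destruct (bins_spec s6 Hx6) as [B1 B2].
  change (arrs s6 aG) with (arrs s5 aG) in B1. change (arrs s6 aDIG2) with (arrs s5 aDIG2) in B1.
  change (vars s6 dm2) with (vars s5 dm2) in B1, B2.
  assert (vars s6 dbase = k * code k sr) as E6.
  { unfold s6. ev. rewrite (env_0 _ _ _ _ (dx_env _ _ _ _ Hx5)), L1. lia. }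
  rewrite E6, G5, K5, M5, E3 in B1. rewrite M5 in B2. change (clk s6) with (S (clk s5)) in B2.
  split.
  - intros x. rewrite B1. apply or_iff_compat_l. cbn [code fold_right]. fold (code k sr).
    split; intros (j & A1 & A2 & A3); exists j; repeat split; auto; lia.
  - unfold expand_cost.
    assert (vars s3 dm2 * (7 + 2 * k) <= m * (7 + 2 * k)) by now apply Nat.mul_le_mono_r.
    assert (k * (6 + d * (9 + 9 * vars s3 dm2)) <= k * (6 + d * (9 + 9 * m))).
    { apply Nat.mul_le_mono_l, Nat.add_le_mono_l, Nat.mul_le_mono_l. lia. }
    lia.
Qed.

Definition code_body : cmd := Op (OLd df aF dcode);; Ifle v1 df expand Skip.
Definition code_loop : cmd := For dcode dNS code_body.

Lemma code_loop_spec s : ctx s ->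
  let s' := run code_loop s in
  (forall x, 1 <= arrs s' aG x <->
     1 <= arrs s aG x \/ exists y j, y < vars s dNS /\ 1 <= arrs s aF y /\ j < k /\
       let s2 := restrict I t al (decode k m y) in x = code k (j :: s2) /\ ok_bin j s2) /\
  clk s' <= clk s + 1 + vars s dNS * (3 + expand_cost (vars s dNS)).
Proof.
  intros Hx. cbv zeta. set (NS := vars s dNS).
  pose proof (eval_for dcode dNS code_body
    (fun z s2 => (forall x, 1 <= arrs s2 aG x <->
     1 <= arrs s aG x \/ exists y j, y < z /\ 1 <= arrs s aF y /\ j < k /\
       x = code k (j :: restrict I t al (decode k m y)) /\ ok_bin j (restrict I t al (decode k m y))) /\
     clk s2 <= clk s + 1 + z * (3 + expand_cost NS)) s) as H.
  apply H; clear H.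
  - split; [|cbn; lia]. intros x. split; [now left|]. intros [H|(y & j & Hy & _)]; [exact H|lia].
  - intros z s2 Hz [A B] Ez F. fold NS in Hz.
    assert (ctx s2) as Hx2 by (eapply ctx_frame; [|exact F|exact Hx]; reflexivity).
    pose proof (proj1 (proj2 F) aF eq_refl : arrs s2 aF = arrs s aF) as FF. clear F.
    unfold code_body. rewrite eval_seq, eval_op, eval_ifle. set (s3 := eop _ _ _ _).
    assert (vars s3 df = arrs s aF z) as E3 by (unfold s3; ev; now rewrite FF, Ez).
    assert (ctx (tick s3)) as Hx3 by (constructor; [constructor|..]; apply Hx2).
    assert (vars s3 v1 = 1) as V1 by apply (dx_env _ _ _ _ Hx3).
    assert (vars (tick s3) dcode = z) as Z3 by exact Ez.
    assert (arrs (tick s3) aG = arrs s2 aG) as G3 by reflexivity.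
    assert (clk (tick s3) = clk s2 + 2) as T3 by (cbn; lia).
    rewrite E3, V1. generalize dependent (tick s3). intros s4 Hx4 Z4 G4 T4.
    destruct (Nat.leb_spec 1 (arrs s aF z)) as [Hl|Hl].
    + destruct (expand_spec s4 Hx4) as [D1 D2]. rewrite Z4, G4 in D1. rewrite Z4 in D2.
      set (s5 := run expand s4) in *. clearbody s5. ev. split.
      * intros x. rewrite D1, A. split.
        -- intros [[H|(y & j & H1 & H2)]|(j & H1 & H2)]; auto.
           ++ right. exists y, j. split; [lia|auto].
           ++ right. exists z, j. auto.
        -- intros [H|(y & j & H1 & H2 & H3)]; auto.
           destruct (Nat.eq_dec y z) as [->|Hne].
           ++ right. exists j. auto.
           ++ left. right. exists y, j. split; [lia|auto].
      * assert (expand_cost z <= expand_cost NS) by (unfold expand_cost; lia). lia.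
    + change (run Skip s4) with s4. ev. rewrite G4. split; [|lia].
      intros x. rewrite A. apply or_iff_compat_l.
      split; intros (y & j & H1 & H2 & H3); exists y, j; (split; [|auto]); [lia|].
      destruct (Nat.eq_dec y z) as [->|]; lia.
Qed.

End Arrival.

Definition pow_loop : cmd := For dq dm2 (mulk;; Op (OAdd mx mz v0)).
Definition pow_cmd : cmd := Op (OConst mx 1);; pow_loop;; mulk;; Op (OAdd dNS2 mz v0).

Lemma pow_cmd_spec s : env s ->
  let s' := run pow_cmd s in let m2 := vars s dm2 in
  vars s' dNS2 = k ^ S m2 /\ clk s' <= clk s + 5 + 2 * k + m2 * (4 + 2 * k).
Proof.
  intros He. unfold pow_cmd. cbv zeta. rewrite !eval_seq, !eval_op. set (s1 := eop _ _ (OConst _ _) _).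
  set (m2 := vars s dm2). assert (env s1) as He1 by (constructor; apply He).
  pose proof (eval_for dq dm2 (mulk;; Op (OAdd mx mz v0))
    (fun q s2 => vars s2 mx = k ^ q /\ clk s2 <= clk s + 2 + q * (4 + 2 * k)) s1) as H.
  change (vars s1 dm2) with m2 in H. fold pow_loop in H. destruct H as [A B].
  - cbn. split; lia.
  - intros q s2 Hq [A B] Eq F.
    assert (env s2) as He2 by (eapply env_frame; [|exact F|exact He1]; reflexivity).
    rewrite eval_seq, eval_op. destruct (mulk_spec s2 He2) as [D1 D2].
    pose proof (env_eval mulk s2 eq_refl He2) as He3.
    set (s3 := run mulk s2) in *. clearbody s3. ev. rewrite D1, A, (env_0 _ _ _ _ He3).
    rewrite Nat.pow_succ_r'. split; lia.
  - pose proof (env_eval pow_loop s1 eq_refl He1) as He2.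
    set (s2 := run pow_loop s1) in *. clearbody s2.
    destruct (mulk_spec s2 He2) as [D1 D2]. pose proof (env_eval mulk s2 eq_refl He2) as He3.
    set (s3 := run mulk s2) in *. clearbody s3. ev. rewrite D1, A, (env_0 _ _ _ _ He3).
    rewrite Nat.pow_succ_r'. split; lia.
Qed.

Definition clear_cmd : cmd := For dcode dNS2 (Op (OSt aG dcode v0)).

Lemma clear_cmd_spec s : env s ->
  let s' := run clear_cmd s in
  (forall x, x < vars s dNS2 -> arrs s' aG x = 0) /\ clk s' <= clk s + 1 + 2 * vars s dNS2.
Proof.
  intros He. apply (eval_for dcode dNS2 (Op (OSt aG dcode v0))
    (fun z s2 => (forall x, x < z -> arrs s2 aG x = 0) /\ clk s2 <= clk s + 1 + 2 * z)).
  - split; [intros; lia|cbn; lia].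
  - intros z s2 Hz [A B] Ez F.
    pose proof (eq_trans (proj1 F v0 eq_refl) (env_0 _ _ _ _ He)) as F0.
    ev. rewrite Ez, F0. split; [|lia]. intros x Hx. unfold aupd.
    destruct (Nat.eqb_spec x z); auto. apply A. lia.
Qed.

Definition copy_table : cmd := For dcode dNS2 (Op (OLd df aG dcode);; Op (OSt aF dcode df)).

Lemma copy_table_spec s :
  let s' := run copy_table s in
  (forall x, x < vars s dNS2 -> arrs s' aF x = arrs s aG x) /\ clk s' <= clk s + 1 + 3 * vars s dNS2.
Proof.
  apply (eval_for dcode dNS2 (Op (OLd df aG dcode);; Op (OSt aF dcode df))
    (fun z s2 => (forall x, x < z -> arrs s2 aF x = arrs s aG x) /\ clk s2 <= clk s + 1 + 3 * z)).
  - split; [intros; lia|cbn; lia].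
  - intros z s2 Hz [A B] Ez F.
    pose proof (proj1 (proj2 F) aG eq_refl) as FG.
    ev. rewrite Ez, FG. split; [|lia]. intros x Hx. unfold aupd.
    destruct (Nat.eqb_spec x z); subst; auto. apply A. lia.
Qed.

Definition shift_loop : cmd := For dq dm2 (Op (OAdd ta dq v1);; Op (OLd tb aACT2 dq);; Op (OSt aACT ta tb)).
Definition shift_cmd : cmd := Op (OSt aACT v0 di);; shift_loop.

Lemma shift_cmd_spec s : env s ->
  let s' := run shift_cmd s in let m2 := vars s dm2 in
  seg (arrs s' aACT) 0 (S m2) = vars s di :: seg (arrs s aACT2) 0 m2 /\ clk s' <= clk s + 2 + 4 * m2.
Proof.
  intros He. unfold shift_cmd. cbv zeta. rewrite eval_seq, eval_op. set (s1 := eop _ _ _ _).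
  set (m2 := vars s dm2).
  pose proof (eval_for dq dm2 (Op (OAdd ta dq v1);; Op (OLd tb aACT2 dq);; Op (OSt aACT ta tb))
    (fun q s2 => seg (arrs s2 aACT) 0 (S q) = vars s di :: seg (arrs s aACT2) 0 q /\
       clk s2 <= clk s + 2 + 4 * q) s1) as H.
  apply H; clear H.
  - split; [|cbn; lia]. unfold s1. ev. rewrite (env_0 _ _ _ _ He). reflexivity.
  - intros q s2 Hq [A B] Eq F.
    pose proof (eq_trans (proj1 F v1 eq_refl) (env_1 _ _ _ _ He)) as F1.
    pose proof (proj1 (proj2 F) aACT2 eq_refl : arrs s2 aACT2 = arrs s aACT2) as FA. clear F.
    ev. rewrite Eq, F1, FA, Nat.add_1_r. split; [|lia].
    rewrite seg_aupd_snoc, A, seg_snoc. reflexivity.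
Qed.

Definition arrival : cmd :=
  Op (OLd di aX dp);; Op (OLd dt aSTART di);; compress aACT aACT2;; Op (OAdd dm2 dw v0);;
  pow_cmd;; clear_cmd;; code_loop;; copy_table;; shift_cmd;; Op (OAdd dm dm2 v1);; Op (OAdd dNS dNS2 v0).

Record table (r : list nat) (s : st) : Prop := {
  tb_act : seg (arrs s aACT) 0 (vars s dm) = act I r;
  tb_size : vars s dNS = k ^ length (act I r);
  tb_reach : forall x, x < k ^ length (act I r) ->
    1 <= arrs s aF x <-> reach d I k r (decode k (length (act I r)) x) }.

Lemma table_setv r v s : table r s -> table r (setv dp v s).
Proof. intros [A B C]. constructor; auto. Qed.

Lemma reach_digits r s : reach d I k r s -> length s = length (act I r) /\ forall b, In b s -> b < k.
Proof.
  intros (f & Hf & _ & ->). split; [apply length_map|]. intros b Hb.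
  apply in_map_iff in Hb as (a & <- & Ha). apply Hf. now apply act_incl in Ha.
Qed.

Lemma reach_step_code i r : ~ In i r -> (forall a, In a r -> start I a <= start I i) -> nonempty I i = true ->
  let t := start I i in let m := length (act I r) in
  forall x, x < k ^ length (act I (i :: r)) ->
  reach d I k (i :: r) (decode k (length (act I (i :: r))) x) <->
  exists y j, y < k ^ m /\ reach d I k r (decode k m y) /\ j < k /\
    let s2 := restrict I t (act I r) (decode k m y) in
    x = code k (j :: s2) /\ ok_bin (act I r) t i j s2.
Proof.
  intros Hir Hs Hn t m x Hx. cbv zeta. rewrite reach_cons by auto. split.
  - intros (s0 & j & H0 & Hj & E & Hl). destruct (reach_digits _ _ H0) as [L0 D0].
    exists (code k s0), j. fold m in L0. rewrite <- L0, decode_code by auto.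
    split; [now apply code_lt|]. split; auto. split; auto. split; auto.
    fold t in E. rewrite <- E. symmetry. apply code_decode; auto. lia.
  - intros (y & j & Hy & H0 & Hj & E & Hl).
    exists (decode k m y), j. split; auto. split; auto. split; auto.
    rewrite E. fold t.
    replace (length (act I (i :: r)))
      with (length (j :: restrict I t (act I r) (decode k m y))).
    + apply decode_code. intros b [<-|Hb]; auto. apply restrict_in in Hb. eapply decode_lt; [|exact Hb]. lia.
    + cbn [length act]. f_equal. apply restrict_length. now rewrite decode_length.
Qed.

Lemma mul_le_pow h : 1 <= h -> k * h <= k ^ h.
Proof.
  induction h as [|h IH]; intros H; [lia|]. rewrite Nat.pow_succ_r'.
  destruct h as [|h]; [cbn; lia|]. specialize (IH ltac:(lia)). nia.
Qed.

Lemma arrival_spec r s h : env s -> table r s ->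
  let i := arrs s aX (vars s dp) in
  i < n -> (forall a, In a r -> a < n) ->
  ~ In i r -> (forall a, In a r -> start I a <= start I i) -> nonempty I i = true ->
  length (act I r) <= h -> length (act I (i :: r)) <= h ->
  let s' := run arrival s in
  table (i :: r) s' /\ clk s' <= clk s + (150 + 18 * d) * (k ^ h * k ^ h).
Proof.
  intros He [Ta Ts Tr] i Hi Hr Hir Hs Hn Hh Hh'. set (t := start I i). set (al := act I r) in *.
  assert (forall a, In a al -> a < n) as Hal by (intros a Ha; apply Hr, (act_incl I r), Ha).
  unfold arrival. cbv zeta. rewrite !eval_seq, !eval_op. set (s1 := eop _ _ (OLd dt _ _) _).
  assert (env s1) as He1 by (constructor; apply He).
  assert (vars s1 dt = t) as E1t by (unfold s1; ev; now apply (env_start _ _ _ _ He)).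
  assert (vars s1 di = i) as E1i by reflexivity.
  assert (vars s1 dm = vars s dm) as E1m by reflexivity.
  assert (vars s1 dNS = vars s dNS) as E1N by reflexivity.
  assert (arrs s1 = arrs s) as E1a by reflexivity.
  assert (clk s1 = clk s + 2) as T1 by (cbn; lia). clearbody s1.
  assert (vars s dm = length al) as Em by (rewrite <- Ta; now rewrite seg_length).
  destruct (compress_spec aACT aACT2 s1 He1 eq_refl eq_refl eq_refl) as [C1 C2].
  { rewrite E1a, E1m, Ta. exact Hal. }
  rewrite E1a, E1m, Ta, E1t, restrict_self in C1. rewrite E1m, Em in C2.
  pose proof (eval_frame (compress aACT aACT2) s1) as F2.
  pose proof (env_eval (compress aACT aACT2) s1 eq_refl He1) as He2.
  set (s2 := run (compress aACT aACT2) s1) in *. clearbody s2.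
  set (s3 := eop _ _ (OAdd dm2 _ _) _).
  assert (vars s3 dm2 = vars s2 dw) as E3 by (unfold s3; ev; rewrite (env_0 _ _ _ _ He2); lia).
  assert (env s3) as He3 by (constructor; apply He2).
  assert (ctx al t i s3) as Hx3.
  { constructor; auto.
    - change (arrs s3) with (arrs s2). change (vars s3 dm) with (vars s2 dm).
      rewrite (proj1 F2 dm eq_refl), (proj1 (proj2 F2) aACT eq_refl), E1m, E1a. exact Ta.
    - exact (eq_trans (proj1 F2 dt eq_refl) E1t).
    - exact (eq_trans (proj1 F2 di eq_refl) E1i).
    - rewrite E3. exact C1. }
  pose proof (eq_trans (proj1 F2 dNS eq_refl) (eq_trans E1N Ts) : vars s3 dNS = k ^ length al) as N3.
  pose proof (proj1 (proj2 F2) aF eq_refl : arrs s3 aF = arrs s1 aF) as F3. rewrite E1a in F3.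
  assert (clk s3 = clk s2 + 1) as T3 by (cbn; lia). clear F2. clearbody s3.
  set (m2 := length (filter (alive I t) al)).
  destruct (pow_cmd_spec s3 He3) as [P1 P2]. rewrite (ctx_m2 _ _ _ _ Hx3) in P1, P2. fold m2 in P1, P2.
  pose proof (ctx_eval _ _ _ pow_cmd s3 eq_refl Hx3) as Hx4.
  pose proof (eq_trans (proj1 (eval_frame pow_cmd s3) dNS eq_refl) N3) as N4.
  pose proof (eq_trans (proj1 (proj2 (eval_frame pow_cmd s3)) aF eq_refl) F3) as F4.
  set (s4 := run pow_cmd s3) in *. clearbody s4.
  destruct (clear_cmd_spec s4 (dx_env _ _ _ _ Hx4)) as [G1 G2]. rewrite P1 in G1, G2.
  pose proof (ctx_eval _ _ _ clear_cmd s4 eq_refl Hx4) as Hx5.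
  pose proof (eq_trans (proj1 (eval_frame clear_cmd s4) dNS eq_refl) N4) as N5.
  pose proof (eq_trans (proj1 (eval_frame clear_cmd s4) dNS2 eq_refl) P1) as M5.
  pose proof (eq_trans (proj1 (proj2 (eval_frame clear_cmd s4)) aF eq_refl) F4) as F5.
  set (s5 := run clear_cmd s4) in *. clearbody s5.
  destruct (code_loop_spec al t i Hal Hi s5 Hx5) as [L1 L2]. rewrite N5, F5 in L1. rewrite N5 in L2.
  pose proof (ctx_eval _ _ _ code_loop s5 eq_refl Hx5) as Hx6.
  pose proof (eq_trans (proj1 (eval_frame code_loop s5) dNS2 eq_refl) M5) as M6.
  set (s6 := run code_loop s5) in *. clearbody s6.
  destruct (copy_table_spec s6) as [K1 K2]. rewrite M6 in K1, K2.
  pose proof (ctx_eval _ _ _ copy_table s6 eq_refl Hx6) as Hx7.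
  pose proof (eq_trans (proj1 (eval_frame copy_table s6) dNS2 eq_refl) M6) as M7.
  set (s7 := run copy_table s6) in *. clearbody s7.
  destruct (shift_cmd_spec s7 (dx_env _ _ _ _ Hx7)) as [S1 S2].
  rewrite (dx_act2 _ _ _ _ Hx7), (dx_i _ _ _ _ Hx7), (ctx_m2 _ _ _ _ Hx7) in S1.
  rewrite (ctx_m2 _ _ _ _ Hx7) in S2. fold m2 in S1, S2.
  pose proof (env_eval shift_cmd s7 eq_refl (dx_env _ _ _ _ Hx7)) as He8.
  pose proof (eq_trans (proj1 (eval_frame shift_cmd s7) dNS2 eq_refl) M7) as M8.
  pose proof (eq_trans (proj1 (eval_frame shift_cmd s7) dm2 eq_refl) (ctx_m2 _ _ _ _ Hx7)) as Q8.
  pose proof (proj1 (proj2 (eval_frame shift_cmd s7)) aF eq_refl) as F8.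
  set (s8 := run shift_cmd s7) in *. clearbody s8. fold m2 in Q8.
  assert (length (act I (i :: r)) = S m2) as Hlen by reflexivity.
  split.
  - constructor; rewrite ?Hlen; ev.
    + rewrite Q8, (env_1 _ _ _ _ He8), Nat.add_1_r, S1. reflexivity.
    + rewrite M8, (env_0 _ _ _ _ He8). lia.
    + intros x Hx. rewrite F8, K1, L1 by auto. rewrite G1 by auto.
      rewrite <- Hlen in Hx |- *. rewrite reach_step_code by auto. fold al t. split.
      * intros [H|(y & j & H1 & H2 & H3)]; [lia|]. exists y, j. split; auto. split; auto. now apply Tr.
      * intros (y & j & H1 & H2 & H3). right. exists y, j. split; auto. split; auto. now apply Tr.
  - ev. rewrite Hlen in Hh'.
    pose proof (mul_le_pow h ltac:(lia)) as Hkh. set (B := k ^ h) in *.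
    assert (k ^ length al <= B) as HB1 by (apply Nat.pow_le_mono_r; lia).
    assert (k ^ S m2 <= B) as HB2 by (apply Nat.pow_le_mono_r; lia).
    assert (k <= B) as HkB.
    { etransitivity; [|exact Hkh]. rewrite <- (Nat.mul_1_r k) at 1. apply Nat.mul_le_mono_l. lia. }
    assert (h <= B) as HhB.
    { etransitivity; [|exact Hkh]. rewrite <- (Nat.mul_1_l h) at 1. apply Nat.mul_le_mono_r. lia. }
    assert (k * length al <= B) as Hka by (etransitivity; [apply Nat.mul_le_mono_l, Hh|exact Hkh]).
    assert (k * m2 <= B) as Hkm by (etransitivity; [apply Nat.mul_le_mono_l|exact Hkh]; lia).
    assert (d * (k * length al) <= d * B) as Hdk by now apply Nat.mul_le_mono_l.
    assert (d * k <= d * B) as Hdk' by now apply Nat.mul_le_mono_l.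
    assert (expand_cost al (k ^ length al) <= (60 + 18 * d) * B) as HE by (unfold expand_cost; lia).
    assert (k ^ length al * (3 + expand_cost al (k ^ length al)) <= B * ((63 + 18 * d) * B)) as HL.
    { apply Nat.mul_le_mono; [exact HB1|]. lia. }
    assert (B <= B * B) as HBB.
    { rewrite <- (Nat.mul_1_r B) at 1. apply Nat.mul_le_mono_l. lia. }
    replace ((150 + 18 * d) * (B * B)) with (87 * (B * B) + B * ((63 + 18 * d) * B)) by lia.
    lia.
Qed.

Definition arrivals : cmd := For dp vM arrival.
Definition any_body : cmd := Op (OLd df aF dcode);; Ifle v1 df (Op (OConst vRES 1)) Skip.
Definition any_loop : cmd := For dcode dNS any_body.

Definition dynamic_cmd : cmd :=
  Op (OConst dm 0);; Op (OConst dNS 1);; Op (OSt aF v0 v1);; arrivals;; Op (OConst vRES 0);; any_loop.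

Lemma any_loop_spec s : env s -> vars s vRES = 0 ->
  let s' := run any_loop s in
  (vars s' vRES = 1 <-> exists x, x < vars s dNS /\ 1 <= arrs s aF x) /\
  clk s' <= clk s + 1 + 4 * vars s dNS.
Proof.
  intros He H0. apply (eval_for dcode dNS any_body
    (fun z s2 => (vars s2 vRES = 1 <-> exists x, x < z /\ 1 <= arrs s aF x) /\
       clk s2 <= clk s + 1 + 4 * z)).
  - split; [|cbn; lia]. cbn. rewrite H0. split; [lia|]. intros (x & Hx & _). lia.
  - intros z s2 Hz [A B] Ez F.
    pose proof (eq_trans (proj1 F v1 eq_refl) (env_1 _ _ _ _ He)) as F1.
    pose proof (proj1 (proj2 F) aF eq_refl) as FF. clear F.
    unfold any_body. ev. rewrite F1, FF, Ez.
    destruct (Nat.leb_spec 1 (arrs s aF z)) as [Hl|Hl]; ev; (split; [|lia]).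
    + split; auto. intros _. exists z. split; auto.
    + rewrite A. split; intros (x & H1 & H2); exists x; (split; [|auto]); [lia|].
      destruct (Nat.eq_dec x z) as [->|]; lia.
Qed.

Lemma dynamic_cmd_spec s h : env s -> jobs I s -> is_height I h ->
  let s' := run dynamic_cmd s in let N := vars s vM in
  (vars s' vRES = 1 <-> exists w, reach d I k (rev (seg (arrs s aX) 0 N)) w) /\
  clk s' <= clk s + 10 + N * ((155 + 18 * d) * (k ^ h * k ^ h)).
Proof.
  intros He [Px Sx _ _] Hh. set (x := arrs s aX) in *. set (N := vars s vM) in *.
  unfold dynamic_cmd. cbv zeta. rewrite !eval_seq, !eval_op. set (s1 := eop _ _ (OSt _ _ _) _).
  fold N. assert (env s1) as He1 by (constructor; apply He).
  set (B := k ^ h). assert (1 <= B) as HB by (apply Nat.neq_0_lt_0, Nat.pow_nonzero; lia).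
  assert (B <= B * B) as HBB.
  { rewrite <- (Nat.mul_1_r B) at 1. apply Nat.mul_le_mono_l. lia. }
  assert (forall p, p <= N -> NoDup (rev (seg x 0 p)) /\
    (forall a, In a (rev (seg x 0 p)) -> a < n /\ nonempty I a = true) /\
    StronglySorted (fun a b => start I b <= start I a) (rev (seg x 0 p))) as Hpre.
  { intros p Hp. assert (NoDup (seg x 0 N)) as ND.
    { apply (Permutation_NoDup (Permutation_sym Px)). apply NoDup_filter, seq_NoDup. }
    replace N with (p + (N - p)) in ND by lia. rewrite seg_app in ND. apply NoDup_app_remove_r in ND.
    split; [now apply NoDup_rev|]. split.
    - intros a Ha. apply in_rev, seg_in in Ha as (q & Hq & <-). apply (jobs_lt _ _ Px).
      apply seg_nth_in. lia.
    - apply sorted_rev. replace N with (p + (N - p)) in Sx by lia. rewrite seg_app in Sx.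
      clear - Sx. induction (seg x 0 p) as [|a l IH]; [constructor|]. cbn in Sx.
      apply StronglySorted_inv in Sx as [Sx F]. constructor; [now apply IH|].
      apply Forall_app in F. apply F. }
  pose proof (eval_for dp vM arrival
    (fun p s2 => table (rev (seg x 0 p)) s2 /\ clk s2 <= clk s + 4 + p * ((151 + 18 * d) * (B * B))) s1) as H.
  change (vars s1 vM) with N in H. fold arrivals in H. destruct H as [T C].
  - split; [|cbn; lia]. constructor; auto.
    intros y Hy. cbn in Hy. replace y with 0 by lia. unfold s1. ev.
    rewrite (env_0 _ _ _ _ He), (env_1 _ _ _ _ He), aupd_eq. cbn [seg seq map rev act length decode].
    rewrite reach_nil. split; auto.
  - intros p s2 Hp [T C] Ep F.
    assert (env s2) as He2 by (eapply env_frame; [|exact F|exact He1]; reflexivity).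
    pose proof (proj1 (proj2 F) aX eq_refl : arrs s2 aX = x) as FX. clear F.
    destruct (Hpre p ltac:(lia)) as (ND & Hn & Hs). destruct (Hpre (S p) ltac:(lia)) as (ND' & Hn' & Hs').
    assert (rev (seg x 0 (S p)) = x p :: rev (seg x 0 p)) as Er.
    { rewrite seg_snoc, rev_app_distr. reflexivity. }
    pose proof (act_length_le I h _ Hh ND Hn Hs) as L1.
    pose proof (act_length_le I h _ Hh ND' Hn' Hs') as L2.
    rewrite Er in *. apply NoDup_cons_iff in ND' as [ND' _].
    apply StronglySorted_inv in Hs' as [_ Hs']. rewrite Forall_forall in Hs'.
    destruct (Hn' (x p) (or_introl eq_refl)) as [Hx1 Hx2].
    pose proof (arrival_spec (rev (seg x 0 p)) s2 h He2 T) as HA. cbv zeta in HA. rewrite FX, Ep in HA.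
    destruct HA as [A1 A4]; auto.
    { intros a Ha. now apply Hn. }
    set (s3 := run arrival s2) in *. clearbody s3.
    split; [apply table_setv; exact A1|]. cbn [setv clk]. fold B in A4. lia.
  - pose proof (env_eval arrivals s1 eq_refl He1) as He2.
    set (s2 := run arrivals s1) in *. clearbody s2. set (s3 := eop _ _ (OConst vRES 0) _).
    assert (env s3) as He3 by (constructor; apply He2).
    destruct (any_loop_spec s3 He3 eq_refl) as [A1 A2].
    change (vars s3 dNS) with (vars s2 dNS) in A1, A2. change (arrs s3 aF) with (arrs s2 aF) in A1.
    change (clk s3) with (S (clk s2)) in A2.
    destruct T as [Ta Ts Tr]. set (r := rev (seg x 0 N)) in *. rewrite Ts in A1, A2.
    destruct (Hpre N ltac:(lia)) as (ND & Hn & Hs).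
    pose proof (act_length_le I h _ Hh ND Hn Hs) as L. fold r in L.
    split.
    + rewrite A1. split.
      * intros (y & H1 & H2). exists (decode k (length (act I r)) y). now apply Tr.
      * intros (w & Hw). destruct (reach_digits _ _ Hw) as [Lw Dw].
        exists (code k w). rewrite <- Lw. split; [now apply code_lt|].
        apply Tr; rewrite <- Lw; [now apply code_lt|]. now rewrite decode_code.
    + assert (k ^ length (act I r) <= 1 + N * (B * B)) as HN.
      { destruct N as [|N'] eqn:EN; [cbn; lia|].
        assert (k ^ length (act I r) <= B) by (apply Nat.pow_le_mono_r; lia). lia. }
      replace (N * ((155 + 18 * d) * (B * B))) with (N * ((151 + 18 * d) * (B * B)) + 4 * (N * (B * B))) by lia.
      lia.
Qed.

End Dynamic.

(** * The decision program *)

Definition main_cmd (d : nat) : cmd :=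
  init_cmd d;;
  Ifle vK v0 (Op (OConst vRES 0)) (prepare_cmd;; Ifle vK v1 sweep_cmd dynamic_cmd).

Definition main_factor (d : nat) : nat := 300 + 60 * d.

Lemma main_cmd_wf d : wf (main_cmd d) = true.
Proof. reflexivity. Qed.

Lemma feasible_one_bin d I r : Permutation r (filter (nonempty I) (seq 0 (n_req I))) ->
  fits d I (fun _ => 0) r <-> feasible d I 1.
Proof.
  intros P. rewrite (feasible_fits d I 1 r P). split.
  - intros H. split; [right; lia|]. exists (fun _ => 0). split; auto.
  - intros (_ & f & Hf & H) c Hc t j. specialize (H c Hc t j).
    rewrite (filter_ext_in _ (fun i => (f i =? j) && activeb I i t)); auto.
    intros a Ha. specialize (Hf a Ha). now replace (f a) with 0 by lia.
Qed.

Lemma feasible_reach d I k r : Permutation r (filter (nonempty I) (seq 0 (n_req I))) -> 0 < k ->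
  (exists w, reach d I k r w) <-> feasible d I k.
Proof.
  intros P Hk. rewrite (feasible_fits d I k r P). split.
  - intros (w & f & Hf & H & _). split; [now right|]. exists f. auto.
  - intros (_ & f & Hf & H). exists (map f (act I r)), f. auto.
Qed.

Lemma main_cmd_spec d I k h lim s :
  (d + 2) * (n_req I + 1) <= lim -> 0 < n_req I -> is_height I h ->
  let s' := eval (encode d I k) lim (main_cmd d) s in
  let n := n_req I in
  (vars s' vRES = 1 <-> feasible d I k) /\
  clk s' <= clk s + main_factor d * (k ^ (2 * h) * n + n * Nat.log2 n) + main_factor d.
Proof.
  intros Hlim Hn Hh. cbv zeta. unfold main_cmd. rewrite eval_seq, eval_ifle.
  destruct (init_cmd_spec d I k lim Hlim s) as [He1 T1].
  set (s1 := eval _ _ (init_cmd d) s) in *. clearbody s1.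
  rewrite (env_K _ _ _ _ He1), (env_0 _ _ _ _ He1).
  set (n := n_req I) in *. set (L := n * Nat.log2 n).
  assert (n <= L + 1 /\ Nat.log2 n <= L) as [HnL HlL].
  { unfold L. destruct (Nat.eq_dec n 1) as [->|Hne]; [cbn; lia|].
    assert (1 <= Nat.log2 n) by (apply (Nat.log2_le_mono 2); lia). nia. }
  destruct (Nat.leb_spec k 0) as [H0|H0].
  { ev. split.
    - split; [lia|]. intros (f & Hf & _). specialize (Hf 0). lia.
    - unfold main_factor. nia. }
  rewrite eval_seq, eval_ifle.
  assert (env d I k (tick s1)) as He1' by (constructor; apply He1).
  destruct (prepare_cmd_spec d I k lim Hlim (tick s1) He1') as (He2 & Hj & HN & T2).
  set (s2 := eval _ _ prepare_cmd _) in *. clearbody s2.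
  cbn [tick clk] in T2. fold n in HN, T2.
  assert ((Nat.log2 n + 1) * (28 * n + 10) <= 38 * L + 28 * n + 10) as HT by (unfold L; lia).
  rewrite (env_K _ _ _ _ He2), (env_1 _ _ _ _ He2).
  assert (env d I k (tick s2)) as He3 by (constructor; apply He2).
  assert (jobs I (tick s2)) as Hj3 by (constructor; apply Hj).
  assert (Permutation (rev (seg (arrs s2 aX) 0 (vars s2 vM))) (filter (nonempty I) (seq 0 n))) as P.
  { rewrite <- Permutation_rev. apply Hj. }
  destruct (Nat.leb_spec k 1) as [H1|H1].
  - assert (k = 1) as -> by lia.
    destruct (sweep_cmd_spec d I 1 lim Hlim (tick s2) He3 Hj3) as [R1 R2].
    cbn [tick vars arrs clk] in R1, R2. set (s3 := eval _ _ sweep_cmd _) in *. clearbody s3.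
    split.
    + rewrite R1. now apply feasible_one_bin.
    + rewrite Nat.pow_1_l, Nat.mul_1_l.
      assert (d * (8 + 32 * vars s2 vM) <= d * (8 + 32 * n)) by (apply Nat.mul_le_mono_l; lia).
      assert (d * n <= d * (L + 1)) by now apply Nat.mul_le_mono_l.
      unfold main_factor. lia.
  - destruct (dynamic_cmd_spec d I k lim Hlim H1 (tick s2) h He3 Hj3 Hh) as [R1 R2].
    cbn [tick vars arrs clk] in R1, R2. set (s3 := eval _ _ dynamic_cmd _) in *. clearbody s3.
    split.
    + rewrite R1. now apply feasible_reach.
    + replace (2 * h) with (h + h) by lia. rewrite Nat.pow_add_r. set (B := k ^ h * k ^ h) in *.
      assert (vars s2 vM * ((155 + 18 * d) * B) <= n * ((155 + 18 * d) * B)) by now apply Nat.mul_le_mono_r.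
      unfold main_factor. lia.
Qed.

(* For every fixed dimension d there is a RAM program that, on input a DVBP
   instance I (n requests, height h) and a number k, halts after
   O(k^(2h) * n + n log n) steps with M[0] = 1 iff I can be packed in k bins. *)
Theorem theorem1 :
  forall d : nat,
  exists (P : program) (C : nat),
    forall (I : instance) (k h : nat),
      is_height I h ->
      exists (s pc' : nat) (m' : memory),
        runs P (0, encode d I k) s (pc', m') /\
        s <= C * (k ^ (2 * h) * n_req I + n_req I * Nat.log2 (n_req I)) + C /\
        (m' 0 = 1 <-> feasible d I k).
Proof.
  intros d. exists (link d (main_cmd d) vRES).
  exists (length (boot_head d 0) + 4 + ram_factor * main_factor d).
  intros I k h Hh. destruct (Nat.eq_dec (n_req I) 0) as [Hn|Hn].
  - destruct (boot_zero d I k (main_cmd d) vRES Hn) as (m' & H1 & H2).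
    exists 4. eexists. exists m'. split; [exact H1|]. split; [lia|]. split; auto. intros _.
    exists (fun _ => 0). rewrite Hn. split; [intros; lia|]. intros. cbn. lia.
  - destruct (boot_correct d I k (main_cmd d) vRES) as (lim & s0 & t & pc & m' & A & B & C & D & E).
    { lia. } { apply main_cmd_wf. } { unfold NV. lia. }
    destruct (main_cmd_spec d I k h lim s0 A ltac:(lia) Hh) as [F G].
    exists t, pc, m'. split; [exact C|]. split; [|now rewrite E].
    rewrite B in G. set (Q := k ^ (2 * h) * n_req I + n_req I * Nat.log2 (n_req I)) in *.
    etransitivity; [exact D|]. etransitivity; [apply Nat.add_le_mono_l, Nat.mul_le_mono_l, G|]. lia.
Qed.
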